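(* For every integer $k\ge 2$ there is an $\varepsilon>0$ such that for every $(n,d,\lambda)$-graph $G$ with $d\ge 1$: (a) if $\lambda\le\varepsilon d^{5/2}n^{-3/2}$, then $G$ contains a square (second power) of a Hamilton cycle; (b) if $\lambda\le\varepsilon d^{3k/2}n^{1-3k/2}$, then $G$ contains a $k$th power of a Hamilton cycle.
   Context: Graphs are finite and simple. For a graph $G$ whose adjacency matrix has eigenvalues $\lambda_1\ge\lambda_2\ge\dots\ge\lambda_n$, put $\lambda(G):=\max\{|\lambda_2|,|\lambda_n|\}$. An $(n,d,\lambda)$-graph is a $d$-regular graph $G$ on $n$ vertices with $\lambda(G)\le\lambda$. The $k$th power of a graph $H$ is the graph on $V(H)$ in which two distinct vertices are adjacent if and only if their distance in $H$ is at most $k$. $G$ contains a $k$th power of a Hamilton cycle if it contains, as a (not necessarily induced) spanning subgraph, the $k$th power of a cycle through all vertices of $G$. *)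

(* Defs.v *)
From HB Require Import structures.
From mathcomp Require Import all_boot all_order all_algebra.
From mathcomp Require Import spectral complex.
From mathcomp Require Import reals.

Set Implicit Arguments.
Unset Strict Implicit.
Unset Printing Implicit Defensive.

Import Order.TTheory GRing.Theory Num.Theory.

Record sgraph := SGraph {
  svertex :> finType;
  sedge : rel svertex;
  sedge_sym : symmetric sedge;
  sedge_irrefl : irreflexive sedge }.

Definition regular (G : sgraph) (d : nat) : Prop :=
  forall x : G, #|[set y : G | sedge x y]| = d.

Definition has_walk (G : sgraph) (x y : G) (m : nat) : bool :=
  [exists p : m.-tuple G, path (@sedge G) x p && (last x p == y)].

(* The least length of a walk from x to y; the value is only meaningful when x
   and y are connected, in which case that length is less than #|G|. *)
Definition graph_dist (G : sgraph) (x y : G) : nat :=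
  find (has_walk x y) (iota 0 #|G|).

Definition power_edge (k : nat) (H : sgraph) : rel H :=
  fun x y => [&& x != y, connect (@sedge H) x y & graph_dist x y <= k].

Lemma has_walkP (G : sgraph) (x y : G) m :
  reflect (exists p, [/\ size p = m, path (@sedge G) x p & last x p = y])
          (has_walk x y m).
Proof.
apply: (iffP existsP) => [[p /andP[xp /eqP ly]] | [p [<- xp ly]]].
  by exists p; rewrite size_tuple.
by exists (in_tuple p); rewrite /= xp ly eqxx.
Qed.

Lemma has_walk_sym (G : sgraph) (x y : G) : has_walk x y =1 has_walk y x.
Proof.
suff W (u v : G) m : has_walk u v m -> has_walk v u m.
  by move=> m; apply/idP/idP; apply: W.
case/has_walkP => p [sp up <-]; apply/has_walkP.
exists (rev (belast u p)); split; first by rewrite size_rev size_belast.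
  rewrite rev_path; apply: sub_path up => a b.
  by rewrite sedge_sym.
by case: p {sp up} => //= a p; rewrite rev_cons last_rcons.
Qed.

Lemma power_edge_sym k (H : sgraph) : symmetric (@power_edge k H).
Proof.
move=> x y; rewrite /power_edge eq_sym (sym_connect_sym (@sedge_sym H)).
by rewrite /graph_dist (eq_find (has_walk_sym x y)).
Qed.

Lemma power_edge_irrefl k (H : sgraph) : irreflexive (@power_edge k H).
Proof. by move=> x; rewrite /power_edge eqxx. Qed.

Definition graph_power (k : nat) (H : sgraph) : sgraph :=
  SGraph (@power_edge_sym k H) (@power_edge_irrefl k H).

Lemma power_edgeP k (H : sgraph) (x y : H) :
  reflect (x != y /\ exists p,
             [/\ size p <= k, path (@sedge H) x p & last x p = y])
          (sedge (x : graph_power k H) y).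
Proof.
have W (p : seq H) : path (@sedge H) x p -> last x p = y ->
    graph_dist x y < #|H| /\ graph_dist x y <= size p.
  move=> xp; case: (shortenP xp) => q xq uq sqp ly.
  have ltq : size q < #|H| by have := max_card (mem (x :: q)); rewrite (card_uniqP uq).
  have wq : has_walk x y (size q) by apply/has_walkP; exists q.
  have ltd : graph_dist x y <= size q.
    rewrite leqNgt; apply/negP => /(before_find 0).
    by rewrite nth_iota // add0n wq.
  by split; [apply: leq_ltn_trans ltq | apply: leq_trans ltd (uniq_leq_size (proj2 (andP uq)) sqp)].
apply: (iffP and3P) => [[xy /connectP[p xp ly] dk] | [xy [p [sp xp ly]]]].
  split=> //; have [dn _] := W p xp (esym ly).
  have := @nth_find _ 0 (has_walk x y) (iota 0 #|H|).
  rewrite has_find size_iota -/(graph_dist x y) dn nth_iota // add0n => /(_ isT).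
  by case/has_walkP => q [sq xq lq]; exists q; rewrite sq.
have [_ dp] := W p xp ly; split=> //; last exact: leq_trans sp.
by apply/connectP; exists p.
Qed.

(* For n >= 3 this is the cycle on n vertices. *)
Definition cycle_edge (n : nat) : rel 'I_n :=
  fun i j => (i != j) && ((j == ordS i) || (i == ordS j)).

Lemma cycle_edge_sym n : symmetric (@cycle_edge n).
Proof. by move=> i j; rewrite /cycle_edge eq_sym orbC. Qed.

Lemma cycle_edge_irrefl n : irreflexive (@cycle_edge n).
Proof. by move=> i; rewrite /cycle_edge eqxx. Qed.

Definition cycle_graph (n : nat) : sgraph :=
  SGraph (@cycle_edge_sym n) (@cycle_edge_irrefl n).

Definition contains_spanning (G H : sgraph) : Prop :=
  exists2 f : H -> G, bijective f &
    forall x y : H, sedge x y -> sedge (f x) (f y).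

Definition contains_ham_power (k : nat) (G : sgraph) : Prop :=
  (3 <= #|G|)%N /\ contains_spanning G (graph_power k (cycle_graph #|G|)).

Local Open Scope ring_scope.

Definition adjmx (R : realType) (G : sgraph) : 'M[R]_#|G| :=
  \matrix_(i, j) (sedge (enum_val i) (enum_val j))%:R.

Lemma tr_adjmx (R : realType) (G : sgraph) : (adjmx R G)^T = adjmx R G.
Proof. by apply/matrixP => i j; rewrite !mxE sedge_sym. Qed.

Lemma char_poly_sym_split (R : realType) n (A : 'M[R]_n) :
  A^T = A -> exists s : seq R, char_poly A == \prod_(x <- s) ('X - x%:P).
Proof.
move=> symA; pose f := real_complex R; pose B : 'M[R[i]]_n := map_mx f A.
have hB : B \is hermsymmx.
  apply: realsym_hermsym.
    by apply/is_hermitianmxP; rewrite expr0 scale1r map_mx_id // map_trmx symA.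
  by apply/mxOverP => i j; rewrite mxE; apply/complex_realP; exists (A i j).
have /orthomx_spectralP defB := hermitian_normalmx hB.
have /mxOverP realD := hermitian_spectral_diag_real hB.
have uP := spectral_unit B.
set P := spectralmx B in defB uP; set D := spectral_diag B in defB realD.
exists [seq complex.Re (D 0 i) | i <- enum 'I_n]; apply/eqP.
apply: (@map_poly_inj _ _ f); rewrite map_char_poly -/B.
rewrite rmorph_prod big_map big_enum /=.
transitivity (char_poly (diag_mx D)).
  rewrite defB /char_poly; set DD := diag_mx D.
  pose Q := map_mx (@polyC R[i]) P; pose Q' := map_mx (@polyC R[i]) (invmx P).
  have Q'Q : Q' *m Q = 1%:M by rewrite -map_mxM mulVmx // map_mx1.
  have -> : char_poly_mx (invmx P *m DD *m P) = Q' *m char_poly_mx DD *m Q.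
    rewrite /char_poly_mx mulmxBr mulmxBl !map_mxM.
    by rewrite scalar_mxC -(mulmxA _%:M) Q'Q mulmx1.
  by rewrite !det_mulmx mulrAC -det_mulmx Q'Q det1 mul1r.
rewrite char_poly_trig; last exact: diag_mx_is_trig.
apply: eq_bigr => i _; rewrite rmorphB /= map_polyX map_polyC /= mxE eqxx mulr1n.
by have /RRe_real /= -> := realD 0 i.
Qed.

(* The eigenvalues, with multiplicity, in nonincreasing order. *)
Definition adj_spectrum (R : realType) (G : sgraph) : seq R :=
  sort >=%R (xchoose (char_poly_sym_split (tr_adjmx R G))).

Lemma adj_spectrum_char_poly (R : realType) (G : sgraph) :
  char_poly (adjmx R G) = \prod_(x <- adj_spectrum R G) ('X - x%:P).
Proof.
rewrite (eqP (xchooseP (char_poly_sym_split (tr_adjmx R G)))).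
by apply: perm_big; rewrite perm_sym perm_sort.
Qed.

Lemma adj_spectrum_sorted (R : realType) (G : sgraph) :
  sorted >=%R (adj_spectrum R G).
Proof. exact: (sort_sorted (fun x y => le_total y x)). Qed.

Lemma size_adj_spectrum (R : realType) (G : sgraph) :
  size (adj_spectrum R G) = #|G|.
Proof.
have := size_char_poly (adjmx R G).
by rewrite adj_spectrum_char_poly size_prod_XsubC => -[].
Qed.

(* Indices start at 0, so entries 1 and #|G|.-1 are the second largest and the
   smallest eigenvalue; this needs at least two vertices. *)
Definition graph_lambda (R : realType) (G : sgraph) : R :=
  Num.max `|(adj_spectrum R G)`_1| `|(adj_spectrum R G)`_(#|G|.-1)|.

(* The graph with no vertices is vacuously d-regular for every d and has no
   eigenvalues; it is excluded. *)
Definition ndl_graph (R : realType) (n d : nat) (lambda : R) (G : sgraph) : Prop :=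
  [/\ (0 < n)%N, #|G| = n, regular G d & graph_lambda R G <= lambda].

(* Main.v *)
Require Import Defs.
From mathcomp Require Import all_boot all_order all_algebra.
From mathcomp Require Import spectral complex boolp reals exp.
From mathcomp Require Import zify ring lra.

Set Implicit Arguments.
Unset Strict Implicit.
Unset Printing Implicit Defensive.

Import Order.TTheory GRing.Theory Num.Theory.

(* The spectral hypothesis is used only through the expander mixing inequality: sets of
   about p^i n and p^j n vertices, p = d / n, have the right number of edges between
   them when i + j <= J, where J = 3 in (a) and J = 3k - 2 in (b).

   Connecting. From a given end of a k-path, reach a k-clique in prescribed linear-sized
   sets. "For almost all a, for almost all neighbours b of a" can be exchanged into "for
   almost all b, for almost all neighbours a of b" by double counting, so the oldest
   vertex of the moving clique can be chosen last, from a large set, and then dropped in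
   favour of a new one. After k such steps almost every clique has been reached; doing
   this from two ends gives a connecting path.

   Absorbing. Each vertex v has an absorber, a bounded k-path that can take in v without
   changing its end cliques. Absorbers are strung together by connecting paths. As long
   as the ambient set is linear-sized, only O(eta p^J n) vertices have too few neighbours
   in it; these exceptional vertices are postponed to an ambient set that has hardly been
   used. A small reservoir is absorbed first; then the remaining vertices are processed
   inside their own set until few of them are left, these are processed inside the
   reservoir, the path is closed through it, and the unused vertices are absorbed. *)

(** The exponents come from squaring the hypothesis: with p = d / n it gives lambda^2 <= eps^2 p^5
    n^2 in (a) and eps^2 p^(3k) n^2 in (b), that is, p^(J + 2) n^2 with J = 3 and J = 3k - 2.
    Connecting is what fixes 3k - 2: next to a given end, the first new vertex has about p^k n
    candidates; chosen last, after k - 1 other clique vertices, it has about p^(2k - 1) n, and these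
    must be seen from a set of size about p^(k - 1) n. The simple absorber, a k-path on 2k vertices
    inside the neighbourhood of v, asks for J >= 2k + 1, which 3k - 2 satisfies once k >= 3. For k =
    2 the two arguments ask for J >= 4 and J >= 5, so (a) has connecting and absorbing arguments of
    its own, and (b) for k = 2 is a consequence of (a). Sizes are tracked only up to constants and
    powers of p. Absorbers and connections have length bounded in terms of k, and the iteration over
    the vertices of the graph keeps its constants, so one threshold on eta is enough. *)

(** * Power paths as sequences of vertices *)

Section PowerPaths.
Implicit Types (G : sgraph) (k : nat).

Fixpoint kpath G k (s : seq G) : bool :=
  if s is x :: s' then all (sedge x) (take k s') && kpath k s' else true.

Lemma kpathP G k x0 (s : seq G) :
  reflect (forall i j, i < j < size s -> j <= i + k ->
             sedge (nth x0 s i) (nth x0 s j)) (kpath k s).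
Proof.
elim: s => [|x s IH] /=; first by constructor=> i j; rewrite ltn0 andbF.
apply: (iffP andP) => [[/(all_nthP x0) h /IH hs] [|i] [|j] //= lt le | h].
- have ltj : j < size (take k s).
    by rewrite size_take; case: ifP; move: lt le; lia.
  by have := h j ltj; rewrite nth_take //; lia.
- by apply: hs; lia.
split; last by apply/IH => i j lt le; apply: (h i.+1 j.+1); lia.
apply/(all_nthP x0) => j; rewrite size_take_min => ltj.
by rewrite nth_take; [apply: (h 0 j.+1); lia | lia].
Qed.

Lemma kpath_rev G k (s : seq G) : kpath k (rev s) = kpath k s.
Proof.
suff h (t : seq G) : kpath k t -> kpath k (rev t).
  by apply/idP/idP => /h; rewrite ?revK.
case: t => // x t; move/(kpathP _ x) => h; apply/(kpathP _ x) => i j.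
rewrite size_rev => lt le; rewrite !nth_rev; try lia.
rewrite sedge_sym; apply: h; move: lt le; lia.
Qed.

Lemma kpath_catl G k (s t : seq G) : kpath k (s ++ t) -> kpath k s.
Proof.
case: s => // x s /(kpathP _ x) h; apply/(kpathP _ x) => i j lt le.
have := h i j; rewrite !nth_cat size_cat.
have -> : i < size (x :: s) by lia.
have -> : j < size (x :: s) by lia.
by apply => //; lia.
Qed.

Lemma kpath_catr G k (s t : seq G) : kpath k (s ++ t) -> kpath k t.
Proof. by elim: s => //= x s IH /andP[_ /IH]. Qed.

(** A required adjacency spans at most k places, so it cannot jump over [b]. *)
Lemma kpath_cat3 G k (a b c : seq G) : k <= size b ->
  kpath k (a ++ b) -> kpath k (b ++ c) -> kpath k (a ++ b ++ c).
Proof.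
move=> kb; elim: a => //= x a IH /andP[hx ha] hb; rewrite IH // andbT.
by rewrite catA takel_cat // size_cat; lia.
Qed.

(** Insertion only increases the distances between old vertices, so no new adjacency among them is
    required. *)
Lemma kpath_insert G k (s t : seq G) r : all (sedge r) s -> all (sedge r) t ->
  kpath k (s ++ t) -> kpath k (s ++ r :: t).
Proof.
elim: s => [|x s IH] /=.
  move=> _ rt ->; rewrite andbT; apply/allP => y /mem_take.
  by move/allP: rt; apply.
move=> /andP[rx rs] rt /andP[hx hs]; rewrite IH // andbT.
apply/allP => y; rewrite !take_cat; rewrite take_cat in hx.
case: ltnP => [ls|ls]; rewrite ?ls in hx.
  by move/allP: hx; apply.
rewrite ltnNge ls /= all_cat in hx; case/andP: hx => hx1 hx2.
rewrite mem_cat => /orP[|]; first by move/allP: hx1; apply.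
case: (k - size s) hx2 => // m hx2; rewrite /= inE => /orP[/eqP->|ym].
  by rewrite sedge_sym.
by move: ym; rewrite -(@take_takel _ m m.+1 t) // => /mem_take; apply/allP.
Qed.

Lemma pairwise_kpath G k (s : seq G) : pairwise (@sedge G) s -> kpath k s.
Proof.
elim: s => //= x s IH /andP[hx /IH->]; rewrite andbT.
by apply/allP => y /mem_take ys; move/allP: hx; apply.
Qed.

Definition cnb G (s : seq G) : {set G} := [set v | all (fun u => sedge u v) s].

Lemma cnb_nil G : @cnb G [::] = setT.
Proof. by apply/setP => v; rewrite !inE. Qed.

Lemma cnb_cons G (x : G) s : cnb (x :: s) = [set u | sedge x u] :&: cnb s.
Proof. by apply/setP => v; rewrite !inE. Qed.

Lemma cnb_perm G (s t : seq G) : s =i t -> cnb s = cnb t.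
Proof. by move=> st; apply/setP => v; rewrite !inE; apply: eq_all_r. Qed.

Lemma in_cnb G (s : seq G) v : (v \in cnb s) = all (sedge v) s.
Proof. by rewrite inE; apply: eq_all => u; rewrite sedge_sym. Qed.

Definition trace G (s : seq G) (Ds : seq {set G}) : bool :=
  all2 (fun v (D : {set G}) => v \in D) s Ds.

Lemma trace_size G (s : seq G) Ds : trace s Ds -> size s = size Ds.
Proof. by elim: s Ds => [|x s IH] [|D Ds] //= /andP[_ /IH->]. Qed.

Lemma trace_cat G (s t : seq G) Ds Es :
  trace s Ds -> trace t Es -> trace (s ++ t) (Ds ++ Es).
Proof. by elim: s Ds => [|x s IH] [|D Ds] //= /andP[-> /IH h]; apply: h. Qed.

Lemma trace_rev G (s : seq G) Ds : trace s Ds -> trace (rev s) (rev Ds).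
Proof.
elim: s Ds => [|x s IH] [|D Ds] //= /andP[xD /IH h].
by rewrite !rev_cons -!cats1; apply: trace_cat => //=; rewrite xD.
Qed.

Lemma trace_nth G (x0 : G) (s : seq G) Ds :
  trace s Ds -> forall i, i < size s -> nth x0 s i \in nth set0 Ds i.
Proof.
elim: s Ds => [|x s IH] [|D Ds] //= /andP[xD /IH h] [|i] //=; exact: h.
Qed.

Lemma trace_uniq G (s : seq G) Ds :
  pairwise (fun A B : {set G} => [disjoint A & B]) Ds -> trace s Ds -> uniq s.
Proof.
elim: s Ds => [|x s IH] [|D Ds] //= /andP[dD dDs] /andP[xD tr].
rewrite (IH Ds) // andbT; apply/negP => xs.
have /(nthP x)[i lti xi] := xs.
have := trace_nth x tr lti; rewrite xi => xDi.
have := all_nthP set0 dD i; rewrite -(trace_size tr) => /(_ lti).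
by move/disjointFr/(_ xD); rewrite xDi.
Qed.

Lemma trace_mem G (s : seq G) Ds (U : {set G}) : trace s Ds ->
  all (fun D : {set G} => D \subset U) Ds -> {subset s <= U}.
Proof.
elim: s Ds => [|x s IH] [|D Ds] //= /andP[xD tr] /andP[sD sDs] y.
by rewrite inE => /orP[/eqP->|]; [exact: (subsetP sD) | exact: (IH Ds)].
Qed.

(** Boolean, through [asbool], so that it can be the predicate of [almost_cliques]; [u] is the
    clique at the moving end. *)
Definition reach G k (x : seq G) (Ds : seq {set G}) (u : seq G) : bool :=
  `[< exists2 z, trace z Ds & kpath k (x ++ z ++ u) >].

End PowerPaths.

Local Open Scope ring_scope.

Ltac pos := solve [repeat first
  [ assumption | done | by apply: ltW | apply: exprn_gt0 | apply: exprn_ge0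
  | apply: mulr_gt0 | apply: mulr_ge0 | apply: addr_gt0 | apply: addr_ge0
  | rewrite invr_gt0 | rewrite invr_ge0 | rewrite ltr0n ]].

(** * Edge counts between vertex sets, and exceptional vertices *)

Section Jumbled.
Variable R : realType.
Implicit Types (G : sgraph) (p c d eta : R) (i j k J : nat).

Local Notation "## A" := (#|A|%:R : R) (at level 10, A at level 8).

Definition nb (G : sgraph) (v : G) : {set G} := [set u | sedge v u].

Definition edges (G : sgraph) (X Y : {set G}) : R :=
  \sum_(x in X) ##(nb x :&: Y).

(* With [eta = lambda ^ 2 / (p ^ (J + 2) * n ^ 2)], the edges between a set of about
   [p ^ i * n] and one of about [p ^ j * n] vertices are well distributed as soon as
   [i + j <= J] and [eta] is small. *)
Definition jumbled (G : sgraph) (p : R) (J : nat) (eta : R) : Prop :=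
  [/\ 0 < p, p <= 1, (0 < #|G|)%N, forall v : G, ##(nb v) = p * ##G
    & forall X Y : {set G},
      (edges X Y - p * ##X * ##Y) ^+ 2
        <= eta * p ^+ (J + 2) * ##G ^+ 2 * (##X * ##Y)].

Definition almost (G : sgraph) (d : R) (A : {set G}) (P : pred G) : bool :=
  ##[set a in A | ~~ P a] <= d * ##A.

(** The error is measured by the ambient sets, so exceptional subsets of unknown size can be tested
    against it. *)
Definition mixing (G : sgraph) (p d : R) (A B : {set G}) : Prop :=
  forall A' B' : {set G}, A' \subset A -> B' \subset B ->
    `|edges A' B' - p * ##A' * ##B'| <= d * p * ##A * ##B.

Lemma edges_cards (G : sgraph) (X Y : {set G}) :
  edges X Y = \sum_(x in X) \sum_(y in Y) (sedge x y)%:R.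
Proof.
apply: eq_bigr => x _; rewrite -sum1_card natr_sum big_mkcond /=.
rewrite [RHS]big_mkcond /=; apply: eq_bigr => y _.
by rewrite !inE; case: sedge; case: (y \in Y).
Qed.

Lemma edgesC (G : sgraph) (X Y : {set G}) : edges X Y = edges Y X.
Proof.
rewrite !edges_cards exchange_big /=; apply: eq_bigr => y _.
by apply: eq_bigr => x _; rewrite sedge_sym.
Qed.

Lemma edges11 (G : sgraph) (v : G) : edges [set v] [set v] = 0.
Proof.
rewrite /edges big_set1; apply/eqP; rewrite pnatr_eq0 cards_eq0 -subset0.
by apply/subsetP => u; rewrite !inE => /andP[+ /eqP uv]; rewrite uv sedge_irrefl.
Qed.

(** A single vertex spans no edge although p are expected, so the error term cannot vanish. *)
Lemma jumbled_eta_gt0 G p J eta : jumbled G p J eta -> 0 < eta.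
Proof.
move=> [p0 p1 n0 _ jum]; have /card_gt0P[v _] := n0.
have := jum [set v] [set v]; rewrite edges11 cards1 !mulr1 sub0r sqrrN.
move=> /(lt_le_trans (exprn_gt0 2 p0)).
by rewrite pmulr_lgt0 ?exprn_gt0 ?ltr0n // pmulr_lgt0 ?exprn_gt0.
Qed.

Lemma jumbled_mono G p J eta J' eta' :
  jumbled G p J eta -> eta <= eta' -> (J' <= J)%N -> jumbled G p J' eta'.
Proof.
move=> j le_eta leJ; have e0 := jumbled_eta_gt0 j; move: j => [p0 p1 n0 dg jum].
split=> // X Y; apply: (le_trans (jum X Y)).
have pJ : p ^+ (J + 2) <= p ^+ (J' + 2).
  by apply: ler_wiXn2l => //; [exact: ltW|rewrite leq_add2r].
do 2![apply: ler_wpM2r; first by rewrite ?mulr_ge0 ?exprn_ge0].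
by apply: ler_pM => //; [exact: ltW|rewrite exprn_ge0 // ltW].
Qed.

Lemma edges_le (G : sgraph) (X Y : {set G}) (m : R) :
  (forall x, x \in X -> ##(nb x :&: Y) <= m) -> edges X Y <= m * ##X.
Proof.
move=> h; apply: (@le_trans _ _ (\sum_(x in X) m)); first exact: ler_sum.
by rewrite sumr_const mulr_natr.
Qed.

Lemma edges_ge (G : sgraph) (X Y : {set G}) (m : R) :
  (forall x, x \in X -> m <= ##(nb x :&: Y)) -> m * ##X <= edges X Y.
Proof.
move=> h; apply: (@le_trans _ _ (\sum_(x in X) m)); last exact: ler_sum.
by rewrite sumr_const mulr_natr.
Qed.

(** The squared error is at most eta p^(J + 2) n^2 |A||B|, the permitted one is d^2 p^2 |A|^2 |B|^2,
    and |A||B| >= c^2 p^(i + j) n^2; this is where i + j <= J enters. *)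
Lemma jumbled_mixing G p J eta c d i j (A B : {set G}) :
  jumbled G p J eta -> 0 < c -> 0 < d -> eta <= (c * d) ^+ 2 ->
  (i + j <= J)%N -> c * p ^+ i * ##G <= ##A -> c * p ^+ j * ##G <= ##B ->
  mixing p d A B.
Proof.
move=> jG c0 d0 eta_le leJ hA hB A' B' sA sB.
have e0 := jumbled_eta_gt0 jG; move: jG => [p0 p1 n0 _ jum].
have pX m : 0 <= p ^+ m by rewrite exprn_ge0 // ltW.
have n0R : 0 < ##G by rewrite ltr0n.
rewrite -(@ler_pXn2r _ 2%N) ?nnegrE // ?mulr_ge0 //; [|exact: ltW..].
rewrite real_normK ?num_real //; apply: (le_trans (jum _ _)).
have hA' : ##A' <= ##A by rewrite ler_nat subset_leq_card.
have hB' : ##B' <= ##B by rewrite ler_nat subset_leq_card.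
apply: (@le_trans _ _ ((c * d) ^+ 2 * p ^+ (i + j + 2) * ##G ^+ 2 * (##A * ##B))).
  apply: ler_pM; rewrite ?mulr_ge0 ?(ltW e0) ?sqr_ge0 //.
  - apply: ler_wpM2r; first exact: sqr_ge0.
    apply: (@le_trans _ _ ((c * d) ^+ 2 * p ^+ (J + 2))).
      exact: ler_wpM2r.
    apply: ler_wpM2l; first exact: sqr_ge0.
    by apply: ler_wiXn2l => //; [exact: ltW|rewrite leq_add2r].
  - exact: ler_pM.
have -> : (c * d) ^+ 2 * p ^+ (i + j + 2) * ##G ^+ 2 * (##A * ##B)
  = d ^+ 2 * p ^+ 2 * (##A * ##B) * ((c * p ^+ i * ##G) * (c * p ^+ j * ##G)).
  by rewrite !exprD; ring.
have -> : (d * p * ##A * ##B) ^+ 2 = d ^+ 2 * p ^+ 2 * (##A * ##B) * (##A * ##B) by ring.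
apply: ler_wpM2l; first by pos.
by apply: ler_pM => //; pos.
Qed.

Lemma mixing_le (G : sgraph) p d (A B A' B' : {set G}) :
  mixing p d A B -> A' \subset A -> B' \subset B ->
  edges A' B' <= p * ##A' * ##B' + d * p * ##A * ##B.
Proof. by move=> h sA sB; have := h A' B' sA sB; rewrite ler_norml => /andP[]; lra. Qed.

Lemma mixing_ge (G : sgraph) p d (A B A' B' : {set G}) :
  mixing p d A B -> A' \subset A -> B' \subset B ->
  p * ##A' * ##B' - d * p * ##A * ##B <= edges A' B'.
Proof. by move=> h sA sB; have := h A' B' sA sB; rewrite ler_norml => /andP[]; lra. Qed.

Lemma mixingC (G : sgraph) p d (A B : {set G}) : mixing p d A B -> mixing p d B A.
Proof.
move=> h A' B' sA sB; have := h B' A' sB sA; rewrite edgesC.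
by rewrite -[p * _ * _]mulrA [##B' * _]mulrC mulrA -[d * p * _ * _]mulrA [##A * _]mulrC mulrA.
Qed.

Lemma mixing_sub (G : sgraph) p d d' (A B A' B' : {set G}) :
  mixing p d A B -> A' \subset A -> B' \subset B ->
  d * p * ##A * ##B <= d' * p * ##A' * ##B' -> mixing p d' A' B'.
Proof.
move=> h sA sB le A2 B2 sA2 sB2; apply: le_trans le; apply: h.
  exact: subset_trans sA2 sA.
exact: subset_trans sB2 sB.
Qed.

Lemma almost_sub G d d' (A : {set G}) (P Q : pred G) :
  almost d A P -> d <= d' -> (forall a, a \in A -> P a -> Q a) -> almost d' A Q.
Proof.
move=> h le PQ; apply: (@le_trans _ _ (d * ##A)); last exact: ler_wpM2r.
apply: le_trans h; rewrite ler_nat; apply/subset_leq_card/subsetP => a.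
by rewrite !inE => /andP[aA nQ]; rewrite aA /=; apply: contra nQ; apply: PQ.
Qed.

Lemma almost_and G d1 d2 (A : {set G}) (P Q : pred G) :
  almost d1 A P -> almost d2 A Q -> almost (d1 + d2) A (fun a => P a && Q a).
Proof.
rewrite /almost => h1 h2; rewrite mulrDl; apply: le_trans (lerD h1 h2).
rewrite -natrD ler_nat; apply: leq_trans (leq_card_setU _ _).
apply/subset_leq_card/subsetP => a; rewrite !inE negb_and.
by case: (a \in A).
Qed.

Lemma almost_card G d (A : {set G}) (P : pred G) :
  almost d A P -> (1 - d) * ##A <= ##[set a in A | P a].
Proof.
have E : ##A = ##[set a in A | P a] + ##[set a in A | ~~ P a].
  rewrite -natrD -(cardsID [set a | P a] A); congr (_ + _)%:R; apply: eq_card => a.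
    by rewrite !inE.
  by rewrite !inE andbC.
by rewrite /almost mulrDl mul1r mulNr => h; rewrite {1}E; lra.
Qed.

Lemma almost_ex G d (A : {set G}) (P : pred G) :
  almost d A P -> d < 1 -> 0 < ##A -> exists2 a, a \in A & P a.
Proof.
move=> /almost_card h d1 A0.
have : 0 < ##[set a in A | P a] by apply: lt_le_trans h; rewrite mulr_gt0 // subr_gt0.
by rewrite ltr0n => /card_gt0P[a]; rewrite inE => /andP[]; exists a.
Qed.

(** The exceptional set L sends at most half the expected number of edges to B, so p|L||B| / 2 is
    bounded by the error; hence the factor 2. *)
Lemma almost_low G p d (A B : {set G}) : 0 < p -> 0 < ##B ->
  mixing p d A B -> almost (2 * d) A (fun a => p * ##B / 2 <= ##(nb a :&: B)).
Proof.
move=> p0 B0 mix; rewrite /almost; set L := [set _ in _ | _].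
have sL : L \subset A by apply/subsetP => a; rewrite inE => /andP[].
have := mixing_ge mix sL (subxx _); have : edges L B <= p * ##B / 2 * ##L.
  by apply: edges_le => x; rewrite inE -ltNge => /andP[_ /ltW].
set e := edges _ _ => h h2.
have : p * ##B * (##L / 2) <= p * ##B * (d * ##A) by lra.
by rewrite ler_pM2l ?mulr_gt0 //; lra.
Qed.

Lemma almost_high G p d (A B : {set G}) : 0 < p -> 0 < ##B ->
  mixing p d A B -> almost d A (fun a => ##(nb a :&: B) <= 2 * p * ##B).
Proof.
move=> p0 B0 mix; rewrite /almost; set L := [set _ in _ | _].
have sL : L \subset A by apply/subsetP => a; rewrite inE => /andP[].
have : 2 * p * ##B * ##L <= edges L B.
  by apply: edges_ge => x; rewrite inE -ltNge => /andP[_ /ltW].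
have := mixing_le mix sL (subxx _); set e := edges _ _ => h h2.
have : p * ##B * (##L) <= p * ##B * (d * ##A) by lra.
by rewrite ler_pM2l ?mulr_gt0.
Qed.

Lemma almost_hit G p d (A B : {set G}) : 0 < p -> 0 < ##B ->
  mixing p d A B -> almost d A (fun a => nb a :&: B != set0).
Proof.
move=> p0 B0 mix; rewrite /almost; set L := [set _ in _ | _].
have sL : L \subset A by apply/subsetP => a; rewrite inE => /andP[].
have e0 : edges L B = 0.
  by rewrite /edges big1 // => x; rewrite !inE negbK => /andP[_ /eqP->]; rewrite cards0.
have := mixing_ge mix sL (subxx _); rewrite e0 => h.
have : p * ##B * (##L) <= p * ##B * (d * ##A) by lra.
by rewrite ler_pM2l ?mulr_gt0.
Qed.

(** Double counting of the bad edges, those where [Q] fails. Seen from A there are O(d p |A||B|) of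
    them, while an exceptional vertex of B has more than a fraction d' of its edges bad. Dividing by
    d' once, and asking for a result below d', explains the square. *)
Lemma almost_exchange (G : sgraph) p d d' (A B : {set G}) (Q : G -> G -> bool) :
  0 < p -> 0 < ##A -> 0 < d -> 0 < d' <= 1 -> d <= d' ^+ 2 / 8 -> mixing p d A B ->
  almost d A (fun a => almost d (nb a :&: B) (Q a)) ->
  almost d' B (fun b => almost d' (nb b :&: A) (Q^~ b)).
Proof.
move=> p0 A0 d0 /andP[d'0 d'1] dd' mix hA.
pose bad := \sum_(a in A) \sum_(b in B) (sedge a b && ~~ Q a b)%:R : R.
have cardE (X : {set G}) (v : G) (S : pred G) :
    ##[set b in nb v :&: X | ~~ S b] = \sum_(b in X) (sedge v b && ~~ S b)%:R.
  rewrite -sum1_card natr_sum big_mkcond /= [RHS]big_mkcond /=.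
  by apply: eq_bigr => y _; rewrite !inE; case: sedge; case: (y \in X); case: (S y).
set E := [set a in A | ~~ almost d (nb a :&: B) (Q a)].
have sE : E \subset A by apply/subsetP => a; rewrite inE => /andP[].
have hE : ##E <= d * ##A by [].
have eE : edges E B <= p * ##E * ##B + d * p * ##A * ##B.
  exact: mixing_le.
have eA : edges A B <= p * ##A * ##B + d * p * ##A * ##B.
  exact: mixing_le.
have d1 : d <= 1 by have : d' ^+ 2 <= 1 by [apply: exprn_ile1; rewrite // ltW]; lra.
have bad_le : bad <= 4 * d * (p * ##A * ##B).
  (* All edges at the exceptional set [E] are counted as bad, the others only up to the fraction
     [d]. *)
  have : bad <= edges E B + d * edges A B.
    rewrite /bad (big_setID E) /= (setIidPr sE); apply: lerD.
      rewrite /edges; apply: ler_sum => a _.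
      rewrite -cardE ler_nat; apply/subset_leq_card/subsetP => b.
      by rewrite inE => /andP[].
    rewrite /edges mulr_sumr [leRHS](big_setID E) /= (setIidPr sE).
    rewrite -[leLHS]add0r; apply: lerD.
      by apply: sumr_ge0 => a _; rewrite mulr_ge0 // ltW.
    apply: ler_sum => a; rewrite !inE => /andP[]; rewrite negb_and negbK.
    by move=> /orP[/negPf->//|h] _; rewrite -cardE.
  have pos : 0 <= p * ##B by rewrite mulr_ge0 // ltW.
  have h1 : p * ##B * ##E <= p * ##B * (d * ##A) by apply: ler_wpM2l.
  have h2 : d * edges A B <= d * (p * ##A * ##B + d * p * ##A * ##B).
    by apply: ler_wpM2l => //; apply: ltW.
  have h3 : d * (d * (p * ##A * ##B)) <= d * (1 * (p * ##A * ##B)).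
    apply: ler_wpM2l; first exact: ltW.
    by apply: ler_wpM2r => //; rewrite !mulr_ge0 // ltW.
  lra.
set F := [set b in B | ~~ almost d' (nb b :&: A) (Q^~ b)].
have sF : F \subset B by apply/subsetP => a; rewrite inE => /andP[].
have eF : p * ##F * ##A - d * p * ##B * ##A <= edges F A.
  exact: (mixing_ge (mixingC mix)).
have bad_ge : d' * edges F A <= bad.
  rewrite /bad exchange_big /= (big_setID F) /= (setIidPr sF).
  rewrite -[leLHS]addr0; apply: lerD; last first.
    by do 2![apply: sumr_ge0 => ? _].
  rewrite /edges mulr_sumr; apply: ler_sum => b; rewrite inE => /andP[_].
  rewrite /almost -ltNge => /ltW/le_trans; apply.
  by rewrite cardE; apply: ler_sum => a _; rewrite sedge_sym.
rewrite /almost -/F.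
have h : d' * (p * ##F * ##A - d * p * ##B * ##A) <= 4 * d * (p * ##A * ##B).
  apply: le_trans bad_le; apply: le_trans bad_ge; apply: ler_wpM2l => //; exact: ltW.
have h2 : p * ##A * (d' * ##F) <= p * ##A * ((4 * d + d' * d) * ##B) by lra.
rewrite ler_pM2l ?mulr_gt0 // in h2.
have h3 : (4 * d + d' * d) * ##B <= d' ^+ 2 * ##B.
  apply: ler_wpM2r => //.
  have : d' * d <= 1 * d by apply: ler_wpM2r => //; apply: ltW.
  have : 0 <= d' ^+ 2 by apply: sqr_ge0.
  lra.
by rewrite -(ler_pM2l d'0) mulrA -expr2; apply: le_trans h3.
Qed.

End Jumbled.

(** * Statements valid for small eta, and cliques chosen vertex by vertex *)

Section Eventually.
Variable R : realType.
Implicit Types (G : sgraph) (p c d eta : R) (i j k J : nat).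
Local Notation "## A" := (#|A|%:R : R) (at level 10, A at level 8).

(** The threshold depends on neither [G] nor [p]. Two such statements combine because a smaller eta
    is a stronger hypothesis. *)
Definition eventually J (Q : sgraph -> R -> Prop) : Prop :=
  exists2 eta, 0 < eta & forall G p, jumbled G p J eta -> Q G p.

Definition big G c p i (A : {set G}) : bool := c * p ^+ i * ##G <= ##A.

Lemma eventually_imp J (Q1 Q2 : sgraph -> R -> Prop) : eventually J Q1 ->
  (forall G p, 0 < p -> p <= 1 -> 0 < ##G -> Q1 G p -> Q2 G p) -> eventually J Q2.
Proof.
move=> [eta eta0 h] imp; exists eta => // G p jG; have := h _ _ jG.
by case: jG => p0 p1 n0 _ _; apply: imp; rewrite // ltr0n.
Qed.

Lemma eventually_and J (Q1 Q2 : sgraph -> R -> Prop) : eventually J Q1 -> eventually J Q2 ->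
  eventually J (fun G p => Q1 G p /\ Q2 G p).
Proof.
move=> [e1 e10 h1] [e2 e20 h2]; exists (Num.min e1 e2) => [|G p jG].
  by rewrite lt_min e10.
by split; [apply: h1 | apply: h2]; apply: jumbled_mono jG _ _; rewrite // ge_min lexx ?orbT.
Qed.

Lemma eventually_degree J : eventually J (fun G p => forall v : G, ##(nb v) = p * ##G).
Proof. by exists 1 => // G p []. Qed.

Lemma big_gt0 G c p i (A : {set G}) :
  0 < c -> 0 < p -> 0 < ##G -> big c p i A -> 0 < ##A.
Proof. by move=> c0 p0 n0; apply: lt_le_trans; pos. Qed.

Lemma bigW G c c' p i j (A B : {set G}) : 0 <= c' <= c -> 0 < p -> p <= 1 ->
  (i <= j)%N -> A \subset B -> big c p i A -> big c' p j B.
Proof.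
move=> /andP[c'0 cc'] p0 p1 ij AB; rewrite /big => h.
apply: (@le_trans _ _ (##A)); last by rewrite ler_nat subset_leq_card.
apply: le_trans h; apply: ler_wpM2r => //; apply: ler_pM => //; first by pos.
by apply: ler_wiXn2l => //; exact: ltW.
Qed.

(** The bookkeeping of one choice: restricting to a typical neighbourhood raises the exponent by one
    and halves the constant. *)
Lemma big_nb G c p i (A : {set G}) (x : R) :
  0 < p -> big c p i A -> p * ##A / 2 <= x -> c / 2 * p ^+ i.+1 * ##G <= x.
Proof.
move=> p0; rewrite /big => h; apply: le_trans.
have := ler_wpM2l (ltW p0) h; rewrite exprS.
have -> : p * (c * p ^+ i * ##G) = 2 * (c / 2 * (p * p ^+ i) * ##G) by field.
by lra.
Qed.

Lemma eventually_typical J c d : 0 < c -> 0 < d -> eventually J (fun G p =>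
  forall i j (A B : {set G}), (i + j <= J)%N -> big c p i A -> big c p j B ->
  [/\ mixing p d A B, almost d A (fun a => p * ##B / 2 <= ##(nb a :&: B)),
      almost d A (fun a => ##(nb a :&: B) <= 2 * p * ##B)
    & almost d A (fun a => nb a :&: B != set0)]).
Proof.
move=> c0 d0; have d2 : 0 < d / 2 by lra.
exists ((c * (d / 2)) ^+ 2) => [|G p jG i j A B ij hA hB]; first by pos.
have [p0 p1 n0 _ _] := jG.
have B0 : 0 < ##B by apply: big_gt0 hB; rewrite ?ltr0n.
have mix : mixing p (d / 2) A B by apply: jumbled_mixing jG _ _ _ ij hA hB.
have mixd : mixing p d A B.
  apply: mixing_sub mix _ _ _ => //.
  have h : 0 <= p * ##A * ##B by pos.
  by rewrite -!(mulrA _ p) -!(mulrA _ (p * _)); apply: ler_wpM2r; lra.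
split=> //; last 2 first.
- exact: almost_high mixd.
- exact: almost_hit mixd.
by have := almost_low p0 B0 mix; have -> : 2 * (d / 2) = d by field.
Qed.

Lemma eventually_exchange J c d' : 0 < c -> 0 < d' <= 1 -> eventually J (fun G p =>
  forall i j (A B : {set G}) (Q : G -> G -> bool), (i + j <= J)%N ->
  big c p i A -> big c p j B ->
  almost (d' ^+ 2 / 8) A (fun a => almost (d' ^+ 2 / 8) (nb a :&: B) (Q a)) ->
  almost d' B (fun b => almost d' (nb b :&: A) (Q^~ b))).
Proof.
move=> c0 d'01; have /andP[d'0 d'1] := d'01.
have d0 : 0 < d' ^+ 2 / 8 by pos.
apply: eventually_imp (eventually_typical J c0 d0) _ => G p p0 p1 n0 h i j A B Q ij hA hB.
have [mix _ _ _] := h _ _ _ _ ij hA hB.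
by apply: almost_exchange mix => //; apply: big_gt0 hA.
Qed.

Lemma almost_all G d (A : {set G}) (P : pred G) :
  0 <= d -> (forall a, a \in A -> P a) -> almost d A P.
Proof.
move=> d0 h; rewrite /almost (_ : [set _ in _ | _] = set0) ?cards0 ?mulr_ge0 //.
by apply/setP => a; rewrite !inE; apply/negP => /andP[/h->].
Qed.

(* A clique is chosen vertex by vertex, in [C :&: W] for the successive [W]; at each
   stage all but a [d]-fraction of the available vertices are acceptable. Since
   cliques are never counted, no upper bound on common neighbourhoods is needed. *)
Fixpoint almost_cliques G d (C : {set G}) (Ws : seq {set G}) (P : pred (seq G)) : bool :=
  if Ws is W :: Ws' then
    almost d (C :&: W) (fun a => almost_cliques d (C :&: nb a) Ws' (fun s => P (a :: s)))
  else P [::].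

Definition clique_in G (C : {set G}) Ws (s : seq G) : bool :=
  [&& trace s Ws, all (fun v => v \in C) s & pairwise (@sedge G) s].

Lemma clique_in_cons G (C W : {set G}) Ws a s :
  a \in C :&: W -> clique_in (C :&: nb a) Ws s -> clique_in C (W :: Ws) (a :: s).
Proof.
rewrite inE => /andP[aC aW] /and3P[tr sC pw]; rewrite /clique_in /= aC aW tr pw !andbT /=.
by apply/andP; split; apply/allP => v /(allP sC); rewrite !inE => /andP[].
Qed.

Lemma almost_cliques_sub G d d' (C : {set G}) Ws (P Q : pred (seq G)) : d <= d' ->
  (forall s, clique_in C Ws s -> P s -> Q s) -> almost_cliques d C Ws P -> almost_cliques d' C Ws Q.
Proof.
move=> dd'; elim: Ws C P Q => [|W Ws IH] C P Q PQ /=; first exact: PQ.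
move=> h; apply: almost_sub h dd' _ => a aW; apply: IH => s hs; apply: PQ.
exact: clique_in_cons.
Qed.

Lemma almost_cliques_all G d (C : {set G}) Ws (P : pred (seq G)) : 0 <= d ->
  (forall s, clique_in C Ws s -> P s) -> almost_cliques d C Ws P.
Proof.
move=> d0; elim: Ws C P => [|W Ws IH] C P hP /=; first exact: hP.
apply: almost_all => // a aW; apply: IH => s hs; apply: hP; exact: clique_in_cons.
Qed.

Lemma almost_cliques_and G d1 d2 (C : {set G}) Ws (P Q : pred (seq G)) : 0 <= d1 -> 0 <= d2 ->
  almost_cliques d1 C Ws P -> almost_cliques d2 C Ws Q -> almost_cliques (d1 + d2) C Ws (fun s => P s && Q s).
Proof.
move=> d10 d20; elim: Ws C P Q => [|W Ws IH] C P Q /=; first by move=> -> ->.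
move=> h1 h2; apply: almost_sub (almost_and h1 h2) _ _ => // a _ /andP[].
exact: IH.
Qed.

Definition bigs G c p (es : seq nat) (C : {set G}) Ws : bool :=
  all2 (fun e (W : {set G}) => big c p e (C :&: W)) es Ws.

Lemma eventually_bigs m J : forall c d, 0 < c -> 0 < d -> eventually J (fun G p =>
  forall i es (C A : {set G}) Ws, size Ws = m ->
  (forall e, e \in es -> (i + e <= J)%N) ->
  big c p i A -> bigs c p es C Ws ->
  almost d A (fun a => bigs (c / 2) p (map S es) (C :&: nb a) Ws)).
Proof.
elim: m => [|m IH] c d c0 d0.
  exists 1 => // G p _ i es C A [|//] _ _ _.
  case: es => // _; apply: almost_all => //; exact: ltW.
have d2 : 0 < d / 2 by lra.
apply: eventually_imp (eventually_and (IH c _ c0 d2) (eventually_typical J c0 d2)) _.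
move=> G p p0 p1 n0 [h1 h2] i [|e es] C A [|W Ws] //= [sz] ie hA /andP[hW hWs].
have ie0 : (i + e <= J)%N by apply: ie; rewrite inE eqxx.
have [_ low _ _] := h2 _ _ _ _ ie0 hA hW.
have hes : forall e, e \in es -> (i + e <= J)%N.
  by move=> e' he'; apply: ie; rewrite inE he' orbT.
have := almost_and low (h1 i es C A Ws sz hes hA hWs).
have -> : d / 2 + d / 2 = d by field.
move/almost_sub; apply => // a _ /andP[ha ->]; rewrite andbT.
rewrite /big -setIA setIC -setIA [W :&: C]setIC.
exact: (big_nb p0 hW).
Qed.

End Eventually.

(** * Changing the order in which the vertices of a clique are chosen *)

Section Chains.
Variable R : realType.
Implicit Types (G : sgraph) (p c d eta : R) (i j k J : nat).
Local Notation "## A" := (#|A|%:R : R) (at level 10, A at level 8).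

(** When the j-th vertex is chosen, its candidates have been cut down by j neighbourhoods, to
    exponent es_j + j; [f] bounds all these exponents. *)
Definition profile (f : nat) (es : seq nat) : Prop :=
  forall j, (j < size es)%N -> (nth 0%N es j + j <= f)%N.

Lemma profile_head f e es : profile f (e :: es) -> (e <= f)%N.
Proof. by move=> /(_ 0%N isT); rewrite /= addn0. Qed.

Lemma profile_tail f e es : profile f (e :: es) -> profile f (map S es).
Proof.
move=> h j; rewrite size_map => lt; have := h j.+1 lt.
by rewrite /= (nth_map 0%N) // addnS addSn.
Qed.

Lemma profile_le f e es e' : profile f (e :: es) -> e' \in es -> (e' <= f)%N.
Proof.
move=> h /(nthP 0%N)[j lt <-]; have := h j.+1 lt; rewrite /=; lia.
Qed.

Lemma bigs_size G c p es (C : {set G}) Ws : bigs c p es C Ws -> size es = size Ws.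
Proof. by elim: es Ws => [|e es IH] [|W Ws] //= /andP[_ /IH->]. Qed.

(** [almost_exchange] inside C, for the property that almost all completions of the edge ab are
    good. The list [u] begins with the vertex of W, so [P] still sees the original order and the
    default of [head] is never reached. *)
Lemma almost_cliques_swap_head J c d' : 0 < c -> 0 < d' <= 1 -> eventually J (fun G p =>
  forall e f (C W W2 : {set G}) Ws P, (e + f <= J)%N ->
  big c p e (C :&: W) -> big c p f (C :&: W2) ->
  almost_cliques (d' ^+ 2 / 8) C [:: W, W2 & Ws] P ->
  almost d' (C :&: W2) (fun b =>
    almost_cliques d' (C :&: nb b) (W :: Ws) (fun u => P (head b u :: b :: behead u)))).
Proof.
move=> c0 d'01; apply: eventually_imp (eventually_exchange J c0 d'01) _.
move=> G p p0 p1 n0 h e f C W W2 Ws P ef hW hW2 hP.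
pose Q a b := almost_cliques (d' ^+ 2 / 8) (C :&: nb a :&: nb b) Ws (fun s => P [:: a, b & s]).
have := h _ _ (C :&: W) (C :&: W2) Q ef hW hW2; move: hP => /= hP.
have {}hP : almost (d' ^+ 2 / 8) (C :&: W)
    (fun a => almost (d' ^+ 2 / 8) (nb a :&: (C :&: W2)) (Q a)).
  apply: almost_sub hP _ _ => // a _.
  by rewrite setIA [nb a :&: C]setIC.
move=> /(_ hP) h2; apply: almost_sub h2 _ _ => // b _.
rewrite setIA [nb b :&: C]setIC => h2; apply: almost_sub h2 _ _ => // a _.
rewrite /Q setIAC; apply: almost_cliques_sub => //.
have /andP[d'0 d'1] := d'01.
have : d' ^+ 2 <= d' by rewrite expr2 -[leRHS]mulr1; apply: ler_wpM2l => //; exact: ltW.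
by lra.
Qed.

(** W is swapped with each set of [Ws] in turn. After i swaps W has exponent e + i and its next
    partner at most f; the last swap, i = m - 1, accounts for e + f + m <= J + 1. The rotation of
    [s] restores the order seen by [P]. *)
Lemma almost_cliques_rot m J : forall c d' e f, 0 < c -> 0 < d' ->
  (e + f + m <= J.+1)%N -> (2 * f <= J)%N ->
  exists2 d : R, 0 < d & eventually J (fun G p => forall (C W : {set G}) Ws es P,
    size Ws = m -> profile f es -> big c p e (C :&: W) -> bigs c p es C Ws ->
    almost_cliques d C (W :: Ws) P -> almost_cliques d' C (rcons Ws W) (fun s => P (rotr 1 s))).
Proof.
elim: m => [|m IH] c d' e f c0 d'0 efm ff.
  by exists d' => //; exists 1 => // G p _ C W [|//] es P _ _ _ _ /=.
have c2 : 0 < c / 2 by lra.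
have [d1 d10 h1] := IH (c / 2) d' e.+1 f c2 d'0 ltac:(lia) ff.
pose d2 := Num.min (Num.min d1 (d' / 4)) 1.
have [d2d1 d2d' d21] : [/\ d2 <= d1, d2 <= d' / 4 & d2 <= 1].
  by split; rewrite /d2 !ge_min lexx ?orbT.
have d20 : 0 < d2 by rewrite /d2 !lt_min d10 ltr01 andbT /=; lra.
have d4 : 0 < d' / 4 by lra.
exists (d2 ^+ 2 / 8); first by pos.
have d201 : 0 < d2 <= 1 by rewrite d20.
apply: eventually_imp (eventually_and (eventually_and h1 (almost_cliques_swap_head J c0 d201))
  (eventually_and (eventually_bigs m J c0 d4) (eventually_typical J c0 d4))) _.
move=> G p p0 p1 n0 [[hIH hsw] [hb ht]] C W [|W2 Ws] //= [|e2 es] P // [sz] pf hW.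
move=> /andP[hW2 hWs] hP.
have e2f := profile_head pf.
have e2J : (e2 + e <= J)%N by clear -e2f efm; lia.
have esJ : forall e', e' \in es -> (e2 + e' <= J)%N.
  by move=> e' he'; have := profile_le pf he'; clear -e2f ff; lia.
have eJ : (e + e2 <= J)%N by clear -e2f efm; lia.
have sw := hsw _ _ _ _ _ Ws P eJ hW hW2 hP.
have bb := hb _ _ _ _ _ sz esJ hW2 hWs.
have [_ tt _ _] := ht _ _ _ _ e2J hW2 hW.
apply: almost_sub (almost_and (almost_and sw bb) tt) _ _; first by lra.
move=> b _ /andP[/andP[hb1 hb2] hb3].
have hW' : big (c / 2) p e.+1 (C :&: nb b :&: W).
  rewrite /big setIAC setIC; exact: (big_nb p0 hW).
have := hIH _ _ _ _ _ sz (profile_tail pf) hW' hb2 (almost_cliques_sub d2d1 (fun _ _ x => x) hb1).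
apply: almost_cliques_sub => // s /and3P[/trace_size] + _ _.
rewrite size_rcons; case/lastP: s => // s a _.
by rewrite -rcons_cons !rotr1_rcons.
Qed.

(** The last entry of [s] is new and [a] is the vertex it replaces; [a] sees all of [s], so that it
    can precede [s] on a k-path. *)
Definition with_predecessor G (C W : {set G}) (P : pred (seq G)) : pred (seq G) :=
  fun s => [exists a in C :&: W, all (sedge a) s && P (rcons (take (size s).-1 s) a)].

(** Once the other vertices are fixed, at least half of the candidates in W are good, a set of
    exponent e + m, and almost every candidate in Z has a neighbour among them. *)
Lemma almost_cliques_replace_last m J : forall c d' e f, 0 < c -> 0 < d' ->
  (e + f + m <= J)%N -> (2 * f <= J)%N ->
  exists2 d : R, 0 < d & eventually J (fun G p => forall (C W Z : {set G}) Ws es P,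
    size Ws = m -> profile f es -> big c p e (C :&: W) -> bigs c p es C (rcons Ws Z) ->
    almost_cliques d C (rcons Ws W) P -> almost_cliques d' C (rcons Ws Z) (with_predecessor C W P)).
Proof.
elim: m => [|m IH] c d' e f c0 d'0 efm ff.
  have c2 : 0 < c / 2 by lra.
  exists (1 / 2); first by lra.
  apply: eventually_imp (eventually_typical J c2 d'0) _.
  move=> G p p0 p1 n0 ht C W Z [|W1 Ws] //= [|e2 es] P //= _ pf hW /andP[hZ _] hP.
  have e2f := profile_head pf.
  set S := [set a in C :&: W | P [:: a]].
  have hS : big (c / 2) p e S.
    have := almost_card hP; rewrite /big in hW *.
    have -> : 1 - 1 / 2 = (1 / 2 : R) by field.
    by apply: le_trans; move: hW; rewrite -!mulrA; lra.
  have hZ' : big (c / 2) p e2 (C :&: Z).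
    by apply: bigW hZ => //; apply/andP; split; lra.
  have e2J : (e2 + e <= J)%N by clear -e2f efm; lia.
  have [_ _ _ hit] := ht _ _ _ _ e2J hZ' hS.
  apply: almost_sub hit _ _ => // z _ /set0Pn[a].
  rewrite !inE => /andP[za /andP[/andP[aC aW] Pa]].
  by apply/existsP; exists a; rewrite !inE aC aW /= sedge_sym za.
have c2 : 0 < c / 2 by lra.
have [d1 d10 h1] := IH (c / 2) (d' / 2) e.+1 f c2 ltac:(lra) ltac:(lia) ff.
have d4 : 0 < d' / 4 by lra.
exists (Num.min d1 (d' / 4)); first by rewrite lt_min d10.
have [d2d1 d2d'] : Num.min d1 (d' / 4) <= d1 /\ Num.min d1 (d' / 4) <= d' / 4.
  by split; rewrite !ge_min lexx ?orbT.
apply: eventually_imp (eventually_and h1 (eventually_and (eventually_bigs m.+1 J c0 d4) (eventually_typical J c0 d4))) _.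
move=> G p p0 p1 n0 [hIH [hb ht]] C W Z [|W2 Ws] //= [|e2 es] P // [sz] pf hW.
move=> /andP[hW2 hWs] hP.
have e2f := profile_head pf.
have e2J : (e2 + e <= J)%N by clear -e2f efm; lia.
have esJ : forall e', e' \in es -> (e2 + e' <= J)%N.
  by move=> e' he'; have := profile_le pf he'; clear -e2f ff; lia.
have szr : size (rcons Ws Z) = m.+1 by rewrite size_rcons sz.
have bb := hb _ _ _ _ _ szr esJ hW2 hWs.
have [_ tt _ _] := ht _ _ _ _ e2J hW2 hW.
apply: almost_sub (almost_and (almost_and hP bb) tt) _ _; first by lra.
move=> b _ /andP[/andP[hb1 hb2] hb3].
have hW' : big (c / 2) p e.+1 (C :&: nb b :&: W).
  rewrite /big setIAC setIC; exact: (big_nb p0 hW).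
have := hIH _ _ _ _ _ _ sz (profile_tail pf) hW' hb2 (almost_cliques_sub d2d1 (fun _ _ x => x) hb1).
apply: almost_cliques_sub; first by lra.
move=> s /and3P[/trace_size] + _ _.
rewrite size_rcons => ss /existsP[a]; rewrite !inE => /and3P[/andP[/andP[aC ba] aW] as_ Pa].
apply/existsP; exists a; rewrite !inE aC aW /= sedge_sym ba as_ /=.
by move: ss Pa; case: s {as_} => // x s.
Qed.

End Chains.

(** * Cliques reachable from a given end *)

Section Reachability.
Variable R : realType.
Implicit Types (G : sgraph) (p c d eta : R) (i j k J : nat).
Local Notation "## A" := (#|A|%:R : R) (at level 10, A at level 8).

Lemma bigs_rcons G c p es e (C : {set G}) Ws W :
  bigs c p (rcons es e) C (rcons Ws W) = bigs c p es C Ws && big c p e (C :&: W).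
Proof.
elim: es Ws => [|e' es IH] [|W' Ws] //=; rewrite ?andbT //.
- by case: Ws => [|? ?]; rewrite /= ?andbF.
- by case: es {IH} => [|? ?]; rewrite /= ?andbF.
- by rewrite IH andbA.
Qed.

Lemma bigs_nseq G c p g (C : {set G}) Ws :
  bigs c p (nseq (size Ws) g) C Ws = all (fun W => big c p g (C :&: W)) Ws.
Proof. by elim: Ws => //= W Ws ->. Qed.

Lemma bigs_nth G c p es (C : {set G}) Ws : size es = size Ws ->
  (forall i, (i < size Ws)%N -> big c p (nth 0%N es i) (C :&: nth set0 Ws i)) ->
  bigs c p es C Ws.
Proof.
elim: es Ws => [|e es IH] [|W Ws] //= [sz] h.
by rewrite (h 0%N) //= IH // => i lt; apply: (h i.+1).
Qed.

(** One move of the clique: the choice of the oldest vertex, in W, is postponed to the end, and this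
    vertex is then exchanged for one of Z. *)
Lemma almost_cliques_step m J c d' e f : 0 < c -> 0 < d' ->
  (e + f + m <= J)%N -> (2 * f <= J)%N ->
  exists2 d : R, 0 < d & eventually J (fun G p => forall (C W Z : {set G}) Ws es P,
    size Ws = m -> profile f es -> big c p e (C :&: W) -> bigs c p es C (rcons Ws Z) ->
    almost_cliques d C (W :: Ws) P -> almost_cliques d' C (rcons Ws Z) (fun s =>
      [exists a in C :&: W, all (sedge a) s && P (a :: take (size s).-1 s)])).
Proof.
move=> c0 d'0 efm ff.
have [d1 d10 h1] := @almost_cliques_replace_last R m J c d' e f c0 d'0 efm ff.
have [d2 d20 h2] := @almost_cliques_rot R m J c d1 e f c0 d10 ltac:(lia) ff.
exists d2 => //; apply: eventually_imp (eventually_and h1 h2) _.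
move=> G p p0 p1 n0 [{}h1 {}h2] C W Z Ws es P sz pf hW.
case/lastP: es pf => [|es e'] pf hWs hP.
  by have := bigs_size hWs; rewrite size_rcons.
have := hWs; rewrite bigs_rcons => /andP[hWs' _].
have pf' : profile f es.
  move=> j lt; have := pf j; rewrite size_rcons nth_rcons lt; apply; exact: ltnW.
have := h1 _ _ _ _ _ _ sz pf hW hWs (h2 _ _ _ _ _ sz pf' hW hWs' hP).
apply: almost_cliques_sub => // s _ /existsP[a /andP[aW /andP[as_]]].
by rewrite rotr1_rcons => Pa; apply/existsP; exists a; rewrite aW as_.
Qed.

(** Two chains coming from opposite ends choose the clique where they meet in opposite orders. By
    induction the tail is reversed and then the head is rotated behind it. *)
Lemma almost_cliques_rev m J : forall c d' g, 0 < c -> 0 < d' -> (2 * g + 2 * m <= J + 3)%N ->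
  exists2 d : R, 0 < d & eventually J (fun G p => forall (C : {set G}) Ws P,
    size Ws = m -> all (fun W => big c p g (C :&: W)) Ws ->
    almost_cliques d C Ws P -> almost_cliques d' C (rev Ws) (fun s => P (rev s))).
Proof.
elim: m => [|m IH] c d' g c0 d'0 gm.
  by exists 1 => //; exists 1 => // G p _ C [|//] P.
have c2 : 0 < c / 2 by lra.
have [d1 d10 h1] := @almost_cliques_rot R m J c d' g (g + m - 1) c0 d'0 ltac:(lia) ltac:(lia).
have d12 : 0 < d1 / 2 by lra.
have [d2 d20 h2] := IH (c / 2) d1 g.+1 c2 d10 ltac:(lia).
exists (Num.min (d1 / 2) d2); first by rewrite lt_min d12.
have [m1 m2] : Num.min (d1 / 2) d2 <= d1 / 2 /\ Num.min (d1 / 2) d2 <= d2.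
  by split; rewrite !ge_min lexx ?orbT.
apply: eventually_imp (eventually_and (eventually_and h1 h2) (eventually_bigs m J c0 d12)) _.
move=> G p p0 p1 n0 [[{}h1 {}h2] hb] C [|W Ws] //= P [sz] /andP[hW hWs] hP.
have hWs' : bigs c p (nseq m g) C Ws by rewrite -sz bigs_nseq.
have gJ : forall e, e \in nseq m g -> (g + e <= J)%N.
  move=> e /nseqP[-> m0]; move: gm m0; clear; lia.
have bb := hb _ _ _ _ _ sz gJ hW hWs'.
pose P2 (s : seq G) := if s is a :: t then P (a :: rev t) else false.
have : almost_cliques d1 C (W :: rev Ws) P2.
  rewrite /=; apply: almost_sub (almost_and hP bb) _ _; first by lra.
  move=> a _ /andP[ha]; rewrite map_nseq -sz bigs_nseq => hb2.
  by apply: (h2 _ _ (fun s => P (a :: s)) sz hb2); apply: almost_cliques_sub ha.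
rewrite rev_cons => h; have := h1 C W (rev Ws) (nseq m g) P2.
rewrite size_rev sz => /(_ erefl).
have pf : profile (g + m - 1) (nseq m g).
  move=> j; rewrite size_nseq => jm; rewrite nth_nseq jm; move: jm; clear; lia.
move=> /(_ pf hW).
have hr : bigs c p (nseq m g) C (rev Ws) by rewrite -sz -(size_rev Ws) bigs_nseq all_rev.
move=> /(_ hr h); apply: almost_cliques_sub => // s /and3P[/trace_size] + _ _.
rewrite size_rcons; case/lastP: s => // t a _.
by rewrite rotr1_rcons rev_rcons.
Qed.

Lemma almost_cliques_ex m J : forall c f, 0 < c -> (2 * f <= J)%N ->
  eventually J (fun G p => forall (C : {set G}) Ws es P,
    size Ws = m -> profile f es -> bigs c p es C Ws ->
    almost_cliques (1 / 2 : R) C Ws P -> exists2 s, clique_in C Ws s & P s).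
Proof.
elim: m => [|m IH] c f c0 ff.
  by exists 1 => // G p _ C [|//] es P _ _ _; exists [::].
have c2 : 0 < c / 2 by lra.
have d4 : (0 : R) < 1 / 4 by lra.
apply: eventually_imp (eventually_and (IH (c / 2) f c2 ff) (eventually_bigs m J c0 d4)) _.
move=> G p p0 p1 n0 [{}IH hb] C [|W Ws] //= [|e es] P // [sz] pf /andP[hW hWs] hP.
have ef := profile_head pf.
have esJ : forall e', e' \in es -> (e + e' <= J)%N.
  by move=> e' he'; have := profile_le pf he'; clear -ef ff; lia.
have bb := hb _ _ _ _ _ sz esJ hW hWs.
have W0 : 0 < ##(C :&: W) by apply: big_gt0 hW.
have [||a aW /andP[ha hb2]] := almost_ex (almost_and hP bb); [lra|by []|].
have [s as_ Ps] := IH _ _ _ _ sz (profile_tail pf) hb2 ha.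
by exists (a :: s) => //; apply: clique_in_cons.
Qed.

Lemma reach_extend G k (x : seq G) Ds (W : {set G}) a s : (0 < k)%N -> size s = k ->
  pairwise (@sedge G) s -> a \in W -> all (sedge a) s ->
  reach k x Ds (a :: take k.-1 s) -> reach k x (rcons Ds W) s.
Proof.
move=> k0 ss pw aW as_ /asboolP[z tr kp]; apply/asboolP.
exists (rcons z a); first by rewrite -!cats1; apply: trace_cat => //=; rewrite aW.
case/lastP: s ss pw as_ kp => [|t v]; first by move: k0 => /[swap] <-.
rewrite size_rcons => st pw as_; rewrite -st /= -cats1 take_size_cat // => kp.
rewrite cat_rcons -(cat_cons a t) catA; apply: kpath_cat3.
- by rewrite /=.
- by rewrite -catA.
- by rewrite cats1 rcons_cons; apply: pairwise_kpath; rewrite /= as_ pw.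
Qed.

(** The window of k sets slides by t places. After one step its profile is bounded by k - 1, hence
    again by e, and the induction continues. The sum e + 2 (k - 1) is the cost of
    [almost_cliques_step] with f and m equal to k - 1. *)
Lemma reach_chain k t J e : (0 < k)%N -> (k.-1 <= e <= k)%N -> (e + 2 * k.-1 <= J)%N ->
  forall c d', 0 < c -> 0 < d' -> exists2 d : R, 0 < d &
  eventually J (fun G p => forall x Ds (Ws Zs : seq {set G}) es,
    size Ws = k -> size Zs = t -> profile e es -> bigs c p es setT Ws ->
    all (big c p 0) Zs -> almost_cliques d setT Ws (reach k x Ds) ->
    almost_cliques d' setT (drop t (Ws ++ Zs)) (reach k x (Ds ++ take t (Ws ++ Zs)))).
Proof.
move=> k0 /andP[e1 e2] eJ; elim: t => [|t IH] c d' c0 d'0.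
  exists d' => //; exists 1 => // G p _ x Ds Ws [|//] es _ _ _ _ _.
  by rewrite drop0 take0 !cats0.
have [d1 d10 h1] := IH c d' c0 d'0.
have [d2 d20 h2] := @almost_cliques_step k.-1 J c d1 e k.-1 c0 d10 ltac:(lia) ltac:(lia).
exists d2 => //; apply: eventually_imp (eventually_and h1 h2) _.
move=> G p p0 p1 n0 [{}h1 {}h2] x Ds [|W Ws]; first by move=> [|? ?] es h; move: k0; rewrite -h.
move=> [|Z Zs] [|e0 es] //= sz [szZ] pf /andP[hW hWs] /andP[hZ hZs] hP.
have sz' : size Ws = k.-1 by rewrite -sz.
have see := bigs_size hWs.
have pf1 : profile k.-1 (rcons es 0).
  move=> j; rewrite size_rcons nth_rcons ltnS leq_eqVlt => /orP[/eqP->|lt].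
    by rewrite ltnn eqxx see sz'.
  rewrite lt; have := pf j.+1 lt; rewrite /= => h.
  by clear -h e2 k0; lia.
have pfe : profile e (rcons es 0).
  by move=> j lt; apply: leq_trans (pf1 j lt) _.
have hW' : big c p e (setT :&: W).
  apply: bigW hW => //; [by rewrite lexx ltW | by have := profile_head pf].
have hr : bigs c p (rcons es 0) setT (rcons Ws Z) by rewrite bigs_rcons hWs setTI.
have := h2 _ _ _ _ _ _ sz' pf1 hW' hr hP.
move=> h; have {}h : almost_cliques d1 setT (rcons Ws Z) (reach k x (rcons Ds W)).
  apply: almost_cliques_sub h => // s /and3P[/trace_size ss _ pw] /existsP[a].
  rewrite in_setI => /and3P[/andP[_ aW] as_]; rewrite size_rcons sz' prednK // in ss.
  by rewrite ss; apply: reach_extend.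
have := h1 x (rcons Ds W) (rcons Ws Z) Zs (rcons es 0).
by rewrite size_rcons sz' prednK // !cat_rcons => /(_ erefl szZ pfe hr hZs h).
Qed.

(** The i-th new vertex has to see the last k - i vertices of [x], hence [drop i x]. The [nE] sets
    lie between the candidates next to [x] and the target sets [Ms]: none in the general argument,
    three for squares. *)
Definition left_prop k J nE : Prop := forall c d', 0 < c -> 0 < d' ->
  eventually J (fun G p => forall (x : seq G) (Xs Es Ms : seq {set G}),
    size x = k -> kpath k x -> size Xs = k -> size Es = nE -> size Ms = k ->
    (forall i, (i < k)%N -> nth set0 Xs i \subset cnb (drop i x)
        /\ big c p (k - i) (nth set0 Xs i)) ->
    all (big c p 0) Es -> all (big c p 0) Ms ->
    almost_cliques d' setT Ms (reach k x (Xs ++ Es))).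

Lemma kpath_attach G k (x s : seq G) : size x = k -> kpath k x ->
  pairwise (@sedge G) s ->
  (forall i, (i < size s)%N -> forall v0, nth v0 s i \in cnb (drop i x)) -> kpath k (x ++ s).
Proof.
move=> sx kx pw h; case E: (x ++ s) => [//|v0 w]; rewrite -E {w E}.
apply/(kpathP _ v0) => i j; rewrite size_cat !nth_cat => /andP[ij js] ji.
have [jx|jx] := ltnP j (size x).
  rewrite (ltn_trans ij jx); move/(kpathP _ v0): kx; apply => //.
  by rewrite ij jx.
have js' : (j - size x < size s)%N by move: js jx; clear; lia.
have [ix|ix] := ltnP i (size x).
  have := h _ js' v0; rewrite in_cnb sedge_sym => /allP; apply.
  apply/(nthP v0); exists (i - (j - size x))%N; first by move: ix ji jx; rewrite size_drop sx; clear; lia.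
  by rewrite nth_drop subnKC //; move: ji; rewrite sx; clear; lia.
by apply: (pairwiseP v0 pw); rewrite ?inE; lia.
Qed.

(** Every clique with trace [Xs] can be attached to [x], so the chain starts without exceptions; its
    first set has exponent k, whence k + 2 (k - 1) <= J. *)
Lemma left_prop_gt2 k J : (0 < k)%N -> (3 * k <= J + 2)%N -> left_prop k J 0.
Proof.
move=> k0 kJ c d' c0 d'0.
have [d d0 h] := @reach_chain k k J k k0 ltac:(lia) ltac:(lia) c d' c0 d'0.
apply: eventually_imp h _ => G p p0 p1 n0 h x Xs Es Ms sx kx sX sE sM hX _ hM.
case: Es sE => // _; rewrite cats0.
have hb : bigs c p (mkseq (fun i => k - i)%N k) setT Xs.
  apply: bigs_nth; first by rewrite size_mkseq.
  move=> i; rewrite sX => ik; rewrite nth_mkseq // setTI.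
  by have [_] := hX i ik.
have pf : profile k (mkseq (fun i => k - i)%N k).
  by move=> i; rewrite size_mkseq => ik; rewrite nth_mkseq // subnK // ltnW.
have := h x [::] Xs Ms _ sX sM pf hb hM.
rewrite -sX drop_size_cat // take_size_cat //; apply; rewrite sX.
apply: almost_cliques_all; first exact: ltW.
move=> s /and3P[tr _ pw]; apply/asboolP; exists [::] => //=.
apply: kpath_attach => // i lt v0.
have ik : (i < k)%N by rewrite -sX -(trace_size tr).
by have [/subsetP sub _] := hX i ik; apply: sub; apply: trace_nth.
Qed.

End Reachability.

(** * Connecting two ends through prescribed disjoint sets *)

Section Connecting.
Variable R : realType.
Implicit Types (G : sgraph) (p c d eta : R) (i j k J : nat).
Local Notation "## A" := (#|A|%:R : R) (at level 10, A at level 8).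

(* Applying the edge estimate to a vertex and its neighbourhood bounds [p] from
   below when [p <= 1 / 2]; applying it to a single vertex handles large [p]. *)
Lemma eventually_large M J : 0 < M -> eventually J (fun G p => M <= p ^+ J.+1 * ##G).
Proof.
move=> M0.
pose e := Num.min (1 / (4 * M)) ((1 / (M * 2 ^+ J.+1)) ^+ 2) : R.
have e0 : 0 < e by rewrite /e lt_min; apply/andP; split; pos.
have [eM eJ] : e <= 1 / (4 * M) /\ e <= (1 / (M * 2 ^+ J.+1)) ^+ 2.
  by split; rewrite /e ge_min lexx ?orbT.
exists e => // G p [p0 p1 n0 dg jum]; have N0 : 0 < ##G by rewrite ltr0n.
have /card_gt0P[v _] := n0.
have [p2|p2] := lerP p (1 / 2).
  have := jum [set v] (nb v).
  have -> : edges R [set v] (nb v) = ##(nb v) by rewrite /edges big_set1 setIid.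
  rewrite cards1 mulr1 mul1r dg => h.
  have h1 : (p * ##G / 2) ^+ 2 <= (p * ##G - p * (p * ##G)) ^+ 2.
    rewrite ler_pXn2r ?nnegrE //; first by have : 0 <= p * ##G * (1 / 2 - p); [apply: mulr_ge0; [pos|lra]|lra].
    - by pos.
    - have -> : p * ##G - p * (p * ##G) = p * ##G * (1 - p) by ring.
      by apply: mulr_ge0; [pos|lra].
  have h2 : p ^+ 2 * ##G ^+ 2 * (1 / 4) <= p ^+ 2 * ##G ^+ 2 * (e * (p ^+ J.+1 * ##G)).
    apply: le_trans (le_trans _ (le_trans h1 h)) _; first by rewrite le_eqVlt; apply/orP; left; apply/eqP; field.
    by rewrite le_eqVlt; apply/orP; left; apply/eqP; rewrite addnS addn1 !exprS; ring.
  rewrite ler_pM2l in h2; last by pos.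
  have h3 : 1 / 4 <= 1 / (4 * M) * (p ^+ J.+1 * ##G).
    by apply: le_trans h2 _; apply: ler_wpM2r => //; pos.
  have : 4 * M * (1 / 4) <= 4 * M * (1 / (4 * M) * (p ^+ J.+1 * ##G)).
    by apply: ler_wpM2l => //; pos.
  have -> : 4 * M * (1 / 4) = M by field.
  by have -> : 4 * M * (1 / (4 * M) * (p ^+ J.+1 * ##G)) = p ^+ J.+1 * ##G by field; lra.
have := jum [set v] [set v]; rewrite edges11 cards1 !mulr1 sub0r sqrrN => h.
have h2 : p ^+ 2 * 1 <= p ^+ 2 * (e * ##G ^+ 2 * p ^+ J).
  rewrite mulr1; apply: le_trans h _; rewrite le_eqVlt; apply/orP; left; apply/eqP.
  by rewrite addn2 !exprS; ring.
rewrite ler_pM2l in h2; last by pos.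
have h3 : 1 <= (1 / (M * 2 ^+ J.+1) * ##G) ^+ 2.
  apply: le_trans h2 _; rewrite exprMn -[leRHS]mulr1; apply: ler_pM; try by pos.
    by apply: ler_wpM2r => //; pos.
  by apply: exprn_ile1 => //; exact: ltW.
have h4 : 1 <= 1 / (M * 2 ^+ J.+1) * ##G.
  rewrite -(@ler_pXn2r _ 2) ?nnegrE // ?expr1n //; by pos.
have h5 : M <= (1 / 2) ^+ J.+1 * ##G.
  have : M * 1 <= M * (1 / (M * 2 ^+ J.+1) * ##G) by apply: ler_wpM2l => //; exact: ltW.
  rewrite mulr1; congr (_ <= _); rewrite expr_div_n expr1n; field.
  by rewrite expf_neq0 ?pnatr_eq0 //= lt0r_neq0.
apply: le_trans h5 _; apply: ler_wpM2r => //.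
by apply: lerXn2r; rewrite ?nnegrE; [lra|exact: ltW|exact: ltW].
Qed.

Lemma eventually_large_le M J k : 0 < M -> (k <= J.+1)%N -> eventually J (fun G p => M <= p ^+ k * ##G).
Proof.
move=> M0 kJ; apply: eventually_imp (eventually_large J M0) _ => G p p0 p1 n0 /le_trans; apply.
by apply: ler_wpM2r => //; apply: ler_wiXn2l => //; exact: ltW.
Qed.

Lemma subset_of_card G (A : {set G}) m : (m <= #|A|)%N ->
  exists2 B : {set G}, B \subset A & #|B| = m.
Proof.
move=> mA; exists [set x in take m (enum A)].
  by apply/subsetP => x; rewrite inE => /mem_take; rewrite mem_enum.
rewrite cardsE; have /card_uniqP -> : uniq (take m (enum A)) by rewrite take_uniq ?enum_uniq.
by rewrite size_takel // -cardE.
Qed.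

(** Greedy choice: before step i at most m_0 + ... + m_(i - 1) elements of S_i are taken. *)
Lemma disjoint_subsets G (S : nat -> {set G}) (m : nat -> nat) T :
  (forall i, (i < T)%N -> (\sum_(0 <= j < i.+1) m j <= #|S i|)%N) ->
  exists F : nat -> {set G},
    [/\ forall i, (i < T)%N -> F i \subset S i, forall i, (i < T)%N -> #|F i| = m i
      & forall i j, (i < j < T)%N -> [disjoint F i & F j]].
Proof.
elim: T => [|T IH] h; first by exists S; split=> // i j; rewrite ltn0 andbF.
have [F [F1 F2 F3]] := IH (fun i lt => h i (ltnW lt)).
pose U := \bigcup_(i < T) F i.
have hU : (#|U| <= \sum_(0 <= j < T) m j)%N.
  rewrite big_mkord; apply: leq_trans (_ : (\sum_(i < T) #|F i| <= _)%N).
    apply: (big_ind2 (fun (A : {set G}) n => #|A| <= n)%N); rewrite ?cards0 //.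
    by move=> A n B n' hA hB; apply: leq_trans (leq_card_setU _ _) _; apply: leq_add.
  by apply: leq_sum => i _; rewrite F2.
have hS : (m T <= #|S T :\: U|)%N.
  have := h T (ltnSn T); rewrite big_nat_recr //= -(cardsID U (S T)).
  have := subset_leq_card (subsetIr (S T) U); move: hU.
  move: #|U| #|_ :\: _| #|_ :&: _| (\sum_(_ <= _ < _) _)%N; lia.
have [B sB cB] := subset_of_card hS.
exists (fun i => if i == T then B else F i); split.
- move=> i; rewrite ltnS leq_eqVlt; case: eqP => [-> _|_ /= lt]; last exact: F1.
  exact: subset_trans sB (subsetDl _ _).
- by move=> i; rewrite ltnS leq_eqVlt; case: eqP => [-> _|_ /= lt]; last exact: F2.
- move=> i j /andP[ij]; rewrite ltnS leq_eqVlt.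
  case: (j =P T) => [jT|_ /= jT].
    have iT : (i < T)%N by rewrite -jT.
    rewrite (ltn_eqF iT) => _; rewrite disjoint_sym.
    apply: disjointWl sB _; rewrite disjoint_sym disjoints_subset.
    apply/subsetP => x xF; rewrite !inE negb_and negbK; apply/orP; left.
    by apply/bigcupP; exists (Ordinal iT).
  by rewrite (ltn_eqF (ltn_trans ij jT)); apply: F3; rewrite ij.
Qed.

(** The exponents do not increase with the index, so the pieces taken earlier are no larger than a
    T-th part of the size guaranteed for the current set. *)
Lemma eventually_disjoint T J g c : (0 < T)%N -> 0 < c -> (g <= J.+1)%N -> eventually J (fun G p =>
  forall (S : nat -> {set G}) (e : nat -> nat),
  (forall i j, (j <= i < T)%N -> (e i <= e j <= g)%N) ->
  (forall i, (i < T)%N -> big c p (e i) (S i)) ->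
  exists F : nat -> {set G},
    [/\ forall i, (i < T)%N -> F i \subset S i,
        forall i, (i < T)%N -> big (c / (2 * T%:R)) p (e i) (F i),
        forall i j, (i < j < T)%N -> [disjoint F i & F j]
      & forall i, (i < T)%N -> ##(F i) <= c * p ^+ e i * ##G]).
Proof.
move=> T0 c0 gJ; have T0R : 0 < T%:R :> R by rewrite ltr0n.
have M0 : 0 < 2 * T%:R / c by pos.
apply: eventually_imp (eventually_large_le M0 gJ) _ => G p p0 p1 n0 hM S e he hS.
pose x i : R := c / (2 * T%:R) * p ^+ e i * ##G.
have x0 i : 0 <= x i by rewrite /x; pos.
(* An integer between x i and 2 x i; the upper bound uses 1 <= x i, supplied by
   [eventually_large_le]. *)
pose m i := (Num.truncn (x i)).+1.
have mlo i : x i <= (m i)%:R by rewrite ltW // /m truncnS_gt // num_real.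
have mhi i : (i < T)%N -> (m i)%:R <= 2 * x i.
  move=> iT; rewrite /m -natr1.
  have : (Num.truncn (x i))%:R <= x i by rewrite truncn_le.
  have : 1 <= x i.
    have eg : (e i <= g)%N by have := he i i; rewrite leqnn iT => /(_ isT)/andP[].
    have pg : p ^+ g * ##G <= p ^+ e i * ##G.
      by apply: ler_wpM2r => //; apply: ler_wiXn2l => //; exact: ltW.
    have := ler_wpM2l (_ : 0 <= c / (2 * T%:R)) (le_trans hM pg).
    have -> : c / (2 * T%:R) * (2 * T%:R / c) = 1 by field; rewrite !lt0r_neq0.
    by rewrite /x mulrA; apply; pos.
  by lra.
have hm i : (i < T)%N -> (\sum_(0 <= j < i.+1) m j <= #|S i|)%N.
  move=> iT; rewrite -(ler_nat R) natr_sum; apply: le_trans _ (hS i iT).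
  apply: (@le_trans _ _ (\sum_(0 <= j < i.+1) (2 * x i))).
    apply: ler_sum_nat => j /andP[_ ji].
    have jT : (j < T)%N by apply: leq_ltn_trans iT.
    apply: le_trans (mhi j jT) _; apply: ler_wpM2l => //.
    rewrite /x; apply: ler_wpM2r => //; apply: ler_wpM2l; first by pos.
    apply: ler_wiXn2l => //; first exact: ltW.
    by have := he i j; rewrite iT -ltnS ji => /(_ isT)/andP[].
  rewrite sumr_const_nat subn0 -[_ *+ i.+1]mulr_natr /x.
  have -> : 2 * (c / (2 * T%:R) * p ^+ e i * ##G) * i.+1%:R
     = c * p ^+ e i * ##G * (i.+1%:R / T%:R) by field; rewrite lt0r_neq0.
  rewrite -[leRHS]mulr1; apply: ler_wpM2l; first by pos.
  by rewrite ler_pdivrMr // mul1r ler_nat.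
have [F [F1 F2 F3]] := disjoint_subsets hm.
exists F; split=> // i iT; first by rewrite /big F2 //; exact: mlo.
rewrite F2 //; apply: le_trans (mhi i iT) _; rewrite /x.
have -> : 2 * (c / (2 * T%:R) * p ^+ e i * ##G) = c * p ^+ e i * ##G / T%:R.
  by field; rewrite lt0r_neq0.
by rewrite ler_pdivrMr // -[leLHS]mulr1; apply: ler_wpM2l; [pos | rewrite ler1n].
Qed.

(* [s] lists the vertices of a path from its end inwards; [j = 0] bounds [#|U|]. *)
Definition extendable G c p k (U : {set G}) (s : seq G) : Prop :=
  forall j, (j <= k)%N -> big c p j (U :&: cnb (take j s)).

Definition connecting_prop k J : Prop := exists K : nat, forall c, 0 < c ->
  eventually J (fun G p => forall (U : {set G}) (x y : seq G),
    size x = k -> size y = k -> kpath k x -> kpath k y ->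
    extendable c p k U (rev x) -> extendable c p k U y ->
    exists m, [/\ {subset m <= U}, uniq m, (size m <= K)%N & kpath k (x ++ m ++ y)]).

Lemma uniq_disjoint G (F : nat -> {set G}) T (idx : seq nat) :
  (forall i j, (i < j < T)%N -> [disjoint F i & F j]) ->
  uniq idx -> all (fun i => (i < T)%N) idx ->
  pairwise (fun A B : {set G} => [disjoint A & B]) (map F idx).
Proof.
move=> dF; elim: idx => //= i s IH /andP[is_ us] /andP[iT sT]; rewrite IH // andbT.
rewrite all_map; apply/allP => j js /=.
have jT : (j < T)%N by move/allP: sT; apply.
have : i != j by apply: contraNneq is_ => ->.
rewrite neq_ltn => /orP[ij|ji]; first by apply: dF; rewrite ij.
by rewrite disjoint_sym; apply: dF; rewrite ji.
Qed.

Lemma cat_uniq_disjoint (T : eqType) (s t : seq T) : uniq s -> uniq t ->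
  (forall x, x \in s -> x \in t -> False) -> uniq (s ++ t).
Proof.
by move=> us ut h; rewrite cat_uniq us ut andbT; apply/hasPn => i it; apply/negP => /h; apply.
Qed.

(** The middle sets [Ms] are approached from x in order and from y in reverse. With the second order
    reversed, at most a fraction 1/4 + 1/4 fails at each stage, so some clique is reached from both
    sides. T counts 2k sets near the ends, 2 nE further ones and k in the middle. *)
Lemma connecting_of_left k J nE : (0 < k)%N -> (2 * k <= J.+1)%N ->
  left_prop R k J nE -> connecting_prop k J.
Proof.
move=> k0 kJ left; pose T := (3 * k + 2 * nE)%N.
exists T => c c0.
have T0 : (0 < T)%N by rewrite /T; move: k0; clear; lia.
have c'0 : 0 < c / (2 * T%:R) by have : 0 < T%:R :> R by [rewrite ltr0n]; move=> ?; pos.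
set c' := c / _ in c'0.
have d4 : (0 : R) < 1 / 4 by lra.
have [d d0 hrev] := @almost_cliques_rev R k J c' (1 / 4) 0 c'0 d4 ltac:(lia).
apply: eventually_imp (eventually_and (eventually_and (left c' _ c'0 d4) (left c' _ c'0 d0))
  (eventually_and (eventually_and hrev (@almost_cliques_ex R k J c' k.-1 c'0 ltac:(lia)))
    (@eventually_disjoint T J k c T0 c0 ltac:(lia)))) _.
move=> G p p0 p1 n0 [[hl1 hl2] [[{}hrev hex] hdis]] U x y sx sy kx ky gx gy.
(* The sets for x (even indices) and for y (odd indices) are interleaved so that the exponents k -
   i./2 do not increase. *)
pose S i := if (i < 2 * k)%N then
    (if odd i then U :&: cnb (take (k - i./2) y) else U :&: cnb (take (k - i./2) (rev x)))
  else U.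
pose e i := if (i < 2 * k)%N then (k - i./2)%N else 0%N.
have [||F [F1 F2 F3 _]] := hdis S e.
- move=> i j /andP[ji iT]; rewrite /e.
  case: ltnP => ik; last by case: ltnP => jk; rewrite ?leq_subr.
  rewrite (leq_ltn_trans ji ik) leq_subr andbT; apply: leq_sub2l; exact: half_leq.
- move=> i iT; rewrite /S /e; case: ltnP => ik.
    by case: odd; [apply: gy | apply: gx]; apply: leq_subr.
  by have := gy 0%N isT; rewrite take0 cnb_nil setIT.
have ilt i : (i < k)%N -> (i.*2.+1 < 2 * k)%N /\ (2 * k <= T)%N.
  by rewrite /T; clear; lia.
pose Xs := [seq F i.*2 | i <- iota 0 k].
pose Ys := [seq F i.*2.+1 | i <- iota 0 k].
pose E1 := [seq F i | i <- iota (2 * k) nE].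
pose E2 := [seq F i | i <- iota (2 * k + nE) nE].
pose Ms := [seq F i | i <- iota (2 * k + 2 * nE) k].
have sub_U i : (i < T)%N -> F i \subset U.
  move=> iT; apply: subset_trans (F1 i iT) _; rewrite /S.
  by case: ifP => // _; case: ifP => _; apply: subsetIl.
have big0 i : (2 * k <= i < T)%N -> big c' p 0 (F i).
  by move=> /andP[ki iT]; have := F2 i iT; rewrite /e ltnNge ki.
have bigE1 : all (big c' p 0) E1.
  rewrite /E1 all_map; apply/allP => i; rewrite mem_iota => hi; apply: big0.
  by move: hi; rewrite /T; clear; lia.
have bigE2 : all (big c' p 0) E2.
  rewrite /E2 all_map; apply/allP => i; rewrite mem_iota => hi; apply: big0.
  by move: hi; rewrite /T; clear; lia.
have bigM : all (big c' p 0) Ms.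
  rewrite /Ms all_map; apply/allP => i; rewrite mem_iota => hi; apply: big0.
  by move: hi; rewrite /T; clear; lia.
have hX i : (i < k)%N -> nth set0 Xs i \subset cnb (drop i x)
    /\ big c' p (k - i) (nth set0 Xs i).
  move=> ik; have [h1 h2] := ilt i ik; have h3 := ltnW h1; have h4 := leq_trans h3 h2.
  rewrite (nth_map 0%N) ?size_iota // nth_iota // add0n; split; last first.
    by have := F2 _ h4; rewrite /e h3 doubleK.
  apply: subset_trans (F1 _ h4) _; rewrite /S h3 odd_double doubleK.
  apply: subset_trans (subsetIr _ _) _.
  rewrite -{1}sx take_rev subKn ?sx ?(ltnW ik) //.
  by rewrite (cnb_perm (mem_rev _)).
have hY i : (i < k)%N -> nth set0 Ys i \subset cnb (drop i (rev y))
    /\ big c' p (k - i) (nth set0 Ys i).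
  move=> ik; have [h1 h2] := ilt i ik; have h4 := leq_trans h1 h2.
  rewrite (nth_map 0%N) ?size_iota // nth_iota // add0n; split; last first.
    by have := F2 _ h4; rewrite /e h1 /= uphalf_double.
  apply: subset_trans (F1 _ h4) _; rewrite /S h1 /= odd_double /= uphalf_double.
  apply: subset_trans (subsetIr _ _) _.
  by rewrite -[y in take _ y]revK take_rev size_rev sy subKn ?(ltnW ik) // (cnb_perm (mem_rev _)).
have sM : size Ms = k by rewrite size_map size_iota.
have [sX sY] : size Xs = k /\ size Ys = k by rewrite !size_map !size_iota.
have [sE1 sE2] : size E1 = nE /\ size E2 = nE by rewrite !size_map !size_iota.
have L := hl1 x Xs E1 Ms sx kx sX sE1 sM hX bigE1 bigM.
have sMr : size (rev Ms) = k by rewrite size_rev.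
have bMr : all (big c' p 0) (rev Ms) by rewrite all_rev.
have syr : size (rev y) = k by rewrite size_rev.
have kyr : kpath k (rev y) by rewrite kpath_rev.
have Rr := hl2 (rev y) Ys E2 (rev Ms) syr kyr sY sE2 sMr hY bigE2 bMr.
have bM : all (fun W => big c' p 0 (setT :&: W)) (rev Ms).
  by rewrite all_rev; apply: sub_all bigM => W; rewrite setTI.
have {}Rr := hrev _ _ _ (etrans (size_rev _) sM) bM Rr; rewrite revK in Rr.
have both := almost_cliques_and (ltW d4) (ltW d4) L Rr.
have d2 : 1 / 4 + 1 / 4 = 1 / 2 :> R by field.
rewrite d2 in both.
have bM' : bigs c' p (nseq k 0%N) setT Ms.
  by rewrite -sM bigs_nseq; apply: sub_all bigM => W; rewrite setTI.
have pf : profile k.-1 (nseq k 0%N).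
  by move=> i; rewrite size_nseq => ik; rewrite nth_nseq ik; move: ik; clear; lia.
have [u /and3P[tu _ pu] /andP[/asboolP[z tz kz] /asboolP[w tw kw]]] := hex _ _ _ _ sM pf bM' both.
have su : size u = k by rewrite (trace_size tu).
have trm : trace (z ++ u ++ rev w) ((Xs ++ E1) ++ Ms ++ rev (Ys ++ E2)).
  by apply: trace_cat => //; apply: trace_cat => //; apply: trace_rev.
pose idx := ([seq i.*2 | i <- iota 0 k] ++ iota (2 * k) nE) ++
  iota (2 * k + 2 * nE) k ++ rev ([seq i.*2.+1 | i <- iota 0 k] ++ iota (2 * k + nE) nE).
have eidx : (Xs ++ E1) ++ Ms ++ rev (Ys ++ E2) = map F idx.
  by rewrite /idx !map_cat map_rev !map_cat -!map_comp.
have idxT : all (fun i => (i < T)%N) idx.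
  rewrite /idx !all_cat all_rev all_cat !all_map; rewrite /T.
  apply/andP; split; [apply/andP; split | apply/andP; split; [|apply/andP; split]];
    apply/allP => i; rewrite mem_iota /=; clear; lia.
have uidx : uniq idx.
  have dbl i : (i \in [seq i.*2 | i <- iota 0 k]) -> ~~ odd i /\ (i < 2 * k)%N.
    by case/mapP => j; rewrite mem_iota => jk ->; rewrite odd_double; split=> //; move: jk; clear; lia.
  have dblS i : (i \in [seq i.*2.+1 | i <- iota 0 k]) -> odd i /\ (i < 2 * k)%N.
    by case/mapP => j; rewrite mem_iota => jk ->; rewrite /= odd_double; split=> //; move: jk; clear; lia.
  apply: cat_uniq_disjoint; [apply: cat_uniq_disjoint|apply: cat_uniq_disjoint|].
  - by rewrite map_inj_uniq ?iota_uniq //; exact: double_inj.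
  - exact: iota_uniq.
  - by move=> i /dbl[_]; rewrite mem_iota; clear; lia.
  - exact: iota_uniq.
  - rewrite rev_uniq; apply: cat_uniq_disjoint; last 1 first.
    + by move=> i /dblS[_]; rewrite mem_iota; clear; lia.
    + by rewrite map_inj_uniq ?iota_uniq // => i j [] /double_inj.
    + exact: iota_uniq.
  - move=> i; rewrite mem_rev mem_cat !mem_iota => h1 /orP[/dblS[_]|]; move: h1; clear; lia.
  - move=> i; rewrite !mem_cat mem_rev mem_cat !mem_iota.
    move=> /orP[/dbl[h1 h2]|h1] /orP[h3|/orP[/dblS[h3 h4]|h3]].
    + by move: h2 h3; clear; lia.
    + by rewrite h3 in h1.
    + by move: h2 h3; clear; lia.
    + by move: h1 h3; clear; lia.
    + by move: h1 h4; clear; lia.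
    + by move: h1 h3; clear; lia.
exists (z ++ u ++ rev w); split.
- apply: trace_mem trm _; rewrite eidx all_map; apply: sub_all idxT => i; exact: sub_U.
- by apply: trace_uniq trm; rewrite eidx; apply: uniq_disjoint F3 uidx idxT.
- by rewrite (trace_size trm) eidx size_map !size_cat size_rev size_cat !size_map !size_iota /T; clear; lia.
- have -> : x ++ (z ++ u ++ rev w) ++ y = (x ++ z) ++ u ++ (rev w ++ y) by rewrite -!catA.
  apply: kpath_cat3; first by rewrite su.
    by rewrite -catA.
  by rewrite -[u in u ++ _]revK -[y]revK -!rev_cat kpath_rev -catA.
Qed.

End Connecting.

(** * Absorbers inside a neighbourhood *)

Section Absorbing.
Variable R : realType.
Implicit Types (G : sgraph) (p c d eta : R) (i j k J : nat).
Local Notation "## A" := (#|A|%:R : R) (at level 10, A at level 8).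

Definition absorbs G k (y m m' x : seq G) (v : G) : Prop :=
  [/\ kpath k (y ++ m ++ x), kpath k (y ++ m' ++ x), uniq (y ++ m ++ x)
    & perm_eq (y ++ m' ++ x) (v :: y ++ m ++ x)].

Definition absorbing_prop k J : Prop := exists K : nat, forall g : R, 0 < g ->
  exists2 c : R, 0 < c & eventually J (fun G p => forall (U : {set G}) v,
    v \notin U -> big g p 0 U -> big g p 1 (nb v :&: U) ->
    exists y m m' x,
      [/\ size y = k, size x = k, {subset y ++ m ++ x <= U} & (size (y ++ m ++ x) <= K)%N]
      /\ [/\ absorbs k y m m' x v, extendable c p k U y & extendable c p k U (rev x)]).

Lemma almost_notin G d (A : {set G}) (s : seq G) :
  (size s)%:R <= d * ##A -> almost d A (fun a => a \notin s).
Proof.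
move=> h; apply: le_trans h; rewrite ler_nat; apply: leq_trans (card_size s).
by apply/subset_leq_card/subsetP => a; rewrite inE negbK => /andP[].
Qed.

Lemma almost_iota G d (A : {set G}) (P : nat -> pred G) m : 0 <= d ->
  (forall j, (j < m)%N -> almost d A (P j)) ->
  almost (m%:R * d) A (fun a => all (P^~ a) (iota 0 m)).
Proof.
move=> d0; elim: m => [|m IH] h; first by apply: almost_all; rewrite ?mul0r.
have h' := almost_and (IH (fun j lt => h j (ltnW lt))) (h m (ltnSn m)).
apply: almost_sub h' _ _ => [|a _]; first by rewrite -natr1; lra.
by rewrite -addn1 iotaD all_cat /= andbT.
Qed.

(** The path grows at its front. The front needs common neighbours in N(v) to go on growing, and
    both ends need them in U to be connected later. A new vertex has exponent k + 1 and is tested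
    against exponents at most k, whence 2k + 1 <= J. *)
Lemma grow_in_neighbourhood k J g t : (0 < k)%N -> (2 * k + 1 <= J)%N -> 0 < g ->
  exists2 c : R, 0 < c & eventually J (fun G p => forall (U : {set G}) v,
    big g p 0 U -> big g p 1 (nb v :&: U) ->
    exists s : seq G, [/\ size s = t, {subset s <= nb v :&: U}, uniq s & kpath k s]
      /\ [/\ forall j, (j <= k)%N -> big c p j (U :&: cnb (take j s)),
             forall j, (j <= k)%N -> big c p j.+1 (nb v :&: U :&: cnb (take j s))
           & forall j, (j <= k)%N -> big c p j (U :&: cnb (take j (rev s)))]).
Proof.
move=> k0 kJ g0; elim: t => [|t [c c0 IH]].
  exists g => //; exists 1 => // G p [p0 p1 _ _ _] U v hU hN; exists [::]; split=> //.
  by split=> j jk; rewrite cnb_nil setIT; [move: hU|move: hN|move: hU]; apply: bigW => //; rewrite lexx ltW.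
(* 2k degree conditions and one of novelty may each fail on a fraction [d], and (2k + 1) d < 1. *)
pose d := 1 / (2 * k%:R + 2) : R.
have k0R : 0 < k%:R :> R by rewrite ltr0n.
have d0 : 0 < d by rewrite /d; pos.
have M0 : 0 < t.+1%:R / (d * c) by pos.
exists (c / 2); first by lra.
apply: eventually_imp (eventually_and IH (eventually_and (eventually_typical J c0 d0)
  (@eventually_large_le R _ J k.+1 M0 ltac:(lia)))) _.
move=> G p p0 p1 n0 [{}IH [ht hM]] U v hU hN.
have [s [[ss sN us ks] [h1 h2 h3]]] := IH U v hU hN.
set A := nb v :&: U :&: cnb (take k s).
have hA : big c p k.+1 A by apply: h2.
have a1 : almost (k%:R * d) A (fun a => all (fun j =>
    p * ##(U :&: cnb (take j s)) / 2 <= ##(nb a :&: (U :&: cnb (take j s)))) (iota 0 k)).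
  apply: almost_iota => [|j jk]; first exact: ltW.
  have kj : (k.+1 + j <= J)%N by move: jk kJ; clear; lia.
  by have [_ ? _ _] := ht _ _ A (U :&: cnb (take j s)) kj hA (h1 j (ltnW jk)).
have a2 : almost (k%:R * d) A (fun a => all (fun j =>
    p * ##(nb v :&: U :&: cnb (take j s)) / 2
      <= ##(nb a :&: (nb v :&: U :&: cnb (take j s)))) (iota 0 k)).
  apply: almost_iota => [|j jk]; first exact: ltW.
  have kj : (k.+1 + j.+1 <= J)%N by move: jk kJ; clear; lia.
  by have [_ ? _ _] := ht _ _ A (nb v :&: U :&: cnb (take j s)) kj hA (h2 j (ltnW jk)).
have a3 : almost d A (fun a => a \notin s).
  apply: almost_notin; rewrite ss; apply: (@le_trans _ _ (t.+1%:R)); first by rewrite ler_nat.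
  apply: le_trans (_ : d * (c * p ^+ k.+1 * ##G) <= _); last by apply: ler_wpM2l hA; exact: ltW.
  have := ler_wpM2l (_ : 0 <= d * c) hM.
  have -> : d * c * (t.+1%:R / (d * c)) = t.+1%:R by field; rewrite !lt0r_neq0.
  by rewrite !mulrA; apply; pos.
have [||a aA /andP[/andP[/allP ha1 /allP ha2] ha3]] := almost_ex (almost_and (almost_and a1 a2) a3).
- have -> : k%:R * d + k%:R * d + d = (2 * k%:R + 1) * d by ring.
  by rewrite /d mul1r ltr_pdivrMr; lra.
- by apply: big_gt0 hA.
have big1 j : (j < k)%N -> big (c / 2) p j.+1 (U :&: cnb (a :: take j s)).
  move=> jk; rewrite cnb_cons setICA; apply: (big_nb p0 (h1 j (ltnW jk))).
  by apply: ha1; rewrite mem_iota.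
have big2 j : (j < k)%N -> big (c / 2) p j.+2 (nb v :&: U :&: cnb (a :: take j s)).
  move=> jk; rewrite cnb_cons setICA; apply: (big_nb p0 (h2 j (ltnW jk))).
  by apply: ha2; rewrite mem_iota.
have c2 : 0 <= c / 2 <= c by apply/andP; split; lra.
move: aA; rewrite 2!in_setI in_cnb => /andP[/andP[va aU] as_].
exists (a :: s); split; first split.
- by rewrite /= ss.
- by move=> u; rewrite inE => /orP[/eqP->|/sN//]; rewrite in_setI va.
- by rewrite /= ha3.
- by rewrite /= ks andbT.
split.
- move=> [|j] jk /=; last exact: big1.
  by apply: bigW (h1 0%N isT) => //; rewrite take0.
- move=> [|j] jk /=; last exact: big2.
  by apply: bigW (h2 0%N isT) => //; rewrite take0.
- move=> j jk; rewrite rev_cons -cats1; have [jt|jt] := leqP j t.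
    by rewrite takel_cat ?size_rev ?ss //; apply: bigW (h3 j jk).
  (* Here the path has at most j vertices, so both ends have the same common neighbourhood. *)
  rewrite take_oversize; last by rewrite size_cat size_rev ss addn1.
  rewrite (@cnb_perm _ _ (a :: s)); last by move=> u; rewrite mem_cat mem_rev !inE orbC.
  case: j jt jk => // j jt jk; have := big1 j jk.
  by rewrite take_oversize // ss.
Qed.

(** Take a k-path on 2k vertices in N(v): its halves serve as the ends, and v fits between them. *)
Lemma absorbing_gt2 k J : (0 < k)%N -> (2 * k + 1 <= J)%N -> absorbing_prop k J.
Proof.
move=> k0 kJ; exists (2 * k)%N => g g0.
have [c c0 h] := @grow_in_neighbourhood k J g (2 * k) ltac:(lia) kJ g0.
exists c => //; apply: eventually_imp h _ => G p p0 p1 n0 h U v vU hU hN.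
have [s [[ss sN us ks] [h1 _ h3]]] := h U v hU hN.
have st : size (take k s) = k by rewrite size_takel // ss leq_pmull.
have sd : size (drop k s) = k by rewrite size_drop ss mul2n -addnn addnK.
exists (take k s), [::], [:: v], (drop k s); split; first split=> //=.
- by move=> u; rewrite cat_take_drop => /sN; rewrite inE => /andP[].
- by rewrite cat_take_drop ss.
split; first split.
- by rewrite cat_take_drop.
- have vs : all (sedge v) s by apply/allP => u /sN; rewrite !inE => /andP[].
  apply: kpath_insert; rewrite ?cat_take_drop //.
    by apply/allP => u /mem_take; apply/allP.
  by apply/allP => u /mem_drop; apply/allP.
- by rewrite cat_take_drop.
- by rewrite -[v :: _]cat1s perm_catCA.
- by move=> j jk; rewrite take_takel //; apply: h1.
- by move=> j jk; have := h3 j jk; rewrite -[s in rev s](cat_take_drop k) rev_cat takel_cat // size_rev sd.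
Qed.

End Absorbing.

(** * Connecting for squares *)

Section SquareConnecting.
Variable R : realType.
Implicit Types (G : sgraph) (p c d eta : R) (i j k J : nat).
Local Notation "## A" := (#|A|%:R : R) (at level 10, A at level 8).

Lemma sum_card_exchange (T : finType) (A B : {set T}) (r : T -> T -> bool) :
  \sum_(a in A) ##[set b in B | r a b] = \sum_(b in B) ##[set a in A | r a b].
Proof.
have E (X : {set T}) (P : pred T) : ##[set x in X | P x] = \sum_(x in X) (P x)%:R.
  rewrite -sum1_card natr_sum big_mkcond [RHS]big_mkcond; apply: eq_bigr => x _.
  by rewrite inE; case: (x \in X); case: (P x).
under eq_bigr do rewrite E; rewrite exchange_big /=.
by under [RHS]eq_bigr do rewrite E.
Qed.

Lemma eventually_edges J eta : 0 < eta -> eventually J (fun G p => forall X Y : {set G},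
  (edges R X Y - p * ##X * ##Y) ^+ 2 <= eta * p ^+ (J + 2) * ##G ^+ 2 * (##X * ##Y)).
Proof. by exists eta => // G p []. Qed.

Definition preds G (X1 X2 Ma : {set G}) (u : G) : {set G} :=
  [set w in Ma | sedge w u && [exists z2 in X2, [&& sedge z2 w, sedge z2 u
     & [exists z1 in X1, sedge z1 z2 && sedge z1 w]]]].

Lemma card_nb_le G p (A : {set G}) u : (forall v : G, ##(nb v) = p * ##G) ->
  {subset A <= nb u} -> ##A <= p * ##G.
Proof. by move=> dg sA; rewrite -(dg u) ler_nat; apply/subset_leq_card/subsetP. Qed.

Lemma big_half G c p i (A : {set G}) d (P : pred G) : 0 <= c -> 0 < p -> d <= 1 / 2 ->
  almost d A P -> big c p i A -> big (c / 2) p i [set a in A | P a].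
Proof.
move=> c0 p0 d2 /almost_card h; rewrite /big => hA; apply: le_trans h.
have : (1 / 2) * ##A <= (1 - d) * ##A by apply: ler_wpM2r => //; lra.
by rewrite -!mulrA in hA *; lra.
Qed.

(* A fixed edge has about [p^2 n] extensions but only about [p^3 n] ways of
   reaching a given third vertex, which the pseudorandomness cannot see when
   [lambda ~ p^(5/2) n]; two steps further the count is large again. *)
Lemma eventually_preds c : 0 < c -> exists2 c' : R, 0 < c' & eventually 3 (fun G p =>
  forall X1 X2 Ma Mb : {set G}, big c p 2 X1 -> big c p 1 X2 ->
  ##X2 <= p * ##G -> big c p 0 Ma -> big c p 0 Mb ->
  exists2 B : {set G}, B \subset Mb & big c' p 1 B /\
    forall u, u \in B -> big c' p 2 (preds X1 X2 Ma u)).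
Proof.
(* [c2] results from comparing the square of (c / 8) p^2 n s with (c / 4) p^5 n^2 s t in [key]; [c3]
   multiplies it by the factor c / 8 of [hT] and the factor c / 4 of [hD]. *)
move=> c0; pose c2 := c / 16; pose c3 := c2 * c ^+ 2 / 32.
have c30 : 0 < c3 by rewrite /c3 /c2; pos.
exists (c3 / 2); first by lra.
have c80 : 0 < c / 8 by lra.
have d0 : (0 : R) < 1 / 16 by lra.
have e0 : 0 < c / 4 by lra.
apply: eventually_imp (eventually_and (eventually_and (eventually_typical 3 c80 d0) (eventually_degree R 3)) (eventually_edges 3 e0)) _.
move=> G p p0 p1 n0 [[ht dg] he] X1 X2 Ma Mb hX1 hX2 X2p hMa hMb.
have W i (c1 : R) (A : {set G}) : c / 8 <= c1 -> big c1 p i A -> big (c / 8) p i A.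
  by move=> cc; apply: bigW => //; apply/andP; split; lra.
have c81 : c / 8 <= c by lra.
have c82 : c / 8 <= c / 2 by lra.
have c84 : c / 8 <= c / 4 by lra.
(* The z2 that some z1 continues to many w, and that have many neighbours in Mb. If they were few, a
   typical z1 would still have many neighbours among the other z2, and one of these would
   qualify. *)
pose D := [set z2 in X2 | [exists z1 in X1, sedge z1 z2 &&
   big (c / 4) p 2 (nb z2 :&: (nb z1 :&: Ma))] && big (c / 2) p 1 (nb z2 :&: Mb)].
have sD : D \subset X2 by apply/subsetP => z; rewrite inE => /andP[].
have hD : big (c / 4) p 1 D.
  suff : ##X2 / 4 <= ##D by apply: le_trans; move: hX2; rewrite /big -!mulrA; lra.
  rewrite leNgt; apply/negP => ltD.
  pose Y := [set z2 in X2 | big (c / 2) p 1 (nb z2 :&: Mb)].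
  pose X2' := Y :\: D.
  have [_ low _ _] := ht 1%N 0%N X2 Mb isT (W _ _ _ c81 hX2) (W _ _ _ c81 hMb).
  have hX2' : big (c / 2) p 1 X2'.
    have : almost (1 / 16 : R) X2 (fun z2 => big (c / 2) p 1 (nb z2 :&: Mb)).
      by apply: almost_sub low _ _ => // a _; apply: big_nb.
    move/almost_card; rewrite -/Y => h.
    have : ##Y <= ##X2' + ##D.
      by rewrite -natrD ler_nat -(cardsID D Y) addnC leq_add2l subset_leq_card // subsetIr.
    have X20 : 0 <= ##X2 by [].
    by move: hX2; rewrite /big -!mulrA; lra.
  have [_ l1 _ _] := ht 2%N 1%N X1 X2' isT (W _ _ _ c81 hX1) (W _ _ _ c82 hX2').
  have [_ l2 _ _] := ht 2%N 0%N X1 Ma isT (W _ _ _ c81 hX1) (W _ _ _ c81 hMa).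
  have [||z1 z1X /andP[h1 h2]] := almost_ex (almost_and l1 l2); [lra|exact: big_gt0 hX1|].
  have h1' : big (c / 4) p 2 (nb z1 :&: X2').
    by have -> : c / 4 = c / 2 / 2 by [field]; apply: (big_nb p0 hX2').
  have {}h2 := big_nb p0 hMa h2.
  have [_ l3 _ _] := ht 2%N 1%N (nb z1 :&: X2') (nb z1 :&: Ma) isT
    (W _ _ _ c84 h1') (W _ _ _ c82 h2).
  have [||z2] := almost_ex l3; [lra|exact: big_gt0 h1'|].
  rewrite !inE => /and4P[z12 nD z2X hz2] /(big_nb p0 h2) h3; case/negP: nD.
  rewrite z2X hz2 andbT /=; apply/existsP; exists z1; rewrite z1X z12 /=.
  by have -> : c / 4 = c / 2 / 2 by field.
pose r z2 w := [&& sedge z2 w, [exists z1 in X1, sedge z1 z2 && sedge z1 w],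
   big (c / 4) p 2 (nb w :&: (nb z2 :&: Mb)) & ##(nb w :&: X2) <= 2 * p * ##X2].
have hT z2 : z2 \in D -> c / 8 * p ^+ 2 * ##G <= ##[set w in Ma | r z2 w].
  rewrite inE => /andP[z2X /andP[/existsP[z1 /and3P[z1X z12 hA]] hM]].
  set A := _ :&: (_ :&: Ma) in hA.
  have [_ l1 _ _] := ht 2%N 1%N A (nb z2 :&: Mb) isT (W _ _ _ c84 hA) (W _ _ _ c82 hM).
  have [_ _ l2 _] := ht 2%N 1%N A X2 isT (W _ _ _ c84 hA) (W _ _ _ c81 hX2).
  have := big_half (ltW e0) p0 _ (almost_and l1 l2) hA.
  have -> : c / 4 / 2 = c / 8 by field.
  move=> /(_ ltac:(lra)) /le_trans; apply; rewrite ler_nat; apply/subset_leq_card/subsetP => w.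
  rewrite !inE => /andP[/and3P[z2w z1w ->] /andP[h1 h2]]; rewrite /r z2w h2 andbT /=.
  apply/andP; split; first by apply/existsP; exists z1; rewrite z1X z12.
  by have -> : c / 4 = c / 2 / 2 by [field]; apply: (big_nb p0 hM).
pose S w := [set z2 in D | r z2 w].
pose T w := [set u in Mb | sedge w u && [exists z2 in S w, sedge z2 u]].
(* [S w] has no lower bound on its size, so [mixing] does not apply and the edge estimate is used
   directly: each z in [S w] sends at least (c / 4) p^2 n edges to [T w]. *)
have key w : c2 * ##(S w) <= p * ##(T w).
  have [->|/set0Pn[z0]] := eqVneq (S w) set0; first by rewrite cards0 mulr0 mulr_ge0 // ltW.
  rewrite inE => /andP[_ /and4P[_ _ _ hw]].
  have sS : ##(S w) <= 2 * p ^+ 2 * ##G.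
    apply: (@le_trans _ _ (##(nb w :&: X2))).
      rewrite ler_nat; apply/subset_leq_card/subsetP => z; rewrite !inE.
      by move=> /andP[/andP[-> _] /andP[+ _]]; rewrite sedge_sym => ->.
    apply: le_trans hw _; have := ler_wpM2l (_ : 0 <= 2 * p) X2p.
    by rewrite expr2 !mulrA; apply; pos.
  have eS : c / 4 * p ^+ 2 * ##G * ##(S w) <= edges R (S w) (T w).
    apply: edges_ge => z zS; have := zS; rewrite inE => /andP[_ /and4P[_ _ hz _]].
    apply: le_trans hz _; rewrite ler_nat; apply/subset_leq_card/subsetP => u.
    rewrite !inE => /and3P[wu zu ->]; rewrite wu zu /=.
    by apply/existsP; exists z; rewrite zS.
  have := he (S w) (T w); move: eS sS.
  set e := edges _ _ _; set s := ##(S w); set t := ##(T w) => eS sS hst.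
  rewrite leNgt; apply/negP => lt.
  have s0 : 0 < s.
    rewrite lt0r ler0n andbT; apply: contraTneq lt => ->.
    by rewrite mulr0 -leNgt mulr_ge0 // ltW.
  have h1 : p * s * t <= c / 8 * p ^+ 2 * ##G * s.
    have : s * (p * t) <= s * (c2 * (2 * p ^+ 2 * ##G)).
      apply: ler_wpM2l; first exact: ltW.
      by apply: le_trans (ltW lt) _; apply: ler_wpM2l sS; rewrite /c2; lra.
    have -> : s * (c2 * (2 * p ^+ 2 * ##G)) = c / 8 * p ^+ 2 * ##G * s by rewrite /c2; field.
    by apply: le_trans; rewrite le_eqVlt; apply/orP; left; apply/eqP; ring.
  have h2 : c / 8 * p ^+ 2 * ##G * s <= e - p * s * t.
    have -> : c / 8 * p ^+ 2 * ##G * s = c / 4 * p ^+ 2 * ##G * s - c / 8 * p ^+ 2 * ##G * s by field.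
    by lra.
  have h3 : (c / 8 * p ^+ 2 * ##G * s) ^+ 2 <= (e - p * s * t) ^+ 2.
    rewrite ler_pXn2r // nnegrE; first by pos.
    by apply: le_trans h2; pos.
  have h4 := le_trans h3 hst.
  have h5 : p ^+ 4 * ##G ^+ 2 * s * (c / 4 * (c2 * s)) <= p ^+ 4 * ##G ^+ 2 * s * (c / 4 * (p * t)).
    apply: le_trans (le_trans _ h4) _; rewrite le_eqVlt; apply/orP; left; apply/eqP.
      by rewrite /c2; field.
    by rewrite /=; ring.
  rewrite ler_pM2l in h5; last by pos.
  rewrite ler_pM2l // in h5.
  by have := le_lt_trans h5 lt; rewrite ltxx.
have sumT : c3 * p ^+ 2 * ##G ^+ 2 <= \sum_(w in Ma) ##(T w).
  have h1 : c / 8 * p ^+ 2 * ##G * ##D <= \sum_(w in Ma) ##(S w).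
    rewrite /S -sum_card_exchange mulr_natr -sumr_const; exact: ler_sum.
  have h2 : c2 * \sum_(w in Ma) ##(S w) <= p * \sum_(w in Ma) ##(T w).
    by rewrite !mulr_sumr; apply: ler_sum.
  have h3 : c2 * (c / 8 * p ^+ 2 * ##G * (c / 4 * p ^+ 1 * ##G)) <= p * \sum_(w in Ma) ##(T w).
    apply: le_trans h2; apply: ler_wpM2l; first by rewrite /c2; lra.
    by apply: le_trans h1; apply: ler_wpM2l hD; pos.
  rewrite -(ler_pM2l p0); apply: le_trans h3; rewrite le_eqVlt; apply/orP; left; apply/eqP.
  by rewrite /c3; field.
pose Pr u := [set w in Ma | u \in T w].
have sumP : \sum_(w in Ma) ##(T w) = \sum_(u in Mb) ##(Pr u).
  rewrite /Pr -sum_card_exchange; apply: eq_bigr => w _; congr (_ %:R); apply: eq_card => u.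
  by rewrite !inE; case: (u \in Mb).
(* No u has more than p n predecessors, and those outside B contribute at most half of the bound in
   [sumT], so B has at least (c3 / 2) p n elements. *)
pose B := [set u in Mb | big (c3 / 2) p 2 (Pr u)].
have sB : B \subset Mb by apply/subsetP => u; rewrite inE => /andP[].
have hPr u : Pr u \subset preds X1 X2 Ma u.
  apply/subsetP => w; rewrite !inE => /and4P[-> _ wu /existsP[z2 /andP[]]].
  rewrite !inE => /andP[/andP[z2X _] /and4P[z2w hz _ _]] z2u; rewrite wu /=.
  by apply/existsP; exists z2; rewrite z2X z2w z2u.
exists B => //; split; last first.
  move=> u; rewrite inE => /andP[_ h]; apply: bigW h => //.
  by rewrite lexx andbT; lra.
have : \sum_(u in Mb) ##(Pr u) <= p * ##G * ##B + c3 / 2 * p ^+ 2 * ##G * ##G.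
  rewrite (big_setID B) /= (setIidPr sB); apply: lerD.
    rewrite mulr_natr -sumr_const; apply: ler_sum => u _.
    apply: (@card_nb_le _ _ _ u dg) => w /(subsetP (hPr u)); rewrite inE => /andP[_ /andP[wu _]].
    by rewrite inE sedge_sym.
  apply: (@le_trans _ _ (\sum_(u in Mb :\: B) (c3 / 2 * p ^+ 2 * ##G))).
    apply: ler_sum => u; rewrite !inE => /andP[+ uM]; rewrite uM /= -ltNge; exact: ltW.
  rewrite sumr_const -[_ *+ #|_|]mulr_natr; apply: ler_wpM2l; first by pos.
  by rewrite ler_nat max_card.
rewrite -sumP => h; have h2 : p * ##G * (c3 / 2 * p ^+ 1 * ##G) <= p * ##G * ##B.
  have := le_trans sumT h.
  have -> : c3 * p ^+ 2 * ##G ^+ 2 = c3 / 2 * p ^+ 2 * ##G * ##G + p * ##G * (c3 / 2 * p ^+ 1 * ##G).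
    by field.
  by lra.
by rewrite ler_pM2l // in h2; pos.
Qed.

Lemma reach_sub G k (x : seq G) Ds Es u :
  all2 (fun A B : {set G} => A \subset B) Ds Es -> reach k x Ds u -> reach k x Es u.
Proof.
move=> h /asboolP[z tz kz]; apply/asboolP; exists z => //.
elim: Ds Es z tz h {kz} => [|D Ds IH] [|E Es] [|a z] //= /andP[aD tz] /andP[DE h].
by rewrite (subsetP DE) //; apply: IH h.
Qed.

(** The chain is started at cliques with first vertex in the set B of [eventually_preds]. As B has
    exponent 1, [reach_chain] costs 1 + 2 = 3, against 2 + 2 for a start right next to x. *)
Lemma left_prop_2 : left_prop R 2 3 3.
Proof.
move=> c d' c0 d'0.
have [c' c'0 hpreds] := eventually_preds c0.
pose c1 := Num.min c c' / 2.
have [c1c c1c'] : c1 * 2 <= c /\ c1 * 2 <= c'.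
  by rewrite /c1 divfK ?pnatr_eq0 //; split; rewrite ge_min lexx ?orbT.
have c10 : 0 < c1 by rewrite /c1 divr_gt0 // lt_min c0.
have [d d0 hchain] := @reach_chain R 2 2 3 1 isT isT isT c1 d' c10 d'0.
have d2 : 0 < d / 2 by lra.
apply: eventually_imp (eventually_and (eventually_and hpreds hchain)
  (eventually_and (eventually_typical 3 c10 d2) (eventually_degree R 3))) _.
move=> G p p0 p1 n0 [[{}hpreds {}hchain] [ht dg]].
move=> [|x1 [|x2 [|//]]] // [|X1 [|X2 [|//]]] // [|Ma [|Mb [|M1 [|//]]]] // Ms _ kx _ _ sM hX.
move=> /and4P[hMa hMb hM1 _] hMs.
have [/= sX1 hX1] := hX 0%N isT; have [/= sX2 hX2] := hX 1%N isT.
have X2p : ##X2 <= p * ##G.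
  apply: (@card_nb_le _ _ _ x2 dg) => z /(subsetP sX2).
  by rewrite !inE /= andbT.
have [B sB [hB hP]] := hpreds X1 X2 Ma Mb hX1 hX2 X2p hMa hMb.
have W i (c2 : R) (A : {set G}) : c1 <= c2 -> big c2 p i A -> big c1 p i A.
  by move=> cc; apply: bigW => //; apply/andP; split; lra.
have c12 : c1 <= c / 2 by lra.
have c1c0 : c1 <= c by lra.
have c1c'0 : c1 <= c' by lra.
have start : almost_cliques d setT [:: B; M1] (reach 2 [:: x1; x2] [:: X1; X2; Ma]).
  rewrite /= setTI; have [_ l1 _ _] := ht 1%N 0%N B M1 isT (W _ _ _ c1c'0 hB) (W _ _ _ c1c0 hM1).
  apply: almost_sub l1 _ _; first by lra.
  move=> u uB hu; have {}hu := big_nb p0 hM1 hu.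
  have [_ _ _ hit] := ht 1%N 2%N (nb u :&: M1) _ isT (W _ _ _ c12 hu) (W _ _ _ c1c'0 (hP u uB)).
  rewrite setTI; apply: almost_sub hit _ _; first by lra.
  move=> u'; rewrite !inE => /andP[uu' _] /set0Pn[w]; rewrite !inE.
  move=> /and4P[u'w wMa wu /existsP[z2 /and4P[z2X z2w z2u /existsP[z1 /and3P[z1X z12 z1w]]]]].
  apply/asboolP; exists [:: z1; z2; w]; first by rewrite /= z1X z2X wMa.
  have := subsetP sX1 _ z1X; rewrite !inE /= andbT => /andP[x1z1 x2z1].
  have := subsetP sX2 _ z2X; rewrite !inE /= andbT => x2z2.
  move: kx; rewrite /= !andbT => x12.
  by rewrite x12 x1z1 x2z1 x2z2 z12 z1w z2w z2u wu uu' sedge_sym u'w.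
have hbs : bigs c1 p [:: 1%N; 0%N] setT [:: B; M1].
  by rewrite /= !setTI (W _ _ _ c1c'0 hB) (W _ _ _ c1c0 hM1).
have hMs' : all (big c1 p 0) Ms by apply: sub_all hMs => A; apply: W.
have pf : profile 1 [:: 1%N; 0%N] by move=> [|[|]].
have := hchain _ _ [:: B; M1] _ _ erefl sM pf hbs hMs' start.
rewrite /= drop0 take0; apply: almost_cliques_sub => // s _; apply: reach_sub.
by rewrite /= !subxx sB.
Qed.

End SquareConnecting.

(** * Absorbers for squares *)

Section SquareAbsorbing.
Variable R : realType.
Implicit Types (G : sgraph) (p c d eta : R) (i j k J : nat).
Local Notation "## A" := (#|A|%:R : R) (at level 10, A at level 8).

Definition extendable_pair G c p (U : {set G}) a b : bool :=
  big c p 1 (nb b :&: U) && big c p 2 (nb b :&: (nb a :&: U)).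

(* The absorber of [v] for [k = 2]: a closed walk [v, a1, .., a6] with [a1] adjacent
   to [a6], a common neighbour [b_i] of [a_(i-1)], [a_i] and [a_(i+1)] (where
   [a0 = a7 = v]), and square paths Q from (a1, b1) to (b4, a4) and Q' from (a3, b3)
   to (b6, a6). Then
     b2 a2 | a1 b1 Q b4 a4 | a3 b3 Q' b6 a6 | a5 b5   and
     b2 a2 | a3 b3 Q' b6 a6 | v | a1 b1 Q b4 a4 | a5 b5
   are both square paths. A copy of K_4 in the neighbourhood of [v], which would be
   simpler, need not exist at this density. [half_ends] is the set of possible [b3],
   given [a1] and [a3]. *)
Definition half_ends G c p a1 (B1 A2 B2 B3 U : {set G}) (a3 : G) : {set G} :=
  [set b3 in B3 | [&& sedge a3 b3, extendable_pair c p U a3 b3 &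
    [exists a2 in A2, [&& sedge a2 a3, sedge a2 b3,
      [exists b2 in B2, [&& sedge a2 b2, sedge a3 b2 & extendable_pair c p U a2 b2]]
      & [exists b1 in B1, sedge a2 b1 && extendable_pair c p U a1 b1]]]]].

Lemma almost_extendable_pair G c d p i a (B U : {set G}) : 0 < p -> 0 <= c ->
  almost d B (fun b => p * ##U / 2 <= ##(nb b :&: U)) ->
  almost d B (fun b => p * ##(nb a :&: U) / 2 <= ##(nb b :&: (nb a :&: U))) ->
  p <= 1 -> big (2 * c) p 0 U -> big (2 * c) p 1 (nb a :&: U) ->
  almost (d + d) B (fun b => extendable_pair c p U a b).
Proof.
move=> p0 c0 h1 h2 p1 hU haU; apply: almost_sub (almost_and h1 h2) _ _ => // b _ /andP[].
have E : c = 2 * c / 2 by field.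
by move=> /(big_nb p0 hU) + /(big_nb p0 haU); rewrite /extendable_pair /big -E => -> ->.
Qed.

(** The delicate vertex is b2, adjacent to a1, a2 and a3. Given a2 its candidates have exponent 2,
    so they can be tested against the neighbours a3 of a2, of exponent 1. [almost_exchange] then
    allows a3 to be chosen first, with almost all its neighbours a2 still good. *)
Lemma eventually_half_ends c d : 0 < c -> 0 < d -> exists2 c' : R, 0 < c' & eventually 3 (fun G p =>
  forall a1 (B1 A2 B2 A3 B3 U : {set G}),
    big c p 2 B1 -> big c p 1 A2 -> big c p 1 B2 ->
    big c p 0 A3 -> big c p 0 B3 -> big c p 0 U -> big c p 1 (nb a1 :&: U) ->
    almost d A3 (fun a3 => big c' p 1 (half_ends c' p a1 B1 A2 B2 B3 U a3))).
Proof.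
move=> c0 d0; pose c' := c / 16.
have c'0 : 0 < c' by rewrite /c'; lra.
exists c' => //.
pose d1 := Num.min (d / 4) (1 / 4).
have [d1d d1q] : d1 <= d / 4 /\ d1 <= 1 / 4 by split; rewrite /d1 ge_min lexx ?orbT.
have d10 : 0 < d1 by rewrite /d1 lt_min; apply/andP; split; lra.
have d101 : 0 < d1 <= 1 by rewrite d10; lra.
pose e := d1 ^+ 2 / 8.
have e0 : 0 < e by rewrite /e; pos.
have ed : e <= d1 / 32.
  rewrite /e expr2; have := ler_wpM2l (ltW d10) d1q; lra.
apply: eventually_imp (eventually_and (eventually_typical 3 c'0 e0) (eventually_exchange 3 c'0 d101)) _.
move=> G p p0 p1 n0 [ht hx] a1 B1 A2 B2 A3 B3 U hB1 hA2 hB2 hA3 hB3 hU haU.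
have W i (c1 : R) (A : {set G}) : c' <= c1 -> big c1 p i A -> big c' p i A.
  by move=> cc; apply: bigW => //; apply/andP; split=> //; exact: ltW.
have k1 : c' <= c by rewrite /c'; lra.
have k2 : c' <= c / 2 by rewrite /c'; lra.
have k4 : c' <= c / 2 / 2 by rewrite /c'; lra.
have k8 : c' <= c / 2 / 2 / 2 by rewrite /c'; lra.
have kk : c' <= 2 * c' by lra.
have V i (c1 : R) (A : {set G}) : 2 * c' <= c1 -> big c1 p i A -> big (2 * c') p i A.
  by move=> cc; apply: bigW => //; apply/andP; split=> //; lra.
have m1 : 2 * c' <= c by rewrite /c'; lra.
have m2 : 2 * c' <= c / 2 by rewrite /c'; lra.
have GE i c1 a (B : {set G}) : (i <= 2)%N -> c' <= c1 -> big c1 p i B ->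
    big (2 * c') p 1 (nb a :&: U) -> almost (e + e) B (extendable_pair c' p U a).
  move=> i2 cc hB ha.
  have i0J : (i + 0 <= 3)%N by move: i2; clear; lia.
  have i1J : (i + 1 <= 3)%N by move: i2; clear; lia.
  have [_ l1 _ _] := ht i 0%N B U i0J (W _ _ _ cc hB) (W _ _ _ k1 hU).
  have [_ l2 _ _] := ht i 1%N B (nb a :&: U) i1J (W _ _ _ cc hB) (W _ _ _ kk ha).
  by apply: almost_extendable_pair => //; [exact: ltW | exact: V hU].
pose B1' := [set b in B1 | extendable_pair c' p U a1 b].
have hB1' : big (c / 2) p 2 B1'.
  by apply: big_half (GE 2%N _ _ _ isT k1 hB1 (V _ _ _ m1 haU)) hB1; move: c0 p0 d0 e0 ed d1d d1q; clear; lra.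
pose A2' := [set a in A2 | [&& nb a :&: B1' != set0, p * ##B2 / 2 <= ##(nb a :&: B2)
  & p * ##U / 2 <= ##(nb a :&: U)]].
have hA2' : big (c / 2) p 1 A2'.
  have [_ _ _ t1] := ht 1%N 2%N A2 B1' isT (W _ _ _ k1 hA2) (W _ _ _ k2 hB1').
  have [_ t2 _ _] := ht 1%N 1%N A2 B2 isT (W _ _ _ k1 hA2) (W _ _ _ k1 hB2).
  have [_ t3 _ _] := ht 1%N 0%N A2 U isT (W _ _ _ k1 hA2) (W _ _ _ k1 hU).
  by apply: big_half (almost_and t1 (almost_and t2 t3)) hA2; move: c0 p0 d0 e0 ed d1d d1q; clear; lra.
pose B2' a := [set b in nb a :&: B2 | extendable_pair c' p U a b].
have hB2' a : a \in A2' -> big (c / 2 / 2) p 2 (B2' a).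
  rewrite inE => /and4P[_ _ /(big_nb p0 hB2) t2 /(big_nb p0 hU) t3].
  by apply: big_half (GE 2%N _ _ _ isT k2 t2 (V _ _ _ m2 t3)) t2; move: c0 p0 d0 e0 ed d1d d1q; clear; lra.
pose E a a3 := nb a3 :&: B2' a != set0.
have hE : almost d1 A3 (fun a3 => almost d1 (nb a3 :&: A2') (E^~ a3)).
  apply: (hx 1%N 0%N _ _ _ isT (W _ _ _ k2 hA2') (W _ _ _ k1 hA3)).
  have [_ t1 _ _] := ht 1%N 0%N A2' A3 isT (W _ _ _ k2 hA2') (W _ _ _ k1 hA3).
  apply: almost_sub t1 _ _ => // a aA /(big_nb p0 hA3) t1.
  by have [_ _ _ t2] := ht 1%N 2%N _ _ isT (W _ _ _ k2 t1) (W _ _ _ k4 (hB2' a aA)).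
have [_ t1 _ _] := ht 0%N 1%N A3 A2' isT (W _ _ _ k1 hA3) (W _ _ _ k2 hA2').
have [_ t2 _ _] := ht 0%N 0%N A3 B3 isT (W _ _ _ k1 hA3) (W _ _ _ k1 hB3).
have [_ t3 _ _] := ht 0%N 0%N A3 U isT (W _ _ _ k1 hA3) (W _ _ _ k1 hU).
apply: almost_sub (almost_and hE (almost_and t1 (almost_and t2 t3))) _ _; first by move: c0 p0 d0 e0 ed d1d d1q; clear; lra.
move=> a3 _ /and4P[hE3 /(big_nb p0 hA2') s1 /(big_nb p0 hB3) s2 /(big_nb p0 hU) s3].
(* The a2 that work for a3 have exponent 2 and the b3 next to a3 exponent 1, again with sum 3. *)
pose X := [set a in nb a3 :&: A2' | E a a3].
have hX : big (c / 2 / 2 / 2) p 2 X by apply: big_half hE3 s1; move: c0 p0 d0 e0 ed d1d d1q; clear; lra.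
have [_ _ _ u1] := ht 1%N 2%N _ X isT (W _ _ _ k2 s2) (W _ _ _ k8 hX).
have u2 := GE 1%N _ _ _ isT k2 s2 (V _ _ _ m2 s3).
have := big_half (ltW (lt_le_trans c'0 k2)) p0 _ (almost_and u1 u2) s2.
move=> /(_ ltac:(move: c0 p0 d0 e0 ed d1d d1q; clear; lra)); apply: bigW => //; first by apply/andP; split; [exact: ltW|].
apply/subsetP => b; rewrite !inE => /andP[/andP[a3b bB] /andP[/set0Pn[a] + gb]].
rewrite !inE => /andP[ba /andP[/andP[a3a /andP[aA /andP[/set0Pn[b1] + _]]] /set0Pn[b2]]].
rewrite !inE => /andP[ab1 /andP[b1B gb1]] /andP[a3b2 /andP[/andP[ab2 b2B] gb2]].
rewrite bB a3b gb /=; apply/existsP; exists a.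
rewrite aA sedge_sym a3a sedge_sym ba /=; apply/andP; split; apply/existsP.
  by exists b2; rewrite b2B ab2 a3b2.
by exists b1; rewrite b1B ab1.
Qed.

(** Boundedly many vertices are negligible even against p^k n, by [eventually_large_le]. *)
Lemma eventually_extendable_setD J k K c : (k <= J.+1)%N -> 0 < c -> eventually J (fun G p =>
  forall (U Z : {set G}) s, (#|Z| <= K)%N -> extendable c p k U s -> extendable (c / 2) p k (U :\: Z) s).
Proof.
move=> kJ c0; have M0 : 0 < (K.+1)%:R * 2 / c by pos.
apply: eventually_imp (eventually_large_le M0 kJ) _ => G p p0 p1 n0 hM U Z s hZ h j jk.
have := h j jk; rewrite /big => hj.
have : ##(U :&: cnb (take j s)) <= ##((U :\: Z) :&: cnb (take j s)) + K%:R.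
  rewrite -natrD ler_nat; apply: leq_trans (leq_add (leqnn _) hZ).
  apply: leq_trans (leq_card_setU _ _); apply/subset_leq_card/subsetP => x.
  by rewrite !inE => /andP[-> ->]; case: (x \in Z).
have : K%:R <= c / 2 * p ^+ j * ##G.
  have pj : p ^+ k * ##G <= p ^+ j * ##G.
    by apply: ler_wpM2r => //; apply: ler_wiXn2l => //; exact: ltW.
  have := ler_wpM2l (_ : 0 <= c / 2) (le_trans hM pj).
  have -> : c / 2 * (K.+1%:R * 2 / c) = K.+1%:R by field; rewrite lt0r_neq0.
  rewrite mulrA => h1; apply: le_trans (h1 ltac:(lra)).
  by rewrite ler_nat.
move: hj; have -> : c * p ^+ j * ##G = c / 2 * p ^+ j * ##G + c / 2 * p ^+ j * ##G by field.
by lra.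
Qed.

Lemma extendable_of_pair G c p (U : {set G}) a b : big c p 0 U -> extendable_pair c p U a b ->
  extendable c p 2 U [:: b; a].
Proof.
move=> hU /andP[h1 h2] [|[|[|//]]] _ /=; first by rewrite cnb_nil setIT.
  by rewrite cnb_cons cnb_nil setIT setIC.
by rewrite !cnb_cons cnb_nil setIT setIC -setIA.
Qed.

Lemma kpath2_glue G (s t : seq G) u1 u2 : kpath 2 (s ++ [:: u1; u2]) ->
  kpath 2 [:: u1, u2 & t] -> kpath 2 (s ++ [:: u1, u2 & t]).
Proof. by move=> h1 h2; apply: (@kpath_cat3 _ 2 s [:: u1; u2] t). Qed.

(** The halves a1, a2, a3 and a6, a5, a4 of the closed walk are exchanged by i -> 7 - i, so
    [eventually_half_ends] serves both; they are then joined along the edge a3 a4. *)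
Lemma absorbing_2 : connecting_prop R 2 3 -> absorbing_prop R 2 3.
Proof.
move=> [Kc hconn]; exists (12 + 2 * Kc)%N => g g0.
pose c1 := g / (2 * 13%:R).
have c10 : 0 < c1 by rewrite /c1; pos.
pose c2 := c1 / 2; have c20 : 0 < c2 by rewrite /c2; lra.
(* 1 / 128 = (1 / 4)^2 / 8 is the error that the exchange of a3 and a4 turns into 1 / 4. *)
have d128 : (0 : R) < 1 / 128 by lra.
have [c' c'0 hhalf] := eventually_half_ends c20 d128.
pose c4 := Num.min c1 c'.
have c40 : 0 < c4 by rewrite lt_min c10.
exists c4 => //.
pose c3 := c4 / 4.
have [c41 c4'] : c4 <= c1 /\ c4 <= c' by split; rewrite ge_min lexx ?orbT.
have c30 : 0 < c3 by rewrite /c3; lra.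
have [k1 k2 k4 k'] : [/\ c3 <= c1, c3 <= c1 / 2, c3 <= c1 / 2 / 2 & c3 <= c'].
  by rewrite /c3; split; lra.
have [c10' c102 c104] : [/\ 0 <= c1, 0 < c1 / 2 & 0 < c1 / 2 / 2] by split; lra.
have c41' : 0 <= c4 <= c1 by apply/andP; split=> //; exact: ltW.
have c4c' : 0 <= c4 <= c' by apply/andP; split=> //; exact: ltW.
have c21 : 0 <= c2 <= c1 by rewrite /c2; apply/andP; split; lra.
pose q : R := 1 / 128.
have [s2 s3 s4 s5] : [/\ q + q < 1, q + (1 / 4 + q) < 1, q + (q + (q + q)) < 1
  & q + (q + (q + (q + q))) < 1] by rewrite /q; split; lra.
have [s6 s7] : q <= 1 / 2 /\ q + 1 / 4 < 1 by rewrite /q; split; lra.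
have q4 : 0 < (1 / 4 : R) <= 1 by lra.
have c420 : 0 < c4 / 2 by lra.
apply: eventually_imp (eventually_and (eventually_and hhalf (eventually_and (eventually_typical 3 c30 d128) (eventually_exchange 3 c30 q4)))
  (eventually_and (eventually_and (hconn _ c40) (hconn _ c420)) (eventually_and (@eventually_extendable_setD 3 2 Kc _ isT c40)
  (@eventually_disjoint R 13 3 1 g isT g0 isT)))) _.
move=> G p p0 p1 n0 [[{}hhalf [ht hx]] [[hc1 hc2] [hgood hdis]]] U v vU hU hN.
(* Indices 0 to 3 are for a1, a6, b1, b6, the neighbours of v; 4 to 7 for a2 to a5; 8 to 11 for b2
   to b5; 12 holds the two connecting paths and witnesses that the ends are extendable. *)
pose S i := if (i < 4)%N then nb v :&: U else U.
pose e i := if (i < 4)%N then 1%N else 0%N.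
have [||F [F1 F2 F3 _]] := hdis S e.
- move=> i j /andP[ji _]; rewrite /e; case: ltnP => i4; last by case: ltnP.
  by rewrite (leq_ltn_trans ji i4).
- by move=> i _; rewrite /S /e; case: ifP.
rewrite -/c1 in F2.
have W i (c : R) (A : {set G}) : c3 <= c -> big c p i A -> big c3 p i A.
  by move=> cc; apply: bigW => //; apply/andP; split=> //; exact: ltW.
have V i (A : {set G}) : big c1 p i A -> big c2 p i A.
  exact: bigW.
have pick i j (A B : {set G}) (c : R) : (i + j <= 3)%N -> c3 <= c -> big c p i A -> big c1 p j B ->
    almost (1 / 128 : R) A (fun a => p * ##B / 2 <= ##(nb a :&: B)).
  by move=> ij cc hA hB; have [] := ht i j A B ij (W _ _ _ cc hA) (W _ _ _ k1 hB).
have f1 i : (i < 4)%N -> big c1 p 1 (F i).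
  by move=> i4; have := F2 i (leq_trans i4 (isT : (4 <= 13)%N)); rewrite /e i4.
have f0 i : (4 <= i < 13)%N -> big c1 p 0 (F i).
  by move=> /andP[i4 i13]; have := F2 i i13; rewrite /e ltnNge i4.
have [||a1 a1F /and4P[a1_6 a1b1 a1a2 /andP[a1b2 a1U]]] := almost_ex
  (almost_and (pick 1%N 1%N _ _ _ isT k1 (f1 0%N isT) (f1 1%N isT))
  (almost_and (pick 1%N 1%N _ _ _ isT k1 (f1 0%N isT) (f1 2%N isT))
  (almost_and (pick 1%N 0%N _ _ _ isT k1 (f1 0%N isT) (f0 4%N isT))
  (almost_and (pick 1%N 0%N _ _ _ isT k1 (f1 0%N isT) (f0 8%N isT))
              (pick 1%N 0%N _ _ _ isT k1 (f1 0%N isT) (f0 12%N isT)))))).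
- exact: s5.
- exact: big_gt0 (f1 0%N isT).
have {}a1_6 := big_nb p0 (f1 1%N isT) a1_6.
have [||a6 a6F /and4P[a6b6 a6a5 a6b5 a6U]] := almost_ex
  (almost_and (pick 2%N 1%N _ _ _ isT k2 a1_6 (f1 3%N isT))
  (almost_and (pick 2%N 0%N _ _ _ isT k2 a1_6 (f0 7%N isT))
  (almost_and (pick 2%N 0%N _ _ _ isT k2 a1_6 (f0 11%N isT))
              (pick 2%N 0%N _ _ _ isT k2 a1_6 (f0 12%N isT))))).
- exact: s4.
- exact: big_gt0 a1_6.
have hT := hhalf a1 _ _ _ _ _ _ (big_nb p0 (f1 2%N isT) a1b1) (big_nb p0 (f0 4%N isT) a1a2)
  (big_nb p0 (f0 8%N isT) a1b2) (V _ _ (f0 5%N isT)) (V _ _ (f0 9%N isT)) (V _ _ (f0 12%N isT))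
  (big_nb p0 (f0 12%N isT) a1U).
have hT' := hhalf a6 _ _ _ _ _ _ (big_nb p0 (f1 3%N isT) a6b6) (big_nb p0 (f0 7%N isT) a6a5)
  (big_nb p0 (f0 11%N isT) a6b5) (V _ _ (f0 6%N isT)) (V _ _ (f0 10%N isT)) (V _ _ (f0 12%N isT))
  (big_nb p0 (f0 12%N isT) a6U).
move: hT hT'; set T := half_ends _ _ _ _ _ _ _ _; set T' := half_ends _ _ _ _ _ _ _ _ => hT hT'.
pose A3 := [set a in F 5 | big c' p 1 (T a)]; pose A4 := [set a in F 6 | big c' p 1 (T' a)].
have hA3 : big (c1 / 2) p 0 A3 by apply: big_half hT (f0 5%N isT).
have hA4 : big (c1 / 2) p 0 A4 by apply: big_half hT' (f0 6%N isT).
(* b3 must see a4 and b4 must see a3. The first is typical when a3 is chosen before a4, the second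
   when a4 is chosen before a3; an exchange brings both to the same order. *)
have join (A B : {set G}) (X : G -> {set G}) : big (c1 / 2) p 0 A -> big (c1 / 2) p 0 B ->
    (forall a, a \in A -> big c' p 1 (X a)) ->
    almost (1 / 128 : R) A (fun a => almost (1 / 128 : R) (nb a :&: B) (fun b => nb b :&: X a != set0)).
  move=> hA hB hXa.
  have [_ t1 _ _] := ht 0%N 0%N A B isT (W _ _ _ k2 hA) (W _ _ _ k2 hB).
  apply: almost_sub t1 _ _ => // a aA /(big_nb p0 hB) t1.
  by have [] := ht 1%N 1%N _ (X a) isT (W _ _ _ k4 t1) (W _ _ _ k' (hXa a aA)).
have j1 : almost (1 / 128 : R) A3 (fun a => almost (1 / 128 : R) (nb a :&: A4) (fun b => nb b :&: T a != set0)).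
  by apply: join => // a; rewrite inE => /andP[].
have j2 : almost (1 / 128 : R) A4 (fun a => almost (1 / 128 : R) (nb a :&: A3) (fun b => nb b :&: T' a != set0)).
  by apply: join => // a; rewrite inE => /andP[].
have q128 : 1 / 128 = (1 / 4) ^+ 2 / 8 :> R by field.
rewrite q128 in j2; have {}j2 := hx 0%N 0%N _ _ _ isT (W _ _ _ k2 hA4) (W _ _ _ k2 hA3) j2.
have [_ t1 _ _] := ht 0%N 0%N A3 A4 isT (W _ _ _ k2 hA3) (W _ _ _ k2 hA4).
have [||a3 a3A /and3P[ja jb /(big_nb p0 hA4) a3A4]] := almost_ex (almost_and j1 (almost_and j2 t1)).
- exact: s3.
- exact: big_gt0 hA3.
have [||a4 + /andP[/set0Pn[b3 b3T] /set0Pn[b4 b4T]]] := almost_ex (almost_and ja jb).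
- exact: s7.
- exact: big_gt0 a3A4.
rewrite !inE => /and3P[a34 a4F _]; move: a3A; rewrite inE => /andP[a3F _].
move: b3T b4T; rewrite !inE => /and5P[a43 b3F a3b3 g3 /existsP[a2]].
rewrite !inE => /andP[/andP[a12 a2F] /and4P[a23 a2b3]].
move=> /existsP[b2]; rewrite !inE => /andP[/andP[a1b2' b2F] /and3P[a2b2 a3b2 g2]].
move=> /existsP[b1]; rewrite !inE => /andP[/andP[a1b1' b1F] /andP[a2b1 g1]].
move=> /and5P[a34' b4F a4b4 g4 /existsP[a5]].
rewrite !inE => /andP[/andP[a65 a5F] /and4P[a54 a5b4]].
move=> /existsP[b5]; rewrite !inE => /andP[/andP[a6b5' b5F] /and3P[a5b5 a4b5 g5]].
move=> /existsP[b6]; rewrite !inE => /andP[/andP[a6b6' b6F] /andP[a5b6 g6]].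
move: a6F; rewrite !inE => /andP[a16 a6F].
have sub_U i : (i < 13)%N -> {subset F i <= U}.
  move=> i13 z /(subsetP (F1 i i13)); rewrite /S.
  by case: ifP => // _; rewrite inE => /andP[].
have vN i z : (i < 4)%N -> z \in F i -> sedge v z.
  move=> i4 /(subsetP (F1 i (leq_trans i4 (isT : (4 <= 13)%N)))).
  by rewrite /S i4 !inE => /andP[].
have va1 := vN 0%N _ isT a1F; have va6 := vN 1%N _ isT a6F.
have vb1 := vN 2%N _ isT b1F; have vb6 := vN 3%N _ isT b6F.
have hU0 : big c4 p 0 (F 12) by apply: bigW (f0 12%N isT).
have G4 a b : extendable_pair c' p (F 12) a b -> extendable c4 p 2 (F 12) [:: b; a].
  move=> /andP[h1 h2]; apply: extendable_of_pair => //; rewrite /extendable_pair.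
  by apply/andP; split; [apply: bigW h1 | apply: bigW h2].
have ab1 : sedge a1 b1 by [].
have [||Q1 [Q1F uQ1 sQ1 kQ1]] := hc1 (F 12) [:: a1; b1] [:: b4; a4] erefl erefl _ _ (G4 _ _ g1) (G4 _ _ g4).
- by rewrite /= a1b1'.
- by rewrite /= sedge_sym a4b4.
have cQ1 : (#|[set z in Q1]| <= Kc)%N by rewrite cardsE (card_uniqP uQ1).
have [||Q2 [Q2F uQ2 sQ2 kQ2]] := hc2 (F 12 :\: [set z in Q1]) [:: a3; b3] [:: b6; a6] erefl erefl _ _
   (hgood _ _ _ cQ1 (G4 _ _ g3)) (hgood _ _ _ cQ1 (G4 _ _ g6)).
- by rewrite /= a3b3.
- by rewrite /= sedge_sym a6b6'.
pose E12 := [:: a1; a6; b1; b6; a2; a3; a4; a5; b2; b3; b4; b5].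
have tE : trace E12 (map F (iota 0 12)).
  by rewrite /= a1F a6F b1F b6F a2F a3F a4F a5F b2F b3F b4F b5F.
have uE : uniq E12.
  by apply: trace_uniq tE; apply: uniq_disjoint F3 _ _; rewrite ?iota_uniq.
have nE z : z \in E12 -> z \notin F 12.
  move=> /(nthP v)[i i12 <-]; have := trace_nth v tE i12.
  rewrite (nth_map 0%N) ?size_iota // nth_iota // add0n => zi.
  apply/negP => z12; have := F3 i 12%N; rewrite i12 => /(_ isT)/disjointFr/(_ zi).
  by rewrite z12.
have uall : uniq (E12 ++ Q1 ++ Q2).
  apply: cat_uniq_disjoint => //; first apply: cat_uniq_disjoint => //.
    by move=> z zQ1 /Q2F; rewrite !inE zQ1.
  move=> z /nE/negP nz; rewrite mem_cat => /orP[/Q1F//|/Q2F].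
  by rewrite inE => /andP[_].
pose m := [:: a1; b1] ++ Q1 ++ [:: b4; a4; a3; b3] ++ Q2 ++ [:: b6; a6].
pose m' := [:: a3; b3] ++ Q2 ++ [:: b6; a6; v; a1; b1] ++ Q1 ++ [:: b4; a4].
have pS : perm_eq ([:: b2; a2] ++ m ++ [:: a5; b5]) (E12 ++ Q1 ++ Q2).
  by apply/permP => P; rewrite /= !count_cat /= !count_cat /=; ring.
have pS' : perm_eq ([:: b2; a2] ++ m' ++ [:: a5; b5]) (v :: [:: b2; a2] ++ m ++ [:: a5; b5]).
  by apply/permP => P; rewrite /= !count_cat /= !count_cat /=; ring.
have sU : {subset [:: b2; a2] ++ m ++ [:: a5; b5] <= U}.
  move=> z; rewrite (perm_mem pS) !mem_cat => /or3P[zE|/Q1F|/Q2F].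
  - have [i i12 <-] := nthP v zE; have := trace_nth v tE i12.
    rewrite (nth_map 0%N) ?size_iota // nth_iota // add0n; apply: sub_U.
    exact: leq_trans i12 _.
  - exact: sub_U.
  - by rewrite inE => /andP[_]; apply: sub_U.
have e1 : kpath 2 [:: b2; a2; a1; b1].
  by rewrite /= !(sedge_sym b2) (sedge_sym a2 a1) a2b2 a1b2' a12 a2b1 a1b1'.
have e2 : kpath 2 [:: b4; a4; a3; b3].
  by rewrite /= !(sedge_sym b4) (sedge_sym a4 a3) a4b4 a34' a34 a43 a3b3.
have e3 : kpath 2 [:: b6; a6; a5; b5].
  by rewrite /= !(sedge_sym b6) a6b6' a5b6 a65 a6b5' a5b5.
have e4 : kpath 2 [:: b2; a2; a3; b3].
  by rewrite /= !(sedge_sym b2) a2b2 a3b2 a23 a2b3 a3b3.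
have e5 : kpath 2 [:: b6; a6; v; a1; b1].
  by rewrite /= !(sedge_sym b6) (sedge_sym a6 v) (sedge_sym a6 a1) a6b6' vb6 va6 a16 va1 vb1 a1b1'.
have e6 : kpath 2 [:: b4; a4; a5; b5].
  by rewrite /= !(sedge_sym b4) (sedge_sym a4 a5) a4b4 a5b4 a54 a4b5 a5b5.
have kp1 : kpath 2 ([:: b2; a2] ++ m ++ [:: a5; b5]).
  have h3 := @kpath2_glue _ ([:: a3; b3] ++ Q2) [:: a5; b5] b6 a6 kQ2 e3.
  have h2 := @kpath2_glue _ [:: b4; a4] (Q2 ++ [:: b6; a6; a5; b5]) a3 b3 e2 h3.
  have h1 := @kpath2_glue _ ([:: a1; b1] ++ Q1) ([:: a3; b3] ++ Q2 ++ [:: b6; a6; a5; b5]) b4 a4 kQ1 h2.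
  have := @kpath2_glue _ [:: b2; a2] (Q1 ++ [:: b4; a4; a3; b3] ++ Q2 ++ [:: b6; a6; a5; b5]) a1 b1 e1 h1.
  by rewrite /m /= -!catA /= -!catA.
have kp2 : kpath 2 ([:: b2; a2] ++ m' ++ [:: a5; b5]).
  have h3 := @kpath2_glue _ ([:: a1; b1] ++ Q1) [:: a5; b5] b4 a4 kQ1 e6.
  have h2 := @kpath2_glue _ [:: b6; a6; v] (Q1 ++ [:: b4; a4; a5; b5]) a1 b1 e5 h3.
  have h1 := @kpath2_glue _ ([:: a3; b3] ++ Q2) ([:: v; a1; b1] ++ Q1 ++ [:: b4; a4; a5; b5]) b6 a6 kQ2 h2.
  have := @kpath2_glue _ [:: b2; a2] (Q2 ++ [:: b6; a6; v; a1; b1] ++ Q1 ++ [:: b4; a4; a5; b5]) a3 b3 e4 h1.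
  by rewrite /m' /= -!catA /= -!catA.
have GU a b : extendable_pair c' p (F 12) a b -> extendable c4 p 2 U [:: b; a].
  move=> /G4 h j j_2; apply: bigW (h j j_2) => //; first by rewrite lexx ltW.
  by apply: setSI; apply/subsetP; apply: sub_U.
exists [:: b2; a2], m, m', [:: a5; b5]; split; split=> //.
- by rewrite (perm_size pS) !size_cat; move: sQ1 sQ2; clear; rewrite /=; lia.
- by split=> //; rewrite (perm_uniq pS).
- exact: GU.
- exact: GU.
Qed.

End SquareAbsorbing.

(** * Absorbing vertices one at a time *)

Section Process.
Variable R : realType.
Implicit Types (G : sgraph) (p c d eta : R) (i j k J : nat).
Local Notation "## A" := (#|A|%:R : R) (at level 10, A at level 8).

(** The vertices of [A] are optional. Only the middle of the path depends on [B]; [y] stays fixed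
    for good and [x] moves when the path is lengthened. *)
Definition absorbing_path G k (y x : seq G) (W A : {set G}) : Prop :=
  size x = k /\ forall B : {set G}, B \subset A ->
    exists m, [/\ kpath k (y ++ m ++ x), uniq (y ++ m ++ x)
                & [set z in y ++ m ++ x] = W :|: B].

Lemma absorbing_path_init G k (y m m' x : seq G) v : size x = k ->
  v \notin y ++ m ++ x -> absorbs k y m m' x v ->
  absorbing_path k y x [set z in y ++ m ++ x] [set v].
Proof.
move=> sx vS [k1 k2 u1 pm]; split=> // B; rewrite subset1 => /orP[/eqP->|/eqP->].
  exists m'; split=> //; first by rewrite (perm_uniq pm) cons_uniq vS.
  by apply/setP => z; rewrite inE (perm_mem pm) in_cons in_setU in_set1 inE orbC.
by exists m; split=> //; rewrite setU0.
Qed.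

(** Optional vertices used by the new segment pass from A to W, and the old path is asked only for
    subsets avoiding them. Membership of v in B decides between [m2'] and [m2]. *)
Lemma absorbing_path_extend G k (y x c y2 m2 m2' x2 : seq G) (W A : {set G}) v :
  size y2 = k -> size x2 = k -> absorbing_path k y x W A -> absorbs k y2 m2 m2' x2 v ->
  kpath k (x ++ c ++ y2) -> uniq (c ++ y2 ++ m2 ++ x2) ->
  v \notin c ++ y2 ++ m2 ++ x2 -> v \notin W ->
  (forall z, z \in c ++ y2 ++ m2 ++ x2 -> z \notin W) ->
  absorbing_path k y x2 (W :|: [set z in c ++ y2 ++ m2 ++ x2])
    ((A :\: [set z in c ++ y2 ++ m2 ++ x2]) :|: [set v]).
Proof.
move=> sy2 sx2 [sx hA] [k1 k2 u1 pm] kc; set Q := c ++ _ => uQ vQ vW QW.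
split=> // B sB.
pose m2'' := if v \in B then m2' else m2.
have km2 : kpath k (y2 ++ m2'' ++ x2) by rewrite /m2''; case: ifP.
have hm2 z : z \in c ++ y2 ++ m2'' ++ x2 <-> (z \in Q) || ((z == v) && (v \in B)).
  rewrite /m2'' /Q mem_cat [z \in c ++ _]mem_cat; case: (v \in B); last by rewrite andbF orbF.
  by rewrite (perm_mem pm) in_cons andbT; case: (z \in c); case: (z == v); rewrite ?orbT ?orbF.
have um2 : uniq (c ++ y2 ++ m2'' ++ x2).
  rewrite /m2''; case: (v \in B) => //.
  move: uQ vQ; rewrite /Q !(cat_uniq c) mem_cat negb_or => /and3P[uc /hasPn hc uy] /andP[vc vy].
  rewrite uc (perm_uniq pm) cons_uniq vy uy /= !andbT; apply/hasPn => z.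
  by rewrite (perm_mem pm) in_cons => /orP[/eqP->//|/hc].
have sB1 : B :\ v \subset A.
  apply/subsetP => z; rewrite !inE => /andP[zv /(subsetP sB)].
  by rewrite !inE (negPf zv) orbF => /andP[].
have [m [km um Em]] := hA _ sB1.
have inm z : (z \in y ++ m ++ x) = (z \in W) || ((z != v) && (z \in B)).
  by have /setP/(_ z) := Em; rewrite inE => ->; rewrite !inE.
exists (m ++ x ++ c ++ y2 ++ m2'').
have E : y ++ (m ++ x ++ c ++ y2 ++ m2'') ++ x2 = (y ++ m ++ x) ++ (c ++ y2 ++ m2'' ++ x2).
  by rewrite -!catA.
split.
- have kx : kpath k ((x ++ c) ++ y2 ++ (m2'' ++ x2)).
    by apply: kpath_cat3; rewrite ?sy2 // -catA.
  have -> : y ++ (m ++ x ++ c ++ y2 ++ m2'') ++ x2 = (y ++ m) ++ x ++ (c ++ y2 ++ m2'' ++ x2).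
    by rewrite -!catA.
  by apply: kpath_cat3; rewrite ?sx // -?catA // catA.
- rewrite E; apply: cat_uniq_disjoint => // z; rewrite inm => h1 /hm2 /orP[zQ|/andP[/eqP zv vB]].
    case/orP: h1 => [|/andP[zv zB]]; first by apply/negP; exact: QW.
    by have := subsetP sB _ zB; rewrite !inE (negPf zv) orbF zQ.
  by move: h1; rewrite zv eqxx /= orbF (negPf vW).
- apply/setP => z; rewrite E inE mem_cat inm !inE.
  have -> : (z \in c ++ y2 ++ m2'' ++ x2) = (z \in Q) || ((z == v) && (v \in B)).
    by apply/idP/idP => /hm2.
  by have [->|zv] := eqVneq z v; rewrite /= ?orbF; case: (_ \in W); case: (_ \in Q); case: (_ \in B).
Qed.

(** The absorber lies in U and only the connection uses the larger Uc: this is how the moving end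
    passes from one ambient set to another. The old and the new end have the same constant [c], so
    steps can be iterated without loss. *)
Definition step_prop G k p (K : nat) g c : Prop :=
  forall (y x : seq G) (W A U Uc : {set G}) v,
    absorbing_path k y x W A -> U \subset Uc -> [disjoint Uc & W] ->
    extendable c p k Uc (rev x) -> v \notin W -> big g p 0 U -> big g p 1 (nb v :&: U) ->
    exists W' A' x', [/\ absorbing_path k y x' W' A', W \subset W' & W' \subset W :|: Uc] /\
      [/\ (#|W' :\: W| <= K)%N, extendable c p k (U :\: W') (rev x')
        & A :|: [set v] \subset W' :|: A'].

Lemma extendable_sub G c c' p k (U V : {set G}) s : 0 <= c' <= c -> 0 < p -> p <= 1 ->
  U \subset V -> extendable c p k U s -> extendable c' p k V s.
Proof. by move=> cc p0 p1 UV h j jk; apply: bigW (h j jk) => //; apply: setSI. Qed.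

Lemma eventually_step k J : (0 < k <= J)%N -> absorbing_prop R k J -> connecting_prop R k J ->
  exists K : nat, forall g : R, 0 < g -> exists2 c0 : R, 0 < c0 &
    forall c : R, 0 < c <= c0 -> eventually J (fun G p => step_prop G k p K g c).
Proof.
move=> /andP[k0 kJ] [K1 habs] [K2 hcon]; exists (K1 + K2)%N => g g0.
have g20 : 0 < g / 2 by lra.
have [c1 c10 {}habs] := habs _ g20.
(* The ends of an absorber are extendable with [c1]; deleting the vertices just used costs a factor
   2. *)
exists (c1 / 2); first by lra.
move=> c /andP[c_0 cc1]; have c20 : 0 < c / 2 by lra.
have M0 : 0 < 2 / g by pos.
apply: eventually_imp (eventually_and (eventually_and habs (hcon _ c20))
  (eventually_and (eventually_and (@eventually_extendable_setD R J k K1.+1 _ (leqW kJ) c_0)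
     (@eventually_extendable_setD R J k (K1 + K2) _ (leqW kJ) c10)) (@eventually_large_le R _ J 1 M0 isT))) _.
move=> G p p0 p1 n0 [[{}habs {}hcon] [[hD1 hD2] hM]] y x W A U Uc v st UUc dis gx vW hU hN.
have cc : 0 <= c <= c1 by apply/andP; split; lra.
have cc2 : 0 <= c <= c1 / 2 by apply/andP; split; lra.
have sUv : U :\ v \subset U by apply: subsetDl.
have hU' : big (g / 2) p 0 (U :\ v).
  move: hU; rewrite /big expr0 !mulr1 => hU.
  have : ##U <= ##(U :\ v) + 1.
    by rewrite natr1 ler_nat (cardsD1 v U) -addn1 addnC leq_add2l leq_b1.
  have pn : p ^+ 1 * ##G <= ##G by rewrite -[leRHS]mul1r; apply: ler_wpM2r.
  have := ler_wpM2l (ltW g20) (le_trans hM pn).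
  have -> : g / 2 * (2 / g) = 1 by field; rewrite lt0r_neq0.
  move: hU; have -> : g * ##G = g / 2 * ##G + g / 2 * ##G by field.
  by lra.
have hN' : big (g / 2) p 1 (nb v :&: (U :\ v)).
  have -> : nb v :&: (U :\ v) = nb v :&: U.
    apply/setP => z; rewrite !inE; have [->|//] := eqVneq z v.
    by rewrite sedge_irrefl.
  by apply: bigW hN => //; apply/andP; split; lra.
have vU' : v \notin U :\ v by rewrite !inE eqxx.
have [y2 [m2 [m2' [x2 [[sy2 sx2 sub sK] [ab gy2 gx2]]]]]] := habs _ _ vU' hU' hN'.
have [k1 k2 u1 pm] := ab.
pose Z := v |: [set z in y2 ++ m2 ++ x2].
have cZ : (#|Z| <= K1.+1)%N.
  rewrite /Z cardsU1 -addn1 addnC leq_add ?leq_b1 //.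
  by rewrite cardsE (card_uniqP u1).
have sx : size x = k by case: st.
have kx : kpath k x.
  case: st => _ /(_ set0 (sub0set _))[m [km _ _]]; exact: kpath_catr (kpath_catr km).
have ky2 : kpath k y2 by apply: kpath_catl k1.
have sUvc : U :\ v \subset Uc := subset_trans sUv UUc.
have gy2' : extendable c p k Uc y2 by apply: extendable_sub gy2.
have [c' [c'U uc' sc' kc']] := hcon (Uc :\: Z) x y2 sx sy2 kx ky2 (hD1 _ _ _ cZ gx) (hD1 _ _ _ cZ gy2').
set Q := c' ++ y2 ++ m2 ++ x2.
have QUc z : z \in Q -> z \in Uc.
  rewrite mem_cat => /orP[/c'U|/sub]; first by rewrite inE => /andP[].
  by apply/subsetP.
have uQ : uniq Q.
  apply: cat_uniq_disjoint => // z /c'U; rewrite !inE negb_or => /andP[/andP[_ nz] _] zS.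
  by rewrite zS in nz.
have vQ : v \notin Q.
  apply/negP; rewrite mem_cat => /orP[/c'U|/sub]; by rewrite !inE eqxx.
have QW z : z \in Q -> z \notin W by move/QUc => zU; rewrite (disjointFr dis zU).
have st' := absorbing_path_extend sy2 sx2 st ab kc' uQ vQ vW QW.
exists (W :|: [set z in Q]), ((A :\: [set z in Q]) :|: [set v]), x2; split; split=> //.
- exact: subsetUl.
- by apply: setUS; apply/subsetP => z; rewrite inE; apply: QUc.
- apply: leq_trans (_ : (size Q <= _)%N); last by rewrite size_cat addnC leq_add.
  apply: leq_trans (card_size Q); apply/subset_leq_card/subsetP => z; rewrite !inE.
  by case: (z \in W).
- have cQ : (#|[set z in Q]| <= K1 + K2)%N.
    by rewrite cardsE (card_uniqP uQ) size_cat addnC leq_add.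
  have -> : U :\: (W :|: [set z in Q]) = U :\: [set z in Q].
    apply/setP => z; rewrite in_setD in_setU negb_or in_setD.
    by case zU: (z \in U); rewrite ?andbF // (disjointFr dis (subsetP UUc _ zU)).
  have c11 : 0 <= c1 <= c1 by rewrite lexx ltW.
  exact: (extendable_sub cc2 p0 p1 (subxx _) (hD2 _ _ _ cQ (extendable_sub c11 p0 p1 sUv gx2))).
- by apply/subsetP => z; rewrite !inE; case: (z \in Q); case: (z \in W); case: (z \in A).
Qed.

Section Iterate.
Variables (G : sgraph) (k : nat) (p : R) (K : nat) (g c : R).
Hypothesis step : step_prop G k p K g c.

(** Each step covers a new target, so the iteration ends, and it stops only when U is nearly used up
    or every remaining target has few neighbours in the rest of U. *)
Lemma process_targets y (S U : {set G}) (x : seq G) (W A : {set G}) :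
  absorbing_path k y x W A -> extendable c p k (U :\: W) (rev x) ->
  exists W' A' x',
    [/\ absorbing_path k y x' W' A', W \subset W' & W' \subset W :|: U] /\
    [/\ (#|W' :\: W| <= K * #|S :\: (W :|: A)|)%N, extendable c p k (U :\: W') (rev x'),
        W :|: A \subset W' :|: A'
      & forall v, v \in S -> v \notin W' :|: A' ->
          ~~ (big g p 0 (U :\: W') && big g p 1 (nb v :&: (U :\: W')))].
Proof.
have [n] := ubnP #|S :\: (W :|: A)|; elim: n W A x => // n IH W A x ltn st gx.
have [|] := boolP [exists v in S :\: (W :|: A),
   big g p 0 (U :\: W) && big g p 1 (nb v :&: (U :\: W))]; last first.
  rewrite negb_exists_in => /forall_inP h; exists W, A, x; split; split=> //.
  - exact: subsetUl.
  - by rewrite setDv cards0.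
  - by move=> v vS vn; apply: h; rewrite inE vn.
case/existsP => v /and3P[vS hU hN].
have vW : v \notin W by move: vS; rewrite !inE negb_or => /andP[/andP[]].
have dis : [disjoint U :\: W & W] by rewrite disjoints_subset setDE subsetIr.
have [W1 [A1 [x1 [[st1 WW1 W1U] [cW1 gx1 AW1]]]]] := step st (subxx _) dis gx vW hU hN.
have W1U' : W1 \subset W :|: U by apply: subset_trans W1U _; apply: setUS; apply: subsetDl.
have cov : W :|: A \subset W1 :|: A1.
  rewrite subUset (subset_trans WW1 (subsetUl _ _)) /=.
  exact: subset_trans (subsetUl _ _) AW1.
have lt1 : (#|S :\: (W1 :|: A1)| < #|S :\: (W :|: A)|)%N.
  apply: proper_card; apply/properP; split; first exact: setDS.
  exists v => //; rewrite in_setD negb_and negbK (subsetP AW1) //.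
  by rewrite in_setU set11 orbT.
have gx1' : extendable c p k (U :\: W1) (rev x1).
  suff <- : (U :\: W) :\: W1 = U :\: W1 by [].
  by rewrite setDDl (setUidPr WW1).
have [W2 [A2 [x2 [[st2 WW2 W2U] [cW2 gx2 cov2 stop]]]]] := IH W1 A1 x1 (leq_trans lt1 ltn) st1 gx1'.
exists W2, A2, x2; split; split=> //.
- exact: subset_trans WW1 WW2.
- apply: subset_trans W2U _; rewrite subUset W1U' /=; exact: subsetUr.
- have -> : W2 :\: W = (W2 :\: W1) :|: (W1 :\: W).
    apply/setP => z; rewrite !inE; have /implyP := subsetP WW1 z; have /implyP := subsetP WW2 z.
    by case: (z \in W); case: (z \in W1); case: (z \in W2).
  apply: leq_trans (leq_card_setU _ _) _; apply: leq_trans (leq_add cW2 cW1) _.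
  by rewrite addnC -mulnS leq_mul.
- exact: subset_trans cov cov2.
Qed.

(** An auxiliary first step, absorbing [v0], moves the end of the path from Uc into U; its at most K
    vertices are the only ones used outside U. *)
Lemma process_in y (S U Uc : {set G}) (x : seq G) (W A : {set G}) v0 :
  absorbing_path k y x W A -> extendable c p k (Uc :\: W) (rev x) -> U \subset Uc ->
  v0 \notin W -> big g p 0 (U :\: W) -> big g p 1 (nb v0 :&: (U :\: W)) ->
  exists W' A' x',
    [/\ absorbing_path k y x' W' A', W \subset W', W' \subset W :|: Uc
       & extendable c p k (U :\: W') (rev x')] /\
    [/\ (#|W' :\: W| <= K * #|S :\: (W :|: A)|.+1)%N,
        (#|(W' :\: W) :\: U| <= K)%N, W :|: A \subset W' :|: A'
      & forall v, v \in S -> v \notin W' :|: A' ->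
          ~~ (big g p 0 (U :\: W') && big g p 1 (nb v :&: (U :\: W')))].
Proof.
move=> st gx UUc v0W hU hN.
have dis : [disjoint Uc :\: W & W] by rewrite disjoints_subset setDE subsetIr.
have [W1 [A1 [x1 [[st1 WW1 W1U] [cW1 gx1 AW1]]]]] :=
  step st (setSD _ UUc) dis gx v0W hU hN.
have cov : W :|: A \subset W1 :|: A1.
  rewrite subUset (subset_trans WW1 (subsetUl _ _)) /=.
  exact: subset_trans (subsetUl _ _) AW1.
have gx1' : extendable c p k (U :\: W1) (rev x1).
  suff <- : (U :\: W) :\: W1 = U :\: W1 by [].
  by rewrite setDDl (setUidPr WW1).
have [W2 [A2 [x2 [[st2 WW2 W2U] [cW2 gx2 cov2 stop]]]]] := process_targets S st1 gx1'.
have W1Uc : W1 \subset W :|: Uc by apply: subset_trans W1U _; apply: setUS; apply: subsetDl.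
exists W2, A2, x2; split; split=> //.
- exact: subset_trans WW1 WW2.
- apply: subset_trans W2U _; rewrite subUset W1Uc /=.
  exact: subset_trans UUc (subsetUr _ _).
- have -> : W2 :\: W = (W2 :\: W1) :|: (W1 :\: W).
    apply/setP => z; rewrite !inE; have /implyP := subsetP WW1 z; have /implyP := subsetP WW2 z.
    by case: (z \in W); case: (z \in W1); case: (z \in W2).
  apply: leq_trans (leq_card_setU _ _) _; rewrite mulnS addnC; apply: leq_add => //.
  apply: leq_trans cW2 _; rewrite leq_mul // subset_leq_card //; exact: setDS.
- apply: leq_trans cW1; apply/subset_leq_card/subsetP => z; rewrite !inE.
  move=> /and3P[zU zW /(subsetP W2U)]; rewrite in_setU (negPf zU) orbF => ->.
  by rewrite zW.
- exact: subset_trans cov cov2.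
Qed.

End Iterate.

End Process.

(** * Assembling the power of a Hamilton cycle *)

Section Hamilton.
Variable R : realType.
Implicit Types (G : sgraph) (p c d eta : R) (i j k J : nat).
Local Notation "## A" := (#|A|%:R : R) (at level 10, A at level 8).

Lemma eventually_start J c : 0 < c -> eventually J (fun G p => forall A U : {set G},
  big c p 0 A -> big (2 * c) p 0 U -> exists2 v, v \in A & big c p 1 (nb v :&: U)).
Proof.
move=> c0; have d0 : (0 : R) < 1 / 2 by lra.
apply: eventually_imp (eventually_typical J c0 d0) _ => G p p0 p1 n0 h A U hA hU.
have hU' : big c p 0 U by apply: bigW hU => //; apply/andP; split; lra.
have [_ l _ _] := h 0%N 0%N A U isT hA hU'.
have [||v vA hv] := almost_ex l; [lra|exact: big_gt0 hA|exists v => //].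
by have := big_nb p0 hU hv; have -> : 2 * c / 2 = c by field.
Qed.

(** A set of exponent J can be compared with a linear one, so it contains a vertex of typical
    degree. *)
Lemma eventually_few_low J c d : 0 < c -> 0 < d -> eventually J (fun G p => forall U L : {set G},
  big (2 * c) p 0 U -> (forall v, v \in L -> ~~ big c p 1 (nb v :&: U)) ->
  ##L <= d * p ^+ J * ##G).
Proof.
move=> c0 d0; pose e := Num.min (2 * c) d.
have e0 : 0 < e by rewrite lt_min d0 andbT; lra.
have [ec ed] : e <= 2 * c /\ e <= d by split; rewrite ge_min lexx ?orbT.
have h0 : (0 : R) < 1 / 2 by lra.
apply: eventually_imp (eventually_typical J e0 h0) _ => G p p0 p1 n0 h U L hU hL.
rewrite leNgt; apply/negP => lt.
have bL : big e p J L.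
  rewrite /big; apply: le_trans (ltW lt); rewrite -!mulrA; apply: ler_wpM2r => //; pos.
have bU : big e p 0 U by apply: bigW hU => //; rewrite ec ltW.
have [_ l _ _] := h J 0%N L U (eq_leq (addn0 J)) bL bU.
have [||v vL hv] := almost_ex l; [lra|exact: big_gt0 bL|].
have := big_nb p0 hU hv; have -> : 2 * c / 2 = c by field.
by apply/negP; exact: hL.
Qed.

Lemma card_setD_ge G (A B : {set G}) : ##A - ##B <= ##(A :\: B).
Proof.
rewrite lerBlDr -natrD ler_nat -(cardsID B A) addnC leq_add2l.
exact/subset_leq_card/subsetIr.
Qed.

Lemma card_setD_eq G (A B : {set G}) : A \subset B -> ##B = ##A + ##(B :\: A).
Proof. by move=> AB; rewrite -natrD -(cardsID A B) (setIidPr AB). Qed.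

(** [F 0] and [F 1] serve the last two rounds and [F 2] the closing of the cycle. Until its turn
    each loses only vertices of W1 and E, at most xi p^k n in all, so degrees and common
    neighbourhoods measured at the start survive. *)
Lemma eventually_power_hamilton k J : (0 < k <= J)%N ->
  absorbing_prop R k J -> connecting_prop R k J ->
  eventually J (fun G p => exists s : seq G, [/\ uniq s, forall z, z \in s,
    (k <= size s)%N, (3 <= size s)%N & kpath k (s ++ take k s)]).
Proof.
move=> /andP[k0 kJ] habs hcon; have kkJ : (0 < k <= J)%N by rewrite k0.
have [K0 hstep] := eventually_step kkJ habs hcon.
have [Ka {}habs] := habs; have [Kc {}hcon] := hcon.
have [K [K1 K0K KaK]] : exists K : R, [/\ 1 <= K, K0%:R <= K & Ka%:R <= K].
  by exists (K0 + Ka).+1%:R; rewrite ler1n !ler_nat; split=> //; lia.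
have Kp : 0 < K by lra.
(* The three reservoirs have at most 18 rho n vertices, so absorbing them costs at most 18 K rho n =
   (18 / 128) n. The at most 4 g n vertices left for [F 0] cost about 4 K g n = (rho / 16) n, a
   small part of it. *)
pose rho : R := 1 / (128 * K); pose g : R := rho / (64 * K).
have rho0 : 0 < rho by rewrite /rho; pos.
have g0 : 0 < g by rewrite /g; pos.
have Krho : K * rho = 1 / 128 by rewrite /rho; field; rewrite lt0r_neq0.
have Kg : K * g = rho / 64 by rewrite /g; field; rewrite lt0r_neq0.
have rho1 : rho <= 1 / 128 by rewrite -Krho -[leLHS]mul1r; apply: ler_wpM2r => //; try exact: ltW.
have grho : g <= rho / 64 by rewrite -Kg -[leLHS]mul1r; apply: ler_wpM2r => //; try exact: ltW.
have [ca ca0 {}habs] := habs g g0.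
have [c0 c00 {}hstep] := hstep g g0.
pose c := Num.min c0 (ca / 2).
have [cc0 cca] : c <= c0 /\ c <= ca / 2 by split; rewrite ge_min lexx ?orbT.
have c_0 : 0 < c by rewrite lt_min c00; lra.
have {}hstep := hstep c ltac:(by rewrite c_0).
(* [ca / 2] protects the common neighbourhoods of the fixed end [y], [rho / 16] the sizes of the
   reservoirs and the degrees into them. *)
pose xi := Num.min (ca / 2) (rho / 16).
have [xica xirho] : xi <= ca / 2 /\ xi <= rho / 16 by split; rewrite ge_min lexx ?orbT.
have xi0 : 0 < xi by rewrite lt_min; apply/andP; split; lra.
(* An exceptional set of d p^J n vertices then costs at most (xi / 8) p^k n, as k <= J. *)
pose d := xi / (8 * K).
have d0 : 0 < d by rewrite /d; pos.
have Kd : K * d = xi / 8 by rewrite /d; field; rewrite lt0r_neq0.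
have dg : d <= g.
  have : K * d <= K * g by rewrite Kd Kg; lra.
  by rewrite ler_pM2l.
have rho2 : 0 < rho / 2 by lra.
have M0 : 0 < 8 * K / xi by pos.
have r60 : 0 < 6 * rho by lra.
have three : (0 : R) < 3 by [].
apply: eventually_imp (eventually_and (eventually_and (eventually_and hstep habs)
   (eventually_and (hcon _ c_0) (@eventually_extendable_setD R J k Ka _ (leqW kJ) ca0)))
  (eventually_and (eventually_and (eventually_and (@eventually_large_le R _ J k M0 (leqW kJ)) (@eventually_large_le R 3 J 1 three isT))
     (eventually_and (@eventually_disjoint R 3 J 0 _ isT r60 isT) (eventually_degree R J)))
   (eventually_and (eventually_start J g0) (eventually_and (eventually_few_low J g0 d0) (eventually_few_low J rho2 d0))))) _.
move=> G p p0 p1 n0 [[[{}hstep {}habs] [{}hcon hD]] [[[hM h3] [hdis dgr]] [hst [hlow hlow2]]]].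
set N := ##G in n0 hM h3 dgr *.
pose X := p ^+ k * N; pose P := p * N.
have X0 : 0 < X by rewrite /X; pos.
have KX : 8 * K <= xi * X.
  have := ler_wpM2l (ltW xi0) hM; rewrite -/X.
  by have -> : xi * (8 * K / xi) = 8 * K by field; rewrite lt0r_neq0.
have PN : P <= N by rewrite -[leRHS]mul1r; apply: ler_wpM2r => //; try exact: ltW.
have XjX j : (j <= k)%N -> X <= p ^+ j * N.
  by move=> jk; apply: ler_wpM2r; [exact: ltW|apply: ler_wiXn2l => //; exact: ltW].
have XP : X <= P by have := XjX 1%N k0; rewrite expr1.
have XJX : p ^+ J * N <= X by apply: ler_wpM2r; [exact: ltW|apply: ler_wiXn2l => //; exact: ltW].
have b0 (a : R) (A : {set G}) : big a p 0 A = (a * N <= ##A) by rewrite /big expr0 mulr1.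
have b1 (a : R) (A : {set G}) : big a p 1 A = (a * P <= ##A) by rewrite /big expr1 -mulrA.
have hKd (x : R) : x <= d * p ^+ J * N -> K * x <= xi / 8 * X.
  move=> h; apply: le_trans (ler_wpM2l (ltW Kp) h) _.
  have -> : K * (d * p ^+ J * N) = K * d * (p ^+ J * N) by ring.
  rewrite Kd.
  by apply: ler_wpM2l => //; lra.
have dX : d * p ^+ J * N <= g * N.
  rewrite -mulrA; apply: ler_pM => //; [exact: ltW|by pos|].
  exact: le_trans XJX (le_trans XP PN).
have xiXN : xi * X <= rho / 16 * N.
  by apply: ler_pM => //; [exact: ltW|exact: ltW|exact: le_trans XP PN].
have xiXP : xi * X <= rho / 16 * P by apply: ler_pM => //; exact: ltW.
have rN : 0 < rho * N by pos.
have rP : 0 < rho * P by rewrite /P; pos.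
have P0' : 0 <= P by rewrite /P; pos.
have N0' : 0 <= N by exact: ltW.
have gN0 : 0 <= g * N by pos.
have gN : g * N <= rho / 64 * N by apply: ler_wpM2r => //; try exact: ltW.
have gP : g * P <= rho / 64 * P by apply: ler_wpM2r => //; rewrite /P; pos.
have rhoN : rho * N <= 1 / 128 * N by apply: ler_wpM2r => //; try exact: ltW.
have rhoP : rho * P <= 1 / 128 * P by apply: ler_wpM2r => //; rewrite /P; pos.
have [||F [_ F2 F3 F4]] := hdis (fun=> setT) (fun=> 0%N) => //.
  by move=> i _; rewrite b0 cardsT -[leRHS]mul1r; apply: ler_wpM2r => //; move: rho1; clear; lra.
have F2' i : (i < 3)%N -> rho * N <= ##(F i).
  by move=> i3; have := F2 i i3; rewrite b0; have -> : 6 * rho / (2 * 3) = rho by field.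
have F4' i : (i < 3)%N -> ##(F i) <= 6 * (rho * N).
  by move=> i3; have := F4 i i3; rewrite expr0 mulr1 -mulrA.
pose V1 := F 0%N :|: F 1%N :|: F 2%N; pose V2 := ~: V1.
have cV1 : ##V1 <= 18 * (rho * N).
  have : ##V1 <= ##(F 0%N) + ##(F 1%N) + ##(F 2%N).
    rewrite -!natrD ler_nat; apply: leq_trans (leq_card_setU _ _) _.
    by rewrite leq_add2r leq_card_setU.
  by have := F4' 0%N isT; have := F4' 1%N isT; have := F4' 2%N isT; clear; lra.
have cV2 : N - 18 * (rho * N) <= ##V2.
  by have := card_setD_ge [set: G] V1; move: cV1; rewrite setTD cardsT -/V2 -/N; clear; lra.
have sV1 i : (i < 3)%N -> F i \subset V1.
  case: i => [|[|[|//]]] _; rewrite /V1.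
  - exact: subset_trans (subsetUl _ _) (subsetUl _ _).
  - exact: subset_trans (subsetUr _ _) (subsetUl _ _).
  - exact: subsetUr.
have nF i j z : (i < j < 3)%N -> z \in F i -> z \in F j -> False.
  by move=> ij zi zj; have := disjointFr (F3 i j ij) zi; rewrite zj.
(* the initial absorber, built inside the set reserved for closing the cycle *)
have [v0 v0V2 hv0] : exists2 v, v \in V2 & big g p 1 (nb v :&: F 2%N).
  by apply: hst; rewrite b0; [move: cV2 gN rhoN N0' | have := F2' 2%N isT; move: gN rN]; clear; lra.
have v0F : v0 \notin F 2%N by apply: contraL v0V2 => /(subsetP (sV1 2%N isT)) h; rewrite /V2 in_setC h.
have bF2 : big g p 0 (F 2%N) by rewrite b0; have := F2' 2%N isT; move: gN rN; clear; lra.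
have [y [m0 [m0' [x0 [[sy sx0 sub0 sK0] [ab0 gy gx0]]]]]] := habs _ _ v0F bF2 hv0.
pose W0 := [set z in y ++ m0 ++ x0].
have cW0 : (#|W0| <= Ka)%N.
  by apply: leq_trans sK0; rewrite /W0 cardsE; apply: card_size.
have st0 : absorbing_path k y x0 W0 [set v0].
  by apply: absorbing_path_init ab0 => //; apply: contra v0F; apply: sub0.
have W0N : ##W0 <= K by apply: le_trans KaK; rewrite ler_nat.
have gx0' : extendable c p k ([set: G] :\: W0) (rev x0).
  apply: extendable_sub (hD _ _ _ cW0 gx0) => //; last by apply: setSD; apply: subsetT.
  by rewrite ltW.
(* vertices with few neighbours in the first two reservoirs are absorbed first *)
pose B1 := [set v | ~~ big (rho / 2) p 1 (nb v :&: F 0%N) || ~~ big (rho / 2) p 1 (nb v :&: F 1%N)].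
have cB1 : K * ##B1 <= xi / 4 * X.
  have l i : (i < 3)%N -> K * ##[set v | ~~ big (rho / 2) p 1 (nb v :&: F i)] <= xi / 8 * X.
    move=> i3; apply: hKd; apply: (hlow2 (F i)); last by move=> v; rewrite inE.
    by rewrite b0; have := F2' i i3; have -> : 2 * (rho / 2) = rho by field.
  have : ##B1 <= ##[set v | ~~ big (rho / 2) p 1 (nb v :&: F 0%N)]
               + ##[set v | ~~ big (rho / 2) p 1 (nb v :&: F 1%N)].
    rewrite -natrD ler_nat; apply: leq_trans (leq_card_setU _ _).
    by apply/subset_leq_card/subsetP => v; rewrite !inE.
  move/(ler_wpM2l (ltW Kp)); rewrite mulrDr.
  by have := l 0%N isT; have := l 1%N isT; clear; lra.
have cnt (W W' : {set G}) m : (#|W' :\: W| <= K0 * m.+1)%N -> ##(W' :\: W) <= K * m%:R + K.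
  move=> h; have -> : K * m%:R + K = K * m.+1%:R by rewrite -natr1; ring.
  apply: (@le_trans _ _ ((K0 * m.+1)%:R)); first by rewrite ler_nat.
  by rewrite natrM; apply: ler_wpM2r.
have cntS (S' S : {set G}) : (#|S' :\: S| <= #|S'|)%N by apply/subset_leq_card/subsetDl.
have bT0 : 2 * g * N <= ##([set: G] :\: W0).
  by have := card_setD_ge [set: G] W0; rewrite cardsT -/N; move: W0N KX xiXN gN rhoN N0'; clear; lra.
have u0B := bT0.
have [u0 u0W hu0] : exists2 v, v \in [set: G] :\: W0 & big g p 1 (nb v :&: ([set: G] :\: W0)).
  by apply: hst; rewrite b0; move: u0B gN0; clear; lra.
have u0n : u0 \notin W0 by move: u0W; rewrite in_setD => /andP[].
have u0b : big g p 0 ([set: G] :\: W0) by rewrite b0; move: u0B gN0; clear; lra.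
have [W1 [A1 [x1 [[st1 W01 _ gx1] [cW1 _ _ stop1]]]]] :=
  process_in hstep B1 st0 gx0' (subxx _) u0n u0b hu0.
have w1 : ##W1 + K <= xi * X.
  have := cnt _ _ _ cW1; have := card_setD_eq W01.
  have : K * ##(B1 :\: (W0 :|: [set v0])) <= K * ##B1.
    by apply: ler_wpM2l; [exact: ltW | rewrite ler_nat; exact: cntS].
  by move: cB1 KX W0N K1 X0 xiXN; clear; nra.
have nbD (v : G) (U W : {set G}) : ##(nb v :&: U) - ##W <= ##(nb v :&: (U :\: W)).
  by rewrite setIDA; apply: card_setD_ge.
(* The ambient set is the whole graph without the few vertices of W1, where all degrees are still
   close to p n, so no target is left out. *)
have cov1 v : v \in B1 -> v \in W1 :|: A1.
  move=> vB; apply: contraT => /(stop1 v vB)/negP[]; rewrite b0 b1.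
  have := card_setD_ge [set: G] W1; rewrite cardsT -/N.
  have := nbD v setT W1; rewrite setIT dgr -/P => h1 h2.
  by move: h1 h2 w1 xiXN xiXP gN gP rhoN rhoP N0' P0' K1 PN; clear; lra.
(* The reservoir vertices are made optional while V2 is nearly intact, so that whatever remains of
   them at the end can be absorbed. *)
have bV2 : 2 * g * N <= ##(V2 :\: W1) by have := card_setD_ge V2 W1; move: cV2 w1 K1 xiXN gN rhoN N0'; clear; lra.
have u1B := bV2.
have [u1 u1W hu1] : exists2 v, v \in V2 :\: W1 & big g p 1 (nb v :&: (V2 :\: W1)).
  by apply: hst; rewrite b0; move: u1B gN0; clear; lra.
have u1n : u1 \notin W1 by move: u1W; rewrite in_setD => /andP[].
have u1b : big g p 0 (V2 :\: W1) by rewrite b0; move: u1B gN0; clear; lra.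
have [W2 [A2 [x2 [[st2 W12 _ gx2] [cW2 cE cov12 stop2]]]]] :=
  process_in hstep V1 st1 gx1 (subsetT V2) u1n u1b hu1.
set E := (W2 :\: W1) :\: V2 in cE.
have EK : ##E <= K by apply: le_trans K0K; rewrite ler_nat.
have w2 : ##W2 <= xi * X + 18 / 128 * N.
  have := cnt _ _ _ cW2; have := card_setD_eq W12.
  have : K * ##(V1 :\: (W1 :|: A1)) <= K * (18 * (rho * N)).
    by apply: ler_wpM2l; [exact: ltW | apply: le_trans cV1; rewrite ler_nat; exact: cntS].
  have -> : K * (18 * (rho * N)) = 18 / 128 * N.
    by have -> : K * (18 * (rho * N)) = 18 * (K * rho) * N by [ring]; rewrite Krho; field.
  by move: w1; clear; lra.
have bV22 : 2 * g * N <= ##(V2 :\: W2) by have := card_setD_ge V2 W2; move: cV2 w2 K1 xiXN gN rhoN N0'; clear; lra.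
have l1 : ##(V1 :\: (W2 :|: A2)) <= d * p ^+ J * N.
  apply: (hlow (V2 :\: W2)); first by rewrite b0.
  move=> v; rewrite in_setD => /andP[vn vV1]; have := stop2 v vV1 vn.
  by rewrite b0 (_ : g * N <= _) //; move: bV22 gN0; clear; lra.
have u2B := bV22.
have [u2 u2W hu2] : exists2 v, v \in V2 :\: W2 & big g p 1 (nb v :&: (V2 :\: W2)).
  by apply: hst; rewrite b0; move: u2B gN0; clear; lra.
have u2n : u2 \notin W2 by move: u2W; rewrite in_setD => /andP[].
have u2b : big g p 0 (V2 :\: W2) by rewrite b0; move: u2B gN0; clear; lra.
have [W3 [A3 [x3 [[st3 W23 W3s gx3] [_ _ cov23 stop3]]]]] :=
  process_in hstep V2 st2 gx2 (subxx _) u2n u2b hu2.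
have l2 : ##(V2 :\: (W3 :|: A3)) <= 2 * g * N.
  have [h|h] := lerP (2 * g * N) (##(V2 :\: W3)).
    have : ##(V2 :\: (W3 :|: A3)) <= d * p ^+ J * N.
      apply: (hlow (V2 :\: W3)); first by rewrite b0.
      move=> v; rewrite in_setD => /andP[vn vV2]; have := stop3 v vV2 vn.
      by rewrite b0 (_ : g * N <= _) //; move: h gN0; clear; lra.
    by move: dX gN0; clear; lra.
  apply: le_trans (ltW h); rewrite ler_nat; apply/subset_leq_card/setDS; exact: subsetUl.
have l3 : ##(setT :\: (W3 :|: A3)) <= 4 * g * N.
  have : ##(setT :\: (W3 :|: A3)) <= ##(V1 :\: (W2 :|: A2)) + ##(V2 :\: (W3 :|: A3)).
    rewrite -natrD ler_nat; apply: leq_trans (leq_card_setU _ _).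
    apply/subset_leq_card/subsetP => z; rewrite in_setD in_setT andbT => zn.
    rewrite in_setU !in_setD.
    rewrite zn /= /V2 in_setC; case: (z \in V1); rewrite ?orbT //= andbT orbF.
    by apply: contra zn; apply: subsetP.
  by move: l1 l2 dX gN0; clear; lra.
(* [E] consists of the at most K vertices used when the end passed from the whole graph into V2. *)
have inW3 z : z \in V1 -> z \in W3 -> z \in W1 :|: E.
  move=> zV1 /(subsetP W3s); rewrite !in_setU /V2 in_setC zV1 orbF => zW2.
  by rewrite /E 2!in_setD zW2 /V2 in_setC zV1 andbT orbN.
have cardF i (W : {set G}) : (i < 3)%N -> (forall z, z \in F i -> z \in W -> z \in W1 :|: E) ->
    rho * N - xi * X <= ##(F i :\: W).
  move=> i3 h; apply: (@le_trans _ _ (##(F i :\: (W1 :|: E)))); last first.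
    rewrite ler_nat; apply/subset_leq_card/subsetP => z; rewrite !in_setD => /andP[zn zF].
    by rewrite zF andbT; apply: contra zn; apply: h.
  have := card_setD_ge (F i) (W1 :|: E); have := F2' i i3.
  have : ##(W1 :|: E) <= ##W1 + ##E by rewrite -natrD ler_nat leq_card_setU.
  by move: EK w1; clear; lra.
have f03 : rho * N - xi * X <= ##(F 0%N :\: W3).
  by apply: cardF => // z /(subsetP (sV1 0%N isT)); apply: inW3.
have u3B : 2 * g * N <= ##(F 0%N :\: W3).
  by move: f03 gN0 gN rN xiXN N0'; clear; lra.
have [u3 u3W hu3] : exists2 v, v \in F 0%N :\: W3 & big g p 1 (nb v :&: (F 0%N :\: W3)).
  by apply: hst; rewrite b0; move: u3B gN0; clear; lra.
have u3n : u3 \notin W3 by move: u3W; rewrite in_setD => /andP[].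
have u3b : big g p 0 (F 0%N :\: W3) by rewrite b0; move: u3B gN0; clear; lra.
have gx3' : extendable c p k ((F 0%N :|: V2) :\: W3) (rev x3).
  apply: extendable_sub gx3 => //; first by rewrite lexx ltW.
  by apply: setSD; apply: subsetUr.
have [W4 [A4 [x4 [[st4 W34 W4s gx4] [cW4 _ cov34 stop4]]]]] :=
  process_in hstep setT st3 gx3' (subsetUl _ _) u3n u3b hu3.
have w4 : ##(W4 :\: W3) <= rho / 16 * N + xi / 8 * X.
  have := cnt _ _ _ cW4.
  have := ler_wpM2l (ltW Kp) l3.
  have -> : K * (4 * g * N) = 4 * (K * g) * N by ring.
  by rewrite Kg; move: KX K1; clear; lra.
have f04 : 2 * g * N <= ##(F 0%N :\: W4).
  have := card_setD_ge (F 0%N :\: W3) (W4 :\: W3).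
  have : ##(F 0%N :\: W3 :\: (W4 :\: W3)) <= ##(F 0%N :\: W4).
    rewrite ler_nat; apply/subset_leq_card/subsetP => z; rewrite !in_setD => /and3P[].
    by rewrite negb_and negbK => + zn ->; rewrite (negPf zn) /= andbT.
  by move: w4 f03 xiXN gN rN N0'; clear; lra.
have l4 : ##(setT :\: (W4 :|: A4)) <= d * p ^+ J * N.
  apply: (hlow (F 0%N :\: W4)); first by rewrite b0.
  move=> v; rewrite in_setD => /andP[vn vT]; have := stop4 v vT vn.
  by rewrite b0 (_ : g * N <= _) //; move: f04 gN0; clear; lra.
have inW4 i z : (0 < i < 3)%N -> z \in F i -> z \in W4 -> z \in W1 :|: E.
  move=> /andP[i0 i3] zF zW; have zV1 := subsetP (sV1 i i3) z zF; apply: inW3 => //.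
  move: (subsetP W4s z zW); rewrite !in_setU /V2 in_setC zV1 orbF => /orP[//|z0].
  by case: (nF 0%N i z _ z0 zF); rewrite i0.
(* so few vertices are left that the second reservoir stays almost intact *)
have f14 : rho * N - xi * X <= ##(F 1%N :\: W4).
  by apply: cardF => // z; apply: inW4.
have u4B : 2 * g * N <= ##(F 1%N :\: W4).
  by move: f14 gN0 gN rN xiXN N0'; clear; lra.
have [u4 u4W hu4] : exists2 v, v \in F 1%N :\: W4 & big g p 1 (nb v :&: (F 1%N :\: W4)).
  by apply: hst; rewrite b0; move: u4B gN0; clear; lra.
have u4n : u4 \notin W4 by move: u4W; rewrite in_setD => /andP[].
have u4b : big g p 0 (F 1%N :\: W4) by rewrite b0; move: u4B gN0; clear; lra.
have gx4' : extendable c p k ((F 0%N :|: F 1%N) :\: W4) (rev x4).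
  apply: extendable_sub gx4 => //; first by rewrite lexx ltW.
  by apply: setSD; apply: subsetUl.
have [W5 [A5 [x5 [[st5 W45 W5s gx5] [cW5 _ cov45 stop5]]]]] :=
  process_in hstep setT st4 gx4' (subsetUr _ _) u4n u4b hu4.
have w5 : ##(W5 :\: W4) <= xi / 4 * X.
  by have := cnt _ _ _ cW5; have := hKd _ l4; move: KX K1; clear; lra.
(* Vertices of [B1] are covered already. Any other v started with (rho / 2) p n neighbours in [F 1],
   and [F 1] has lost too few vertices to change this much. *)
have cov5 v : v \in W5 :|: A5.
  apply: contraT => vn; have := stop5 v (in_setT v) vn => /negP[].
  have vB1 : v \notin B1.
    apply: contra vn => /cov1 h; apply: (subsetP cov45); apply: (subsetP cov34).
    by apply: (subsetP cov23); apply: (subsetP cov12).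
  move: vB1; rewrite inE negb_or !negbK => /andP[_ hv].
  rewrite b1 in hv; rewrite b0 b1.
  have s5 : F 1%N :\: (W1 :|: E :|: (W5 :\: W4)) \subset F 1%N :\: W5.
    apply/subsetP => z; rewrite !in_setD 2!in_setU => /andP[zn zF]; rewrite zF andbT.
    apply: contra zn => z5; rewrite in_setD z5 andbT; case z4: (z \in W4); rewrite ?orbT //.
    by have := inW4 1%N z isT zF z4; rewrite in_setU => ->.
  have cZ : ##(W1 :|: E :|: (W5 :\: W4)) <= ##W1 + ##E + ##(W5 :\: W4).
    rewrite -!natrD ler_nat; apply: leq_trans (leq_card_setU _ _) _.
    by rewrite leq_add2r leq_card_setU.
  have := nbD v (F 1%N) (W1 :|: E :|: (W5 :\: W4)).
  have : ##(nb v :&: (F 1%N :\: (W1 :|: E :|: (W5 :\: W4)))) <= ##(nb v :&: (F 1%N :\: W5)).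
    by rewrite ler_nat; apply/subset_leq_card/setIS.
  have := card_setD_ge (F 1%N) (W1 :|: E :|: (W5 :\: W4)).
  have : ##(F 1%N :\: (W1 :|: E :|: (W5 :\: W4))) <= ##(F 1%N :\: W5).
    by rewrite ler_nat; apply/subset_leq_card.
  have := F2' 1%N isT => a1 a2 a3 a4 a5.
  by move: a1 a2 a3 a4 a5 cZ hv w1 w5 EK xiXN xiXP gN gP rN rP K1 P0' XP; clear; lra.
have inW5 z : z \in F 2%N -> z \in W5 -> z \in W1 :|: E.
  move=> zF zW; apply: (inW4 2%N) => //.
  move: (subsetP W5s z zW); rewrite !in_setU => /or3P[//|z0|z1].
    by case: (nF 0%N 2%N z).
  by case: (nF 1%N 2%N z).
have gy5 : extendable c p k (F 2%N :\: W5) y.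
  move=> j jk; rewrite /big; have := gy j jk; rewrite /big -/N => gyj.
  have s5 : (F 2%N :&: cnb (take j y)) :\: (W1 :|: E) \subset (F 2%N :\: W5) :&: cnb (take j y).
    apply/subsetP => z; rewrite in_setD !in_setI in_setD => /and3P[zn zF ->]; rewrite zF !andbT.
    by apply: contra zn; apply: inW5.
  have := card_setD_ge (F 2%N :&: cnb (take j y)) (W1 :|: E).
  have : ##(F 2%N :&: cnb (take j y) :\: (W1 :|: E)) <= ##((F 2%N :\: W5) :&: cnb (take j y)).
    by rewrite ler_nat; apply/subset_leq_card.
  have : ##(W1 :|: E) <= ##W1 + ##E by rewrite -natrD ler_nat leq_card_setU.
  have h1 : xi * X <= ca / 2 * (p ^+ j * N).
    by apply: ler_pM => //; [exact: ltW | exact: ltW | exact: XjX].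
  have h2 : c * (p ^+ j * N) <= ca / 2 * (p ^+ j * N).
    by apply: ler_wpM2r => //; pos.
  by move=> a1 a2 a3; move: gyj a1 a2 a3 w1 EK h1 h2; rewrite -!mulrA; clear; lra.
pose U := (F 1%N :|: F 2%N) :\: W5.
have gxU : extendable c p k U (rev x5).
  apply: extendable_sub gx5 => //; first by rewrite lexx ltW.
  by apply: setSD; apply: subsetUl.
have gyU : extendable c p k U y.
  apply: extendable_sub gy5 => //; first by rewrite lexx ltW.
  by apply: setSD; apply: subsetUr.
have [sx5 hst5] := st5.
have [mm [kmm umm Emm]] := hst5 set0 (sub0set _).
have [m [mU um _ km]] := hcon U x5 y sx5 sy (kpath_catr (kpath_catr kmm)) (kpath_catl kmm) gxU gyU.
(* Every vertex outside W5 is optional by now; those that the closing path [m] does not use are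
   absorbed. *)
have sB : ~: W5 :\: [set z in m] \subset A5.
  apply/subsetP => z; rewrite in_setD in_setC => /andP[_ zW].
  by have := cov5 z; rewrite in_setU (negPf zW).
have [l [kl ul El]] := hst5 _ sB.
have inl z : (z \in y ++ l ++ x5) = (z \notin m).
  have /setP/(_ z) := El; rewrite inE => ->; rewrite !inE.
  case zm: (z \in m) => /=; last by rewrite orbN.
  by have := mU z zm; rewrite inE => /andP[/negPf->].
have us : uniq ((y ++ l ++ x5) ++ m).
  by apply: cat_uniq_disjoint => // z; rewrite inl => /negPf->.
have als z : z \in (y ++ l ++ x5) ++ m by rewrite mem_cat inl orNb.
exists ((y ++ l ++ x5) ++ m); split=> //.
- by rewrite !size_cat sy -!addnA leq_addr.
- have := uniq_leq_size (enum_uniq G) (fun z _ => als z); rewrite -cardE; apply: leq_trans.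
  by rewrite -(ler_nat R); move: h3 PN; rewrite expr1 -/N; exact: le_trans.
- rewrite -catA take_size_cat // -!catA catA; apply: kpath_cat3; rewrite ?sx5 //.
  by rewrite -catA.
Qed.

End Hamilton.

(** * From eigenvalues to the edge estimate *)

Section Spectral.
Variable R : realType.
Implicit Types (G : sgraph) (p c d eta : R).
Local Notation "## A" := (#|A|%:R : R) (at level 10, A at level 8).
Local Open Scope sesquilinear_scope.

Local Notation f := (real_complex R).

Definition sqnorm n (w : 'rV[R[i]]_n) : R[i] := \sum_j `|w 0 j| ^+ 2.

Lemma sqnormE n (w : 'rV[R[i]]_n) : sqnorm w = (w *m w^t*) 0 0.
Proof. by rewrite mxE; apply: eq_bigr => j _; rewrite !mxE normCK. Qed.

Lemma sqnorm_real n (v : 'rV[R]_n) :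
  sqnorm (map_mx f v) = f (\sum_j v 0 j ^+ 2).
Proof.
rewrite rmorph_sum; apply: eq_bigr => j _; rewrite mxE normCK rmorphXn /= expr2.
by congr (_ * _); apply/eqP; rewrite eq_complex /= oppr0 !eqxx.
Qed.

Lemma sqnorm_unitary n (w : 'rV[R[i]]_n) (P : 'M[R[i]]_n) :
  P \is unitarymx -> sqnorm (w *m P) = sqnorm w.
Proof.
move=> uP; rewrite !sqnormE trmx_mul map_mxM /= mulmxA.
by rewrite mulmxtVK.
Qed.

Lemma char_poly_conj n (P : 'M[R[i]]_n) (D : 'rV[R[i]]_n) : P \in unitmx ->
  char_poly (invmx P *m diag_mx D *m P) = \prod_i ('X - (D 0 i)%:P).
Proof.
move=> uP; pose Q := map_mx (@polyC R[i]) P; pose Q' := map_mx (@polyC R[i]) (invmx P).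
have QQ : Q' *m Q = 1%:M by rewrite -map_mxM mulVmx // map_mx1.
rewrite /char_poly.
have -> : char_poly_mx (invmx P *m diag_mx D *m P) = Q' *m char_poly_mx (diag_mx D) *m Q.
  by rewrite /char_poly_mx mulmxBr mulmxBl !map_mxM scalar_mxC -(mulmxA _%:M) QQ mulmx1.
rewrite !det_mulmx mulrAC -det_mulmx QQ det1 mul1r.
rewrite -[\det _]/(char_poly _) char_poly_trig ?diag_mx_is_trig //.
by apply: eq_bigr => i _; rewrite mxE eqxx mulr1n.
Qed.

(** In an orthonormal eigenbasis the coordinates [u] of the all-ones vector vanish unless the
    eigenvalue is d. As all entries but the first are at most lam < d in absolute value, a single
    index i0 remains, and orthogonality to the all-ones vector makes the coordinate of v there
    vanish. *)
Lemma spectral_bound n (A : 'M[R]_n) (s : seq R) (d lam : R) (v : 'rV[R]_n) :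
  A^T = A -> char_poly A = \prod_(x <- s) ('X - x%:P) ->
  const_mx 1 *m A = d *: (const_mx 1 : 'rV_n) ->
  (forall x, x \in behead s -> `|x| <= lam) -> lam < d -> \sum_j v 0 j = 0 ->
  \sum_j (v *m A) 0 j ^+ 2 <= lam ^+ 2 * \sum_j v 0 j ^+ 2.
Proof.
move=> symA chA oneA hs ltd v0; pose B : 'M[R[i]]_n := map_mx f A.
have hB : B \is hermsymmx.
  apply: realsym_hermsym.
    by apply/is_hermitianmxP; rewrite expr0 scale1r map_mx_id // map_trmx symA.
  by apply/mxOverP => i j; rewrite mxE; apply/complex_realP; exists (A i j).
have /orthomx_spectralP defB := hermitian_normalmx hB.
have uP := spectral_unitarymx B; have iP := spectral_unit B.
set P := spectralmx B in defB uP iP; set D := spectral_diag B in defB.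
have invP : invmx P = P^t* by apply: invmx_unitary.
pose V := map_mx f v; pose w := V *m P^t*.
have uPt : P^t* \is unitarymx by rewrite trmxC_unitary.
have PtP : P^t* *m P = 1%:M by rewrite -invP mulVmx.
have PPt : P *m P^t* = 1%:M by apply/unitarymxP.
have qw : sqnorm w = sqnorm V by apply: sqnorm_unitary.
have qVB : sqnorm (map_mx f (v *m A)) = \sum_j `|w 0 j| ^+ 2 * `|D 0 j| ^+ 2.
  rewrite map_mxM -/V -/B defB invP !mulmxA -/w (sqnorm_unitary _ uP).
  rewrite /sqnorm; apply: eq_bigr => j _; rewrite mul_mx_diag mxE normrM exprMn //.
pose o : 'rV[R[i]]_n := const_mx 1; pose u := o *m P^t*.
have hu j : u 0 j * D 0 j = f d * u 0 j.
  have oB : o *m B = f d *: o.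
    have := congr1 (map_mx f) oneA; rewrite map_mxM map_mxZ.
    by have -> : map_mx f (const_mx 1 : 'rV_n) = o by apply/matrixP => a b; rewrite !mxE rmorph1.
  have : (u *m diag_mx D) = f d *: u.
    have := congr1 (fun M : 'rV[R[i]]_n => M *m P^t*) oB; rewrite defB invP !mulmxA -/u.
    by rewrite -(mulmxA _ P) PPt mulmx1 -scalemxAl.
  by move/matrixP/(_ 0 j); rewrite mul_mx_diag !mxE.
have wu : \sum_j w 0 j * (u 0 j)^* = 0.
  have : w *m u^t* = V *m o^t*.
    rewrite /w /u trmx_mul map_mxM /= trmxCK mulmxA -(mulmxA V) PtP mulmx1 //.
  move/matrixP/(_ 0 0); rewrite !mxE => E.
  transitivity (f (\sum_j v 0 j)); last by rewrite v0 rmorph0.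
  rewrite -[LHS](_ : \sum_j w 0 j * (u^t*) j 0 = _); last first.
    by apply: eq_bigr => j _; rewrite !mxE.
  by rewrite E rmorph_sum; apply: eq_bigr => j _; rewrite !mxE conjC1 mulr1.
have [n0|n0] := posnP n.
  by rewrite !big1 ?mulr0 // => -[j ltj]; exfalso; rewrite n0 in ltj.
have pe : perm_eq [seq D 0 i | i <- enum 'I_n] [seq f x | x <- s].
  apply: prod_XsubC_eq; rewrite big_map big_enum /= -(char_poly_conj D iP) -defB [RHS]big_map.
  rewrite -[B]/(map_mx f A) -map_char_poly chA rmorph_prod; apply: eq_bigr => x _.
  by rewrite rmorphB /= map_polyX map_polyC.
case: s hs chA pe => [|s0 s] hs chA pe.
  by have := perm_size pe; rewrite size_map size_enum_ord => E; rewrite E in n0.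
have [i0 i0D] : exists i0, D 0 i0 = f s0.
  have : f s0 \in [seq D 0 i | i <- enum 'I_n] by rewrite (perm_mem pe) mem_head.
  by case/mapP => i _ ->; exists i.
(* Multiplicities matter: with one index removed for the first entry, the others carry exactly the
   rest of the spectrum. *)
have pe' : perm_eq [seq D 0 i | i <- rem i0 (enum 'I_n)] [seq f x | x <- s].
  rewrite -(perm_cons (f s0)) -[f s0 :: map f s]/(map f (s0 :: s)).
  apply: perm_trans pe; rewrite perm_sym -i0D.
  have i0e : i0 \in enum 'I_n by rewrite mem_enum.
  by rewrite -[_ :: map _ _]/(map (fun i => D 0 i) (i0 :: rem i0 (enum 'I_n))); apply/perm_map/perm_to_rem.
have Dle i : i != i0 -> `|D 0 i| <= f lam.
  move=> ii0; have : D 0 i \in [seq f x | x <- s].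
    rewrite -(perm_mem pe'); apply/mapP; exists i => //.
    by rewrite mem_rem_uniq ?enum_uniq // inE ii0 mem_enum.
  case/mapP => x xs ->; rewrite normc_def /= expr0n addr0 sqrtr_sqr lecR.
  exact: hs.
have u0 i : i != i0 -> u 0 i = 0.
  move=> /Dle h; apply/eqP; apply: contraTT ltd => ui; rewrite -leNgt.
  have Di : D 0 i = f d by apply: (mulfI ui); rewrite hu mulrC.
  move: h; rewrite Di normc_def /= expr0n addr0 sqrtr_sqr lecR.
  by apply: le_trans; apply: ler_norm.
have ui0 : u 0 i0 != 0.
  apply/eqP => h; have uz : u = 0.
    by apply/rowP => j; rewrite [RHS]mxE; have [->//|/u0] := eqVneq j i0.
  have : o = 0 by rewrite -[o]mulmx1 -PtP mulmxA -/u uz mul0mx.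
  by move/rowP/(_ i0); rewrite !mxE => /eqP; rewrite oner_eq0.
have w0 : w 0 i0 = 0.
  move: wu; rewrite (bigD1 i0) //= big1 ?addr0; last by move=> j /u0->; rewrite conjC0 mulr0.
  by move/eqP; rewrite mulf_eq0 conjC_eq0 (negPf ui0) orbF => /eqP.
rewrite -lecR rmorphM /= -!sqnorm_real qVB -/V -qw /sqnorm mulr_sumr.
apply: ler_sum => j _; have [->|/Dle h] := eqVneq j i0.
  by rewrite w0 normr0 expr0n mul0r mulr0.
rewrite mulrC; apply: ler_wpM2r; first by rewrite exprn_ge0.
have l0 : 0 <= f lam := le_trans (normr_ge0 _) h.
by rewrite rmorphXn /=; apply: lerXn2r; rewrite ?nnegrE.
Qed.

(** Cauchy-Schwarz, from the nonnegative sum of the (a_i s - y_i t)^2; y^2 = y turns the squared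
    norm of y into its sum. *)
Lemma cauchy_indicator n (a y : 'I_n -> R) : (forall i, y i ^+ 2 = y i) ->
  (\sum_i a i * y i) ^+ 2 <= (\sum_i a i ^+ 2) * \sum_i y i.
Proof.
move=> yy.
have E (s t : R) : \sum_i (a i * s - y i * t) ^+ 2
    = s ^+ 2 * (\sum_i a i ^+ 2) - 2 * s * t * (\sum_i a i * y i) + t ^+ 2 * \sum_i y i.
  rewrite !mulr_sumr -sumrB -big_split /=; apply: eq_bigr => i _.
  transitivity (s ^+ 2 * a i ^+ 2 - 2 * s * t * (a i * y i) + t ^+ 2 * y i ^+ 2); first by ring.
  by rewrite yy.
set s := \sum_i y i; set t := \sum_i a i * y i.
have s0 : 0 <= s by apply: sumr_ge0 => i _; rewrite -yy sqr_ge0.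
have h : \sum_i (a i * s - y i * t) ^+ 2 = s * ((\sum_i a i ^+ 2) * s - t ^+ 2).
  by rewrite E -/s -/t; ring.
have : 0 <= s * ((\sum_i a i ^+ 2) * s - t ^+ 2).
  by rewrite -h; apply: sumr_ge0 => i _; apply: sqr_ge0.
have [s1|s1] := ltrP 0 s; first by rewrite pmulr_rge0 // subr_ge0.
have sz : s = 0 by apply/le_anti; rewrite s1 s0.
have yz i : y i = 0.
  have /eqP := sz; rewrite /s psumr_eq0; last by move=> k _; rewrite -yy sqr_ge0.
  by move/allP/(_ i); rewrite mem_index_enum => /(_ isT)/eqP.
by move=> _; rewrite sz mulr0 /t big1 ?expr0n // => i _; rewrite yz mulr0.
Qed.

Lemma sum_enum_val G (F : G -> R) : \sum_(x : G) F x = \sum_(i < #|G|) F (enum_val i).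
Proof. by rewrite (reindex (@enum_val G G)) //; exact/onW_bij/enum_val_bij. Qed.

Lemma edges_adjmx G (X Y : {set G}) :
  edges R X Y = \sum_(j < #|G|) (\sum_(i < #|G|) (enum_val i \in X)%:R * adjmx R G i j)
                  * (enum_val j \in Y)%:R.
Proof.
rewrite edges_cards exchange_big /= big_mkcond /= sum_enum_val.
apply: eq_bigr => j _; case: (_ \in Y); rewrite ?mulr1 ?mulr0 //.
rewrite big_mkcond /= sum_enum_val; apply: eq_bigr => i _.
by rewrite mxE; case: (_ \in X); rewrite ?mul1r ?mul0r.
Qed.

Lemma card_sum G (X : {set G}) : ##X = \sum_(i < #|G|) (enum_val i \in X)%:R.
Proof.
rewrite -sum1_card natr_sum big_mkcond /= sum_enum_val.
by apply: eq_bigr => i _; case: (_ \in X).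
Qed.

(** In the sorted spectrum x lies between the second and the last entry, so one of these is at least
    as large in absolute value. *)
Lemma adj_spectrum_behead G (x : R) :
  x \in behead (adj_spectrum R G) -> `|x| <= graph_lambda R G.
Proof.
set s := adj_spectrum R G => xs.
have ss : size s = #|G| by apply: size_adj_spectrum.
have srt : sorted >=%R s by apply: adj_spectrum_sorted.
move/(nthP 0): xs => [i lti <-]; rewrite nth_behead; rewrite size_behead in lti.
have tr : transitive (>=%R : rel R) by move=> a b c /[swap]; apply: le_trans.
have rf : reflexive (>=%R : rel R) by move=> a /=.
have lt1 : (i.+1 < size s)%N by rewrite -ltn_predRL.
have lt0 : (1 < size s)%N by apply: leq_ltn_trans lt1.
have ltl : (#|G|.-1 < size s)%N by rewrite ss prednK // -ss; apply: ltn_trans lt0.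
have le1 : (i.+1 <= #|G|.-1)%N by rewrite -ss ltn_predRL.
have h1 : s`_i.+1 <= s`_1.
  by apply: (sorted_leq_nth tr rf 0 srt); rewrite ?inE.
have h2 : s`_(#|G|.-1) <= s`_i.+1.
  by apply: (sorted_leq_nth tr rf 0 srt); rewrite ?inE.
rewrite /graph_lambda -/s le_max ler_norml.
have [x0|x0] := lerP 0 s`_i.+1.
  apply/orP; left; have := ler_norm s`_1; have := normr_ge0 s`_1; lra.
by apply/orP; right; rewrite ltr0_norm //; have := ler_norm (- s`_(#|G|.-1)); rewrite normrN; lra.
Qed.

(** With v the indicator of X minus its mean, the deviation is the inner product of vA and the
    indicator of Y, and |v|^2 = |X| - |X|^2 / n <= |X|. *)
Lemma lambda_mixing G (d : nat) (lam : R) (X Y : {set G}) :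
  (0 < #|G|)%N -> regular G d -> graph_lambda R G <= lam -> lam < d%:R ->
  (edges R X Y - d%:R / ##G * ##X * ##Y) ^+ 2 <= lam ^+ 2 * (##X * ##Y).
Proof.
move=> n0 reg gl ltd; have N0 : 0 < ##G by rewrite ltr0n.
pose A := adjmx R G; pose x (i : 'I_#|G|) : R := (enum_val i \in X)%:R; pose y (i : 'I_#|G|) : R := (enum_val i \in Y)%:R.
pose m := ##X / ##G; pose v : 'rV[R]_#|G| := \row_i (x i - m).
have sx : \sum_i x i = ##X by rewrite card_sum.
have sy : \sum_i y i = ##Y by rewrite card_sum.
have mN : m * ##G = ##X by rewrite /m divfK ?lt0r_neq0.
have colA j : \sum_i A i j = d%:R.
  rewrite -(reg (enum_val j)) (card_sum [set y : G | sedge (enum_val j) y]).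
  by apply: eq_bigr => i _; rewrite mxE inE sedge_sym.
have oneA : const_mx 1 *m A = d%:R *: (const_mx 1 : 'rV_#|G|).
  apply/rowP => j; rewrite !mxE mulr1 -(colA j); apply: eq_bigr => i _.
  by rewrite mxE mul1r.
have v0 : \sum_j v 0 j = 0.
  under eq_bigr do rewrite mxE.
  by rewrite sumrB sx sumr_const card_ord -[m *+ _]mulr_natr mN subrr.
have hs z : z \in behead (adj_spectrum R G) -> `|z| <= lam.
  by move/adj_spectrum_behead/le_trans; apply.
have key := spectral_bound (tr_adjmx R G) (adj_spectrum_char_poly R G) oneA hs ltd v0.
have vA j : (v *m A) 0 j = \sum_i x i * A i j - m * d%:R.
  rewrite mxE; under eq_bigr do rewrite mxE mulrBl.
  by rewrite sumrB -mulr_sumr colA.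
have -> : edges R X Y - d%:R / ##G * ##X * ##Y = \sum_j (v *m A) 0 j * y j.
  rewrite edges_adjmx; under [RHS]eq_bigr do rewrite vA mulrBl.
  rewrite sumrB -mulr_sumr sy; congr (_ - _); rewrite /m; ring.
have yy i : y i ^+ 2 = y i by rewrite /y; case: (_ \in Y); rewrite ?expr1n ?expr0n.
have xx i : x i ^+ 2 = x i by rewrite /x; case: (_ \in X); rewrite ?expr1n ?expr0n.
apply: le_trans (cauchy_indicator _ yy) _; rewrite sy mulrA.
apply: ler_wpM2r => //; apply: le_trans key _; apply: ler_wpM2l; first exact: sqr_ge0.
have -> : \sum_j v 0 j ^+ 2 = ##X - m * ##X.
  transitivity (\sum_j (x j - 2 * m * x j + m ^+ 2)).
    apply: eq_bigr => j _; rewrite mxE.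
    transitivity (x j ^+ 2 - 2 * m * x j + m ^+ 2); first by ring.
    by rewrite xx.
  rewrite big_split sumrB /= -mulr_sumr sx sumr_const card_ord -[_ *+ #|_|]mulr_natr.
  by transitivity (##X - 2 * m * ##X + m * (m * ##G)); [ring | rewrite mN; ring].
by rewrite gerBl mulr_ge0 // /m divr_ge0.
Qed.

(* Here [eta < 1] and [d <= n] give [lambda < d], so that no Perron bound on the
   largest eigenvalue is needed. *)
Lemma ndl_jumbled G (n d : nat) (lam eta : R) (J : nat) : (0 < d)%N -> 0 < eta < 1 ->
  ndl_graph n d lam G -> lam ^+ 2 <= eta * (d%:R / n%:R) ^+ (J + 2) * n%:R ^+ 2 ->
  jumbled G (d%:R / n%:R) J eta.
Proof.
move=> d0 /andP[eta0 eta1] [n0 cG reg gl] hlam; rewrite -cG in n0 hlam *.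
have N0 : 0 < ##G by rewrite ltr0n.
have D0 : 0 < d%:R :> R by rewrite ltr0n.
have dn : d%:R <= ##G.
  have /card_gt0P[v _] := n0; rewrite ler_nat -(reg v); exact: max_card.
have p0 : 0 < d%:R / ##G by rewrite divr_gt0.
have p1 : d%:R / ##G <= 1 by rewrite ler_pdivrMr // mul1r.
have pn : d%:R / ##G * ##G = d%:R by rewrite divfK ?lt0r_neq0.
have lam0 : 0 <= lam by apply: le_trans gl; rewrite le_max normr_ge0.
have ltd : lam < d%:R.
  rewrite -(@ltr_pXn2r _ 2) ?nnegrE //; apply: le_lt_trans hlam _.
  have -> : eta * (d%:R / ##G) ^+ (J + 2) * ##G ^+ 2 = eta * (d%:R / ##G) ^+ J * (d%:R / ##G * ##G) ^+ 2.
    by rewrite exprD exprMn; ring.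
  rewrite pn gtr_pMl ?exprn_gt0 //.
  have Q1 : (d%:R / ##G) ^+ J <= 1 by apply: exprn_ile1 => //; exact: ltW.
  by apply: le_lt_trans eta1; rewrite -[leRHS]mulr1; apply: ler_wpM2l => //; exact: ltW.
split=> // [v|X Y].
  by rewrite pn -(reg v).
apply: le_trans (lambda_mixing X Y n0 reg gl ltd) _.
by apply: ler_wpM2r => //; apply: mulr_ge0.
Qed.

End Spectral.

(** * From cyclic power paths to powers of a Hamilton cycle *)

(** [a] counts the steps forward and [b] those backward; having [b] on the left avoids
    subtraction. *)
Lemma cycle_walk n (x : 'I_n) (w : seq 'I_n) :
  path (@cycle_edge n) x w ->
  exists a b, (a + b <= size w)%N /\ (last x w + b = x + a %[mod n])%N.
Proof.
elim: w x => [|z w IH] x /=; first by exists 0%N, 0%N.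
move=> /andP[/andP[_ xz] /IH[a [b [ab E]]]].
case/orP: xz => /eqP h.
  exists a.+1, b; split; first by rewrite addSn.
  by rewrite E h /= modnDml addSnnS.
exists a, b.+1; split; first by rewrite addnS.
rewrite addnS -addSn -[in RHS](modnDml x) h /= modn_mod modnDml addSn.
by rewrite -addn1 -modnDml E modnDml addn1.
Qed.

(** Vertices at distance at most k on the cycle differ by some t <= k modulo n. If i + t runs past
    the end of [s], the adjacency is read in the appended copy of its first k entries. *)
Lemma power_hamilton_of_kpath (G : sgraph) k (s : seq G) : uniq s -> (forall z, z \in s) ->
  (k <= size s)%N -> (3 <= size s)%N -> kpath k (s ++ take k s) -> contains_ham_power k G.
Proof.
move=> us als ks s3 kp.
have sG : size s = #|G|.
  by rewrite -(card_uniqP us); apply: eq_card => z; rewrite als.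
split; first by rewrite -sG.
have x0 : G by case: s s3 {us als ks kp sG}.
pose f (i : 'I_#|G|) := nth x0 s i.
have near (i j : 'I_#|G|) t : (t <= k)%N -> i != j -> (j = i + t %[mod #|G|])%N -> sedge (f i) (f j).
  move=> tk ij E; have iG := ltn_ord i; have jG := ltn_ord j.
  have t0 : (0 < t)%N.
    rewrite lt0n; apply: contra ij => /eqP t0; move: E; rewrite t0 addn0 !modn_small //.
    by move=> h; apply/eqP/val_inj; rewrite /= h.
  have tG : (t <= #|G|)%N by rewrite -sG; apply: leq_trans ks.
  have szt : size (s ++ take k s) = (#|G| + k)%N by rewrite size_cat size_takel // sG.
  have := elimT (kpathP k x0 _) kp i (i + t)%N; rewrite szt leq_add2l tk.
  have -> : (i < i + t < #|G| + k)%N.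
    by rewrite -{1}[nat_of_ord i]addn0 ltn_add2l t0 /= -addSn leq_add.
  move=> /(_ isT isT); rewrite !nth_cat sG iG.
  rewrite (modn_small jG) in E.
  case: ltnP => h; first by rewrite /f E modn_small.
  have lt : (i + t - #|G| < #|G|)%N by rewrite ltn_subLR // -addSn leq_add.
  have -> : (i + t - #|G|)%N = j by rewrite E -{2}(subnK h) modnDr modn_small.
  rewrite nth_take //; rewrite E -(subnK h) modnDr modn_small //.
  by rewrite ltn_subLR //; apply: leq_trans (leq_add iG tk); rewrite addSn.
have finj : injective f.
  by move=> i j /eqP; rewrite /f nth_uniq ?sG // => /eqP/val_inj.
exists f; first by apply: inj_card_bij => //; rewrite card_ord.
move=> x y /power_edgeP[xy [w [wk pw lw]]].
have [a [b [ab E]]] := cycle_walk pw; rewrite lw in E.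
have [ba|ba] := leqP b a.
  apply: (near x y (a - b)%N) => //; first by apply: leq_trans wk; apply: leq_trans (leq_subr _ _) _; apply: leq_trans (leq_addr _ _) ab.
  by apply/eqP; rewrite -(eqn_modDr b) -addnA subnK //; apply/eqP.
rewrite sedge_sym; apply: (near y x (b - a)%N); rewrite 1?eq_sym //.
  by apply: leq_trans wk; apply: leq_trans (leq_subr _ _) _; apply: leq_trans (leq_addl _ _) ab.
by apply/eqP; rewrite -(eqn_modDr a) -addnA subnK ?(ltnW ba) //; apply/eqP.
Qed.

(** * Real exponents and the conclusion *)

Section PowerBounds.
Variable R : realType.

(** Squaring makes the half-integral exponents integral, and eps <= 1 replaces eps^2 by eps. *)
Lemma sqr_powR_bound (eps lam : R) (n d m : nat) (u w : R) :
  0 <= eps <= 1 -> 0 <= lam -> (0 < n)%N -> u * 2 = m%:R -> w * 2 = 2 - m%:R ->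
  lam <= eps * d%:R `^ u * n%:R `^ w ->
  lam ^+ 2 <= eps * (d%:R / n%:R) ^+ m * n%:R ^+ 2.
Proof.
move=> /andP[e0 e1] l0 n0 hu hw h; have N0 : 0 < n%:R :> R by rewrite ltr0n.
have Ed : (d%:R `^ u) ^+ 2 = d%:R ^+ m :> R.
  by rewrite -powR_mulrn ?powR_ge0 // -powRrM hu powR_mulrn.
have En : (n%:R `^ w) ^+ 2 = n%:R ^+ 2 / n%:R ^+ m :> R.
  rewrite -powR_mulrn ?powR_ge0 // -powRrM hw powRD; last by rewrite lt0r_neq0 // implybT.
  by rewrite powRN !powR_mulrn.
apply: (@le_trans _ _ ((eps * d%:R `^ u * n%:R `^ w) ^+ 2)).
  by apply: lerXn2r => //; rewrite nnegrE // !mulr_ge0 ?powR_ge0.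
rewrite !exprMn Ed En exprVn.
have -> : eps ^+ 2 * d%:R ^+ m * (n%:R ^+ 2 / n%:R ^+ m) = eps ^+ 2 * (d%:R ^+ m / n%:R ^+ m * n%:R ^+ 2) by ring.
rewrite -[leRHS]mulrA; apply: ler_wpM2r; last by rewrite expr2 -[leRHS]mulr1 ler_wpM2l.
by rewrite mulr_ge0 ?divr_ge0 ?exprn_ge0.
Qed.

End PowerBounds.

Theorem corollary4 (R : realType) (k : nat) (hk : (2 <= k)%N) :
  exists eps : R, 0 < eps /\
    forall (n d : nat) (lambda : R) (G : sgraph),
      (1 <= d)%N -> ndl_graph n d lambda G ->
      (lambda <= eps * d%:R `^ (5 / 2) * n%:R `^ (- (3 / 2)) ->
         contains_ham_power 2 G) /\
      (lambda <= eps * d%:R `^ (3 * k%:R / 2) * n%:R `^ (1 - 3 * k%:R / 2) ->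
         contains_ham_power k G).
Proof.
have con2 : connecting_prop R 2 3 := @connecting_of_left R 2 3 3 isT isT (@left_prop_2 R).
have [e2 e20 h2] := @eventually_power_hamilton R 2 3 isT (absorbing_2 con2) con2.
have [ek ek0 hkk] : exists2 eta : R, 0 < eta & forall G p, jumbled G p (3 * k - 2) eta ->
    exists s : seq G, [/\ uniq s, forall z, z \in s,
      (k <= size s)%N, (3 <= size s)%N & kpath k (s ++ take k s)].
  (* For k = 2 the second hypothesis corresponds to J = 4, which implies the case J = 3 already
     settled. *)
  have [->|k3] := eqVneq k 2%N.
    by exists e2 => // G p jG; apply: h2; apply: jumbled_mono jG _ _.
  have {hk k3} hk : (2 < k)%N by rewrite ltn_neqAle eq_sym k3.
  apply: eventually_power_hamilton; first by lia.
    by apply: absorbing_gt2; lia.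
  by apply: (@connecting_of_left _ _ _ 0); [lia|lia|apply: left_prop_gt2; lia].
pose eps := Num.min (1 / 2) (Num.min e2 ek).
have [eps1 eps2 epsk] : [/\ eps <= 1 / 2, eps <= e2 & eps <= ek].
  by rewrite /eps !ge_min !lexx ?orbT.
have eps0 : 0 < eps by rewrite !lt_min e20 ek0 !andbT; lra.
exists eps; split=> // n d lam G d0 ndl.
have [n0 _ _ gl] := ndl.
have lam0 : 0 <= lam by apply: le_trans gl; rewrite le_max normr_ge0.
have e01 : 0 <= eps <= 1 by apply/andP; split; lra.
have e01' : 0 < eps < 1 by apply/andP; split; lra.
split=> h.
  have h5 : 5 / 2 * 2 = 5%:R :> R by field.
  have h3 : - (3 / 2) * 2 = 2 - 5%:R :> R by field.
  have hl := sqr_powR_bound e01 lam0 n0 h5 h3 h.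
  have jG := ndl_jumbled d0 e01' ndl (J := 3) hl.
  have [s [us als ks s3 kp]] := h2 _ _ (jumbled_mono jG eps2 (leqnn _)).
  exact: power_hamilton_of_kpath kp.
have E : (3 * k - 2 + 2)%N = (3 * k)%N by rewrite subnK // (leq_trans hk) // leq_pmull.
have Ek : (3 * k)%:R = 3 * k%:R :> R by rewrite natrM.
have h1 : 3 * k%:R / 2 * 2 = (3 * k)%:R :> R by rewrite Ek; field.
have h3 : (1 - 3 * k%:R / 2) * 2 = 2 - (3 * k)%:R :> R by rewrite Ek; field.
have hl := sqr_powR_bound e01 lam0 n0 h1 h3 h.
rewrite -E in hl; have jG := ndl_jumbled d0 e01' ndl hl.
have [s [us als ks s3 kp]] := hkk _ _ (jumbled_mono jG epsk (leqnn _)).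
exact: power_hamilton_of_kpath kp.
Qed.
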